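(* Let $\omega\in\Omega$ be a period of the function $[z]$ (i.e. $[\omega]=0$). Let $\tau^{(0)}(x)$ and $\tau^{(1)}(x)$ be nonzero meromorphic functions on $H_{\omega}$ and $H_{\omega+\delta}$, respectively. Suppose that $$\frac{\tau^{(0)}(x\pm a_1\delta)}{\tau^{(0)}(x\pm a_2\delta)}=\frac{[(a_0\pm a_1|x)]}{[(a_0\pm a_2|x)]}\quad(x\in H_{\omega})$$ for any $C_3$-frame $\{\pm a_0,\pm a_1,\pm a_2\}$ of type $\mathrm{II}_1$ with $(\phi|a_0)=1$ (and $(\phi|a_1)=(\phi|a_2)=0$), and $$[(a_1\pm a_2|x)]\tau^{(0)}(x-a_0\delta)\tau^{(1)}(x+a_0\delta)+[(a_2\pm a_0|x)]\tau^{(0)}(x-a_1\delta)\tau^{(1)}(x+a_1\delta)+[(a_0\pm a_1|x)]\tau^{(0)}(x-a_2\delta)\tau^{(1)}(x+a_2\delta)=0\quad(x\in H_{\omega+\delta/2})$$ for any $C_3$-frame $\{\pm a_0,\pm a_1,\pm a_2\}$ with $(\phi|a_0)=(\phi|a_1)=(\phi|a_2)=\frac12$. Then there exists a unique hypergeometric $\tau$-function $\tau=\tau(x)$ on $D_\omega=\bigsqcup_{n\in\mathbb{Z}}H_{\omega+n\delta}$ such that its components $\tau^{(n)}=\tau|_{H_{\omega+n\delta}}$ satisfy $\tau^{(n)}(x)=0$ for $n<0$ and $$\tau^{(0)}(x)=\tau(x)\quad(x\in H_\omega),\qquad \tau^{(1)}(x)=\tau(x)\quad(x\in H_{\omega+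\delta}).$$
   Context: Let $V=\mathbb{C}^8$ with canonical basis $v_0,\ldots,v_7$ and the symmetric $\mathbb{C}$-bilinear form $(\cdot|\cdot)$ with $(v_i|v_j)=\delta_{ij}$. Put $\phi=\frac12(v_0+\cdots+v_7)$ and $P=\{a\in\mathbb{Z}^8\cup(\phi+\mathbb{Z}^8): (\phi|a)\in\mathbb{Z}\}$ (the $E_8$ root lattice). For $\kappa\in\mathbb{C}$ put $H_\kappa=\{x\in V:(\phi|x)=\kappa\}$. A $C_3$-frame is a set $\{\pm a_0,\pm a_1,\pm a_2\}\subset V$ of six vectors such that $(a_i|a_j)=\delta_{ij}$, $a_i\pm a_j\in P$ for $i<j$ and $2a_i\in P$. It is of type $\mathrm{II}_1$ if the multiset of the values $(\phi|a)$, $a$ in the frame, is $\{1,-1,0,0,0,0\}$. Fix a nonzero entire function $[z]$ satisfying $[\beta\pm\gamma][z\pm\alpha]+[\gamma\pm\alpha][z\pm\beta]+[\alpha\pm\beta][z\pm\gamma]=0$ for all $z,\alpha,\beta,\gamma\in\mathbb{C}$, where $[\alpha\pm\beta]=[\alpha+\beta][\alpha-\beta]$. Let $\Omega=\{\omega\in\mathbb{C}:[\omega]=0\}$ and fix $\delta\neq0$ in $\mathbb{C}$ with $\mathbb{Z}\delta\cap\Omega=\{0\}$. Double signs denote products: $\tau(x\pm a\delta)=\tau(x+a\delta)\tau(x-a\delta)$, $[(a\pm b|x)]=[(a+b|x)][(a-b|x)]$. For $D\subseteq V$ with $D+P\delta=D$, a function $\tau$ on $D$ is an ORG $\tau$-function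 if for all $C_3$-frames $\{\pm a,\pm b,\pm c\}$ $$[(b\pm c|x)]\tau(x\pm a\delta)+[(c\pm a|x)]\tau(x\pm b\delta)+[(a\pm b|x)]\tau(x\pm c\delta)=0$$ for all $x$ such that the points $x\pm a\delta,x\pm b\delta,x\pm c\delta$ lie in $D$. A meromorphic ORG $\tau$-function $\tau$ on $D_\omega$ is a hypergeometric $\tau$-function if, with $\tau^{(n)}=\tau|_{H_{\omega+n\delta}}$, one has $\tau^{(n)}=0$ for $n<0$ and $\tau^{(0)}\not\equiv0$. *)

(* Defs.v *)
From HB Require Import structures.
From mathcomp Require Import all_boot all_order all_algebra.
From mathcomp Require Import complex.
From mathcomp Require Import all_classical all_reals all_analysis.

Set Implicit Arguments.
Unset Strict Implicit.
Unset Printing Implicit Defensive.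

Import Order.TTheory GRing.Theory Num.Theory.
Import numFieldNormedType.Exports.

Local Open Scope classical_set_scope.
Local Open Scope ring_scope.

(* Typing R[i] as a numClosedFieldType gives access to the topology and the
   normed-module structure that MathComp-Analysis puts on every numFieldType;
   [differentiable] is then differentiability over the complex numbers. *)
Definition Cplx (R : realType) : numClosedFieldType := complex R.

Definition Vec (R : realType) := 'rV[Cplx R]_8.

Section Analysis.
Variable R : realType.
Local Notation C := (Cplx R).

Definition holomorphic_on (W : normedModType C) (U : set W) (g : W -> C) : Prop :=
  forall y, U y -> differentiable g y.

Definition entire (f : C -> C) : Prop := holomorphic_on [set: C] f.

(* A meromorphic function is represented by a total function on the ambient
   space, whose values outside the domain E, or on a nowhere dense subset of E,
   are irrelevant.  Every identity between meromorphic functions on E is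
   therefore understood on a dense, relatively open subset of E. *)
Definition generically (W : normedModType C) (E : set W) (Q : W -> Prop) : Prop :=
  exists U : set W, [/\ open U, E `<=` closure (E `&` U) &
    forall x, E x -> U x -> Q x].

(* Used for E a locally finite disjoint union of parallel affine hyperplanes:
   the holomorphic functions on a relatively open subset of E are then locally
   the restrictions of holomorphic functions of the ambient space.
   The condition that h is generically nonzero on E `&` U says that h is not a
   zero divisor there. *)
Definition meromorphic_on (W : normedModType C) (E : set W) (f : W -> C) : Prop :=
  forall x, E x -> exists U : set W, exists g h : W -> C,
    [/\ open U, U x, holomorphic_on U g, holomorphic_on U h &
        generically (E `&` U) (fun y => h y != 0 /\ f y = g y / h y)].

Definition eq_mero (W : normedModType C) (E : set W) (f g : W -> C) : Prop :=
  generically E (fun x => f x = g x).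

Definition nonzero_meromorphic_on (W : normedModType C) (E : set W)
    (f : W -> C) : Prop :=
  meromorphic_on E f /\ ~ eq_mero E f (fun=> 0).

End Analysis.

Section E8.
Variable R : realType.
Local Notation C := (Cplx R).
Local Notation V := (Vec R).

Definition dot (u v : V) : C := \sum_(i < 8) u 0 i * v 0 i.

Definition phi : V := const_mx (2^-1 : C).

Definition Z8 : set V := [set a | forall i, exists n : int, a 0 i = n%:~R].

Definition E8_lattice : set V :=
  [set a | (Z8 a \/ Z8 (a - phi)) /\ exists n : int, dot phi a = n%:~R].

Definition hyperplane (kappa : C) : set V := [set x | dot phi x = kappa].

Definition D_omega (omega delta : C) : set V :=
  [set x | exists n : int, hyperplane (omega + n%:~R * delta) x].

(* {+-a0, +-a1, +-a2} is a C_3-frame; orthonormality makes the six vectors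
   pairwise distinct. *)
Definition C3_frame (a0 a1 a2 : V) : Prop :=
  [/\ [/\ dot a0 a0 = 1, dot a1 a1 = 1 & dot a2 a2 = 1],
      [/\ dot a0 a1 = 0, dot a0 a2 = 0 & dot a1 a2 = 0],
      [/\ E8_lattice (a0 + a1), E8_lattice (a0 + a2) & E8_lattice (a1 + a2)],
      [/\ E8_lattice (a0 - a1), E8_lattice (a0 - a2) & E8_lattice (a1 - a2)] &
      [/\ E8_lattice (a0 *+ 2), E8_lattice (a1 *+ 2) & E8_lattice (a2 *+ 2)]].

Definition C3_frame_II1 (a0 a1 a2 : V) : Prop :=
  C3_frame a0 a1 a2 /\
  perm_eq [seq dot phi a | a <- [:: a0; - a0; a1; - a1; a2; - a2]]
          [:: 1; -1; 0; 0; 0; 0].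

End E8.

Section Tau.
Variable R : realType.
Local Notation C := (Cplx R).
Local Notation V := (Vec R).
Variable br : C -> C.

Definition br_pm (u v : C) : C := br (u + v) * br (u - v).

Definition three_term : Prop :=
  forall z alpha beta gamma : C,
    br_pm beta gamma * br_pm z alpha + br_pm gamma alpha * br_pm z beta
      + br_pm alpha beta * br_pm z gamma = 0.

Definition zeros : set C := [set omega | br omega = 0].

Definition br_dot (a b x : V) : C := br (dot (a + b) x) * br (dot (a - b) x).

Variable delta : C.

Definition tau_pm (tau : V -> C) (a x : V) : C :=
  tau (x + delta *: a) * tau (x - delta *: a).

Definition both_in (D : set V) (a : V) : set V :=
  [set x | D (x + delta *: a) /\ D (x - delta *: a)].

Definition ORG_tau (D : set V) (tau : V -> C) : Prop :=
  forall a b c : V, C3_frame a b c ->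
    eq_mero (both_in D a `&` both_in D b `&` both_in D c)
      (fun x => br_dot b c x * tau_pm tau a x + br_dot c a x * tau_pm tau b x
                + br_dot a b x * tau_pm tau c x)
      (fun=> 0).

Definition hypergeometric_tau (omega : C) (tau : V -> C) : Prop :=
  [/\ meromorphic_on (D_omega omega delta) tau,
      ORG_tau (D_omega omega delta) tau,
      forall n : int, n < 0 ->
        eq_mero (hyperplane (omega + n%:~R * delta)) tau (fun=> 0) &
      ~ eq_mero (hyperplane omega) tau (fun=> 0)].

End Tau.

(* The domain D_omega satisfies the standing assumption D + P delta = D. *)
Lemma dotDr (R : realType) (u v w : Vec R) : dot u (v + w) = dot u v + dot u w.
Proof. by rewrite -big_split; apply: eq_bigr => i _; rewrite mxE mulrDr. Qed.

Lemma dotZr (R : realType) (c : Cplx R) (u v : Vec R) : dot u (c *: v) = c * dot u v.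
Proof. by rewrite mulr_sumr; apply: eq_bigr => i _; rewrite mxE mulrCA. Qed.

Lemma D_omega_shift (R : realType) (omega delta : Cplx R) :
  [set y | exists x p, [/\ D_omega omega delta x, E8_lattice p & y = x + delta *: p]]
  = D_omega omega delta.
Proof.
apply/seteqP; split => [_ [x [p [[n xn] [_ [m pm]] ->]]]|x xD].
  exists (n + m); rewrite /hyperplane /= dotDr dotZr pm.
  by rewrite (xn : dot _ _ = _) intrD mulrDl addrA (mulrC delta).
exists x, 0; split=> //; last by rewrite scaler0 addr0.
split; first by left=> i; exists 0; rewrite mxE.
by exists 0; rewrite /dot big1 // => i _; rewrite !mxE mulr0.
Qed.

(* Main.v *)
(* Write f, g, h for three consecutive components tau^(n-1), tau^(n), tau^(n+1).  Sorting
   the frames by the values (phi|a) splits the ORG equations into relations of types I,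
   II_0, II_1 and II_2 on single hyperplanes.  If f is generically nonzero, one relation
   II_1, for one frame, can be solved for h.  It remains to see that all the other
   relations follow.  Each II_0 relation for g is a combination of three relations I
   between f and g; the other relations II_1 with the same unit vector a then follow from
   the three-term identity; and relations I for two auxiliary frames carry II_1 from the
   unit vector (phi + u - v)/2 to (phi + u - w)/2 whenever u, v, w is a frame of type I.
   Writing a = (phi + r)/2 with r a root orthogonal to phi, these moves connect all the
   roots r, which is checked by enumeration.  II_2 is a combination of two relations II_1,
   and relation I between g and h of three relations II_1, so the construction goes on.
   The initial relations come from the hypothesis on the ratios of tau^(0), the relation
   II_2 at omega holding since a + b = phi and [omega] = 0.

   If some tau^(n) vanishes, so do the later ones: for a frame with (phi|a) = (phi|b) = 1
   the coefficient [(a+b|x)] is the constant [omega + n delta], which is nonzero for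
   n <> 0, and the relation II_2 forces tau^(n+1) = 0.  The same two facts give uniqueness.

   That a meromorphic function on a hyperplane is either generically zero or generically
   nonzero is the identity theorem.  It is proved for functions that are merely complex
   differentiable: Goursat's theorem gives a primitive F, whose derivative is again
   differentiable, and if F vanishes near c the maximum principle applied to
   F(z) / (z - c)^n for all n makes F vanish on a larger disc. *)

Require Import Defs.
From Stdlib Require Import ZArith.
From HB Require Import structures.
From mathcomp Require Import all_boot all_order all_algebra.
From mathcomp Require Import complex ring lra ssrZ zify.
From mathcomp Require Import all_classical all_reals all_analysis.
Set Implicit Arguments.
Unset Strict Implicit.
Unset Printing Implicit Defensive.
Import Order.TTheory GRing.Theory Num.Theory.
Import numFieldNormedType.Exports.
Local Open Scope classical_set_scope.
Local Open Scope ring_scope.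

(** * Complex derivatives and dyadic averages *)

Section Modulus.
Variable R : realType.
Local Notation C := (Cplx R).

(** Each passage from one relation to another is a polynomial identity that holds up to a factor to
    be cancelled, made of brackets [(r|x) + s] and, in most cases, a value of f. A bracket is
    generically nonzero when (r|x) is not constant on the hyperplane, so the frames are chosen with
    r off the line of phi. Relations for different frames can be combined only after translations
    that make them share their values of f or h; these translations dictate the auxiliary vectors
    below, such as a fourth vector completing a frame of type I. The cancellation of f is the reason
    for the dichotomy between generically zero and generically nonzero. If f = 0 and g is not 0,
    relation II_1 constrains g instead of defining h. This happens exactly at the level omega, where
    the hypothesis on ratios is that constraint; above it the induction carries along that g
    vanishes whenever f does. *)

Definition cabs (z : C) : R := Normc.normc (z : complex R).
Definition rc (x : R) : C := real_complex R x.
Definition cre (z : C) : R := complex.Re (z : complex R).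
Definition cim (z : C) : R := complex.Im (z : complex R).
Definition ci : C := Complex 0 1.

Lemma normE (z : C) : `|z| = rc (cabs z). Proof. by []. Qed.

Lemma cabs_ge0 z : 0 <= cabs z.
Proof. by case: z => a b; apply: sqrtr_ge0. Qed.
Lemma cabsM z w : cabs (z * w) = cabs z * cabs w.
Proof. exact: Normc.normcM. Qed.
Lemma cabsD z w : cabs (z + w) <= cabs z + cabs w.
Proof. exact: le_normcD. Qed.
Lemma cabsN z : cabs (- z) = cabs z.
Proof. exact: normcN. Qed.
Lemma cabsB z w : cabs (z - w) = cabs (w - z).
Proof. by rewrite -cabsN opprB. Qed.
Lemma cabs0 : cabs 0 = 0.
Proof. exact: Normc.normc0. Qed.
Lemma cabs_eq0 z : cabs z = 0 -> z = 0.
Proof. exact: Normc.eq0_normc. Qed.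
Lemma cabs_gt0 z : z != 0 -> 0 < cabs z.
Proof.
move=> z0; rewrite lt_def cabs_ge0 andbT; apply: contra_neq z0; exact: cabs_eq0.
Qed.
Lemma cabs_rc x : cabs (rc x) = `|x|.
Proof. by rewrite /cabs /= expr0n /= addr0 sqrtr_sqr. Qed.
Lemma cabs1 : cabs 1 = 1.
Proof. exact: Normc.normc1. Qed.
Lemma cabsV z : cabs z^-1 = (cabs z)^-1.
Proof. exact: Normc.normcV. Qed.
Lemma cabs_sqr z : cabs z ^+ 2 = cre z ^+ 2 + cim z ^+ 2.
Proof. by case: z => a b; rewrite /cabs /= sqr_sqrtr // addr_ge0 // sqr_ge0. Qed.
Lemma cre_le z : `|cre z| <= cabs z.
Proof.
rewrite -ler_sqr ?nnegrE ?normr_ge0 ?cabs_ge0 // cabs_sqr real_normK ?num_real //.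
by rewrite lerDl sqr_ge0.
Qed.
Lemma cim_le z : `|cim z| <= cabs z.
Proof.
rewrite -ler_sqr ?nnegrE ?normr_ge0 ?cabs_ge0 // cabs_sqr real_normK ?num_real //.
by rewrite lerDr sqr_ge0.
Qed.
Lemma cE z : z = rc (cre z) + ci * rc (cim z).
Proof. by case: z => a b; exact: complexE. Qed.
Lemma cabs_ci : cabs ci = 1.
Proof. by rewrite /cabs /= expr0n /= add0r expr1n sqrtr1. Qed.
Lemma creD z w : cre (z + w) = cre z + cre w. Proof. by case: z; case: w. Qed.
Lemma cimD z w : cim (z + w) = cim z + cim w. Proof. by case: z; case: w. Qed.
Lemma creN z : cre (- z) = - cre z. Proof. by case: z. Qed.
Lemma cimN z : cim (- z) = - cim z. Proof. by case: z. Qed.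
Lemma creM z w : cre (z * w) = cre z * cre w - cim z * cim w.
Proof. by case: z; case: w. Qed.
Lemma cimM z w : cim (z * w) = cre z * cim w + cim z * cre w.
Proof. by case: z => a b; case: w => c d. Qed.
Lemma cre_rc x : cre (rc x) = x. Proof. by []. Qed.
Lemma cim_rc x : cim (rc x) = 0. Proof. by []. Qed.
Lemma creE x y : cre (rc x + ci * rc y) = x.
Proof. by rewrite creD creM !cre_rc cim_rc /ci /cre /cim /=; ring. Qed.
Lemma cimE x y : cim (rc x + ci * rc y) = y.
Proof. by rewrite cimD cimM !cre_rc !cim_rc /ci /cre /cim /=; ring. Qed.
Lemma rcD x y : rc (x + y) = rc x + rc y. Proof. exact: rmorphD. Qed.
Lemma rcB x y : rc (x - y) = rc x - rc y. Proof. exact: rmorphB. Qed.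
Lemma rcM x y : rc (x * y) = rc x * rc y. Proof. exact: rmorphM. Qed.
Lemma rc0 : rc 0 = 0. Proof. exact: rmorph0. Qed.
Lemma rc1 : rc 1 = 1. Proof. exact: rmorph1. Qed.
Lemma rcV x : rc x^-1 = (rc x)^-1. Proof. exact: fmorphV. Qed.
Lemma rc_nat n : rc n%:R = n%:R. Proof. exact: rmorph_nat. Qed.
Lemma rc_lt x y : (rc x < rc y) = (x < y). Proof. exact: ltcR. Qed.
Lemma rc_le x y : (rc x <= rc y) = (x <= y). Proof. exact: lecR. Qed.
Lemma ge0_rc (e : C) : 0 <= e -> e = rc (cre e).
Proof. by move=> /ger0_real /RRe_real. Qed.
Lemma gt0_rc (e : C) : 0 < e -> 0 < cre e.
Proof. by move=> e0; rewrite -rc_lt -ge0_rc// ltW. Qed.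

Lemma nbhs_cabs (z : C) (P : set C) :
  nbhs z P <-> exists2 r : R, 0 < r & forall w, cabs (w - z) < r -> P w.
Proof.
split=> [/nbhs_ballP[e /= e0 zP]|[r r0 zP]].
  exists (cre e); first exact: gt0_rc.
  move=> w wz; apply: zP; rewrite -ball_normE /= normE cabsB (ge0_rc (ltW e0)).
  by rewrite rc_lt.
apply/nbhs_ballP; exists (rc r); first by rewrite /= -rc0 rc_lt.
move=> w; rewrite -ball_normE /= normE rc_lt cabsB; exact: zP.
Qed.

(** The norm of [C] takes its values in [C]; this form keeps all bounds in [R] and involves no
    quotient. *)
Definition cdiff (f : C -> C) (z d : C) : Prop :=
  forall e : R, 0 < e -> exists2 r : R, 0 < r &
    forall h, cabs h < r -> cabs (f (z + h) - f z - d * h) <= e * cabs h.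

Lemma is_derive_cdiff (f : C -> C) (z d : C) : is_derive z 1 f d <-> cdiff f z d.
Proof.
split=> [[fd <-] e e0|fd].
  move: fd => /cvgrPdist_le/(_ (rc e)); rewrite -rc0 rc_lt => /(_ e0).
  move=> /nbhs_cabs[r r0 H]; exists r => // h hr.
  have [->|h0] := eqVneq h 0.
    by rewrite addr0 subrr mulr0 subr0 cabs0 mulr0.
  have := H h; rewrite subr0 => /(_ hr h0).
  rewrite normE rc_le /= /derive => H1.
  have -> : f (z + h) - f z - 'D_1 f z * h =
    - (('D_1 f z - h^-1 *: (f (h *: (1:C) + z) - f z)) * h).
    rewrite mulrBl opprB /GRing.scale /= mulr1 (addrC h z) mulrAC mulVf // mul1r.
    by [].
  by rewrite cabsN cabsM ler_wpM2r ?cabs_ge0.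
have H : h^-1 *: (f (h *: (1:C) + z) - f z) @[h --> 0^'] --> d.
  apply/cvgrPdist_le => e e0.
  have [r r0 H] := fd _ (gt0_rc e0).
  apply/nbhs_cabs; exists r => // h; rewrite subr0 => hr h0.
  rewrite (ge0_rc (ltW e0)) normE rc_le.
  rewrite -(ler_pM2r (cabs_gt0 h0)) -cabsM.
  rewrite -cabsN.
  have -> : - ((d - h^-1 *: (f (h *: (1:C) + z) - f z)) * h) = f (z + h) - f z - d * h.
    rewrite mulrBl opprB /GRing.scale /= mulr1 (addrC h z) mulrAC mulVf // mul1r.
    by [].
  exact: H.
split; first by apply/cvg_ex; exists d.
exact: cvg_lim.
Qed.

Lemma cdiff_cont f z d : cdiff f z d -> forall e : R, 0 < e ->
  exists2 r : R, 0 < r & forall h, cabs h < r -> cabs (f (z + h) - f z) <= e.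
Proof.
move=> /(_ 1 ltr01)[r r0 H] e e0.
have k0 : 0 < 1 + cabs d by rewrite ltr_pwDl ?cabs_ge0.
exists (Num.min r (e / (1 + cabs d))); first by rewrite lt_min r0 divr_gt0.
move=> h; rewrite lt_min => /andP[/H hr he].
have -> : f (z + h) - f z = (f (z + h) - f z - d * h) + d * h by rewrite subrK.
rewrite (le_trans (cabsD _ _))// cabsM.
apply: (@le_trans _ _ ((1 + cabs d) * cabs h)); first by rewrite mulrDl lerD2r.
by rewrite mulrC -ler_pdivlMr // ltW.
Qed.

Lemma complex_cauchy (s : nat -> C) :
  (forall e : R, 0 < e -> exists n0, forall n, (n0 <= n)%N -> cabs (s n - s n0) <= e) ->
  exists c, forall e : R, 0 < e -> exists n0, forall n, (n0 <= n)%N -> cabs (s n - c) <= e.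
Proof.
move=> sC.
(* Completeness is that of [R], applied to [cre] and [cim], which are additive and 1-Lipschitz. *)
have key (p : C -> R) : (forall z, `|p z| <= cabs z) -> (forall z w, p (z - w) = p z - p w) ->
   exists x, forall e : R, 0 < e -> exists n0, forall n, (n0 <= n)%N -> `|p (s n) - x| <= e.
  move=> pl pB.
  have : cvgn (fun n => p (s n)).
    apply: cauchy_cvg; apply/cauchy_ballP => e e0.
    have [n0 H] := sC (e / 4) ltac:(by rewrite divr_gt0).
    exists (([set m | exists2 n, (n0 <= n)%N & m = p (s n)]),
            ([set m | exists2 n, (n0 <= n)%N & m = p (s n)])) => /=.
      by split; exists n0 => // n /= n0n; exists n.
    case=> x y [/= [n n0n ->] [m n0m ->]].
    rewrite -ball_normE /=.
    have -> : p (s n) - p (s m) = p (s n - s n0) - p (s m - s n0) by rewrite !pB; ring.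
    rewrite (le_lt_trans (ler_normB _ _))//.
    have := le_trans (pl _) (H n n0n); have := le_trans (pl _) (H m n0m).
    by lra.
  move=> /cvg_ex[x /cvgrPdist_le xl]; exists x => e e0.
  have [n0 _ H] := xl e e0; exists n0 => n n0n; rewrite distrC.
  exact: H.
have [x Hx] := key cre cre_le (fun z w => ltac:(by rewrite creD creN)).
have [y Hy] := key cim cim_le (fun z w => ltac:(by rewrite cimD cimN)).
exists (rc x + ci * rc y) => e e0.
have e20 : 0 < e / 2 by rewrite divr_gt0.
have [n1 H1] := Hx _ e20; have [n2 H2] := Hy _ e20.
exists (maxn n1 n2) => n; rewrite geq_max => /andP[/H1 h1 /H2 h2].
have -> : s n - (rc x + ci * rc y) = rc (cre (s n) - x) + ci * rc (cim (s n) - y).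
  by rewrite {1}(cE (s n)) !rcB; ring.
by rewrite (le_trans (cabsD _ _))// cabsM cabs_ci mul1r !cabs_rc (splitr e) lerD.
Qed.

End Modulus.

(** * Averages over dyadic points *)

Section DyadicAverages.
Variable R : realType.
Local Notation C := (Cplx R).
Implicit Types (u v : R -> C) (t s : R).

Definition I01 t := 0 <= t <= 1.

(* The mean of u over the left endpoints of the 2^n dyadic subintervals of [0, 1]; the limit
   plays the role of the integral of u, and halving and reversal are immediate for it. *)
Fixpoint davg (n : nat) u : C :=
  if n is m.+1 then (davg m (fun t => u (t / 2)) + davg m (fun t => u ((1 + t) / 2))) / 2
  else u 0.

Lemma I01_0 : I01 0. Proof. by rewrite /I01 lexx ler01. Qed.
Lemma I01_l t : I01 t -> I01 (t / 2). Proof. by rewrite /I01; lra. Qed.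
Lemma I01_r t : I01 t -> I01 ((1 + t) / 2). Proof. by rewrite /I01; lra. Qed.

Lemma cabs_half (z : C) : cabs (z / 2) = cabs z / 2.
Proof. by rewrite cabsM cabsV -rc_nat cabs_rc normr_nat. Qed.

Lemma davg_eq n u v : (forall t, I01 t -> u t = v t) -> davg n u = davg n v.
Proof.
elim: n u v => [|n IH] u v uv /=; first by apply: uv; rewrite /I01 lexx ler01.
by congr ((_ + _) / _); apply: IH => t ?; apply: uv; [exact: I01_l|exact: I01_r].
Qed.

Lemma davg_bound n u v e : (forall t, I01 t -> cabs (u t - v t) <= e) ->
  cabs (davg n u - davg n v) <= e.
Proof.
elim: n u v => [|n IH] u v uv /=; first by apply: uv; rewrite /I01 lexx ler01.
rewrite -mulrBl cabs_half ler_pdivrMr // opprD addrACA (le_trans (cabsD _ _))//.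
by rewrite mulr2n mulrDr mulr1 lerD ?IH // => t ?; apply: uv; [exact: I01_l|exact: I01_r].
Qed.

Lemma davg_cst n (c : C) : davg n (fun=> c) = c.
Proof. by elim: n => //= n ->; field. Qed.

(** Indexed by the dyadic scale, the modulus of continuity fits inductions on [davg]: restriction to
    either half of [0, 1] turns scale n + 1 into scale n. *)
Definition osc u n e := forall s t, I01 s -> I01 t -> `|s - t| <= 2 ^- n ->
  cabs (u s - u t) <= e.

Lemma osc_half u n e : osc u n.+1 e ->
  osc (fun t => u (t / 2)) n e /\ osc (fun t => u ((1 + t) / 2)) n e.
Proof.
move=> o; split=> s t s1 t1 st; (apply: o;
  [by (exact: I01_l || exact: I01_r)|by (exact: I01_l || exact: I01_r)|]).
- by rewrite -mulrBl normrM (gtr0_norm (_ : 0 < 2^-1)) ?invr_gt0// exprSr invfM ler_pM2r ?invr_gt0.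
- rewrite (_ : _ - _ = (s - t) / 2); last by field.
  by rewrite normrM (gtr0_norm (_ : 0 < 2^-1)) ?invr_gt0// exprSr invfM ler_pM2r ?invr_gt0.
Qed.

Lemma davg_osc n m u e : osc u n e -> cabs (davg (n + m) u - davg n u) <= e.
Proof.
elim: n u => [|n IH] u o.
  rewrite add0n -(davg_cst m (davg 0 u)); apply: davg_bound => t t1 /=.
  have z1 : I01 (0:R) := I01_0.
  by apply: o => //; rewrite subr0 expr0 invr1; case/andP: t1 => t0 t1; rewrite ger0_norm.
rewrite addSn /= -mulrBl cabs_half ler_pdivrMr // opprD addrACA (le_trans (cabsD _ _))//.
have [h1 h2] := osc_half o.
by rewrite mulr2n mulrDr mulr1 lerD ?IH.
Qed.

(** Reversal turns left endpoints into right ones, hence an error of one oscillation, which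
    disappears in the limit. *)
Lemma davg_rev n u e : osc u n e -> cabs (davg n (fun t => u (1 - t)) - davg n u) <= e.
Proof.
elim: n u => [|n IH] u o.
  have z1 : I01 (0:R) := I01_0.
  by apply: o => //=; rewrite /I01 subr0 ?ler01 ?lexx // subr0 normr1 expr0 invr1.
rewrite /= -mulrBl cabs_half ler_pdivrMr // (addrC (davg n (fun t => u (t / 2)))).
rewrite opprD addrACA (le_trans (cabsD _ _))//.
have [h1 h2] := osc_half o.
rewrite mulr2n mulrDr mulr1; apply: lerD.
  have := IH _ h2; congr (_ <= _); congr (cabs (_ - _)).
  by apply: davg_eq => t _; congr (u _); field.
have := IH _ h1; congr (_ <= _); congr (cabs (_ - _)).
by apply: davg_eq => t _; congr (u _); field.
Qed.

(** The left endpoints have mean (1 - 2^-n) / 2, half a step short of the midpoint. *)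
Lemma davg_affine n (a b : C) :
  davg n (fun t => a + b * rc t) = a + b * rc ((1 - 2 ^- n) / 2).
Proof.
elim: n a b => [|n IH] a b /=.
  by rewrite expr0 invr1 subrr mul0r.
have -> : davg n (fun t => a + b * rc (t / 2)) = davg n (fun t => a + (b / 2) * rc t).
  by apply: davg_eq => t _; rewrite rcM rcV rc_nat; ring.
have -> : davg n (fun t => a + b * rc ((1 + t) / 2)) =
          davg n (fun t => (a + b / 2) + (b / 2) * rc t).
  by apply: davg_eq => t _; rewrite rcM rcD rc1 rcV rc_nat; ring.
rewrite !IH exprSr invfM; set x := 2 ^- n; rewrite !(rcM, rcB, rcV) rc1 !rc_nat.
by move: ((rc _)^-1) => y; field.
Qed.

Definition isavg u c := forall e : R, 0 < e ->
  exists n0, forall n, (n0 <= n)%N -> cabs (davg n u - c) <= e.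

Definition unif u := forall e : R, 0 < e -> exists n, osc u n e.

Lemma osc_le u n m e : (n <= m)%N -> osc u n e -> osc u m e.
Proof.
move=> nm o s t s1 t1 st; apply: o => //; apply: le_trans st _.
by rewrite lef_pV2 ?posrE ?exprn_gt0 // ler_eXn2l // ltr1n.
Qed.

Lemma isavg_ex u : unif u -> exists c, isavg u c.
Proof.
move=> uu; apply: complex_cauchy => e /uu[n uo]; exists n => m nm.
by rewrite -(subnKC nm); apply: davg_osc.
Qed.

Lemma isavg_unique u c d : isavg u c -> isavg u d -> c = d.
Proof.
move=> uc ud; apply/eqP; rewrite -subr_eq0; apply/eqP/cabs_eq0/eqP.
rewrite eq_le cabs_ge0 andbT; apply/ler_addgt0Pl => e e0; rewrite addr0.
have e20 : 0 < e / 2 by rewrite divr_gt0.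
have [n1 H1] := uc _ e20; have [n2 H2] := ud _ e20.
have := H1 (maxn n1 n2) (leq_maxl _ _); have := H2 (maxn n1 n2) (leq_maxr _ _).
set x := davg _ _ => h2 h1.
rewrite (_ : c - d = (x - d) - (x - c)); last by ring.
by rewrite (le_trans (cabsD _ _))// cabsN (splitr e) lerD.
Qed.

Lemma isavg_half u a b : isavg (fun t => u (t / 2)) a -> isavg (fun t => u ((1 + t) / 2)) b ->
  isavg u ((a + b) / 2).
Proof.
move=> ha hb e e0; have [n1 H1] := ha _ e0; have [n2 H2] := hb _ e0.
exists (maxn n1 n2).+1 => -[//|n]; rewrite ltnS geq_max => /andP[/H1 h1 /H2 h2] /=.
rewrite -mulrBl cabs_half ler_pdivrMr // opprD addrACA (le_trans (cabsD _ _))//.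
by rewrite mulr2n mulrDr mulr1 lerD.
Qed.

Lemma isavg_rev u c : unif u -> isavg u c -> isavg (fun t => u (1 - t)) c.
Proof.
move=> uu uc e e0; have e20 : 0 < e / 2 by rewrite divr_gt0.
have [n1 H1] := uc _ e20; have [n2 H2] := uu _ e20.
exists (maxn n1 n2) => n; rewrite geq_max => /andP[/H1 h1 h2].
rewrite -(subrK (davg n u) (davg n _)) -addrA (le_trans (cabsD _ _))// (splitr e) lerD //.
by apply: davg_rev; apply: osc_le H2.
Qed.

Lemma isavg_bound u v c d e : isavg u c -> isavg v d ->
  (forall t, I01 t -> cabs (u t - v t) <= e) -> cabs (c - d) <= e.
Proof.
move=> uc vd uv; apply/ler_addgt0Pl => x x0.
have x20 : 0 < x / 2 by rewrite divr_gt0.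
have [n1 H1] := uc _ x20; have [n2 H2] := vd _ x20.
have := H1 (maxn n1 n2) (leq_maxl _ _); have := H2 (maxn n1 n2) (leq_maxr _ _).
have := davg_bound (maxn n1 n2) uv.
set a := davg _ _; set b := davg _ _ => h3 h2 h1.
rewrite (_ : c - d = (b - d) - (a - c) + (a - b)); last by ring.
rewrite (le_trans (cabsD _ _))// lerD // (le_trans (cabsD _ _))// cabsN.
by rewrite (splitr x) lerD.
Qed.

Lemma half_powers (r : R) : 0 < r -> exists n, 2 ^- n < r.
Proof.
move=> r0; exists (Num.Def.archi_bound r^-1).
by rewrite invf_plt ?posrE ?exprn_gt0 //; apply: upper_nthrootP.
Qed.

End DyadicAverages.

(** * Goursat's theorem and the identity theorem *)

Section Goursat.
Variable R : realType.
Local Notation C := (Cplx R).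
Implicit Types (u v : R -> C) (t s : R).

(** Heine-Cantor; compactness is used in its near-covering form, with the dyadic scale n tending to
    infinity as parameter. *)
Lemma heine u : (forall t, I01 t -> forall e : R, 0 < e -> exists2 r : R, 0 < r &
    forall s, I01 s -> `|s - t| < r -> cabs (u s - u t) <= e) -> unif u.
Proof.
move=> uc e e0; have e20 : 0 < e / 2 by rewrite divr_gt0.
have /compact_near_coveringP cK := @segment_compact R 0 1.
have := cK nat \oo (fun n t => forall s, I01 s -> I01 t -> `|s - t| <= 2 ^- n -> cabs (u s - u t) <= e).
have HF : Filter \oo by exact: eventually_filter.
move=> /(_ HF) cK'; have {cK'} : \forall n \near \oo, `[0, 1] `<=`
    (fun t => forall s, I01 s -> I01 t -> `|s - t| <= 2 ^- n -> cabs (u s - u t) <= e).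
  apply: cK' => t tI; have t1 : I01 t by have : t \in `[0, 1] by []; rewrite in_itv.
  have [r r0 H] := uc t t1 _ e20.
  have r20 : 0 < r / 2 by rewrite divr_gt0.
  have [n n2] := half_powers r20.
  exists (ball t (r / 2), [set m | (n <= m)%N]).
    by split; [exact: nbhsx_ballx|exists n].
  move=> [t' m] [/=]; rewrite /ball /= => tt' nm s s1 t1' st'.
  have mr : 2 ^- m < r / 2.
    apply: le_lt_trans n2; rewrite lef_pV2 ?posrE ?exprn_gt0 //.
    by rewrite ler_eXn2l // ltr1n.
  have h1 : `|t' - t| < r by rewrite distrC; lra.
  have h2 : `|s - t| < r.
    rewrite (_ : s - t = (s - t') + (t' - t)); last by ring.
    by rewrite (le_lt_trans (ler_normD _ _))// (distrC t'); lra.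
  have := H _ s1 h2; have := H _ t1' h1 => h3 h4.
  rewrite (_ : u s - u t' = (u s - u t) - (u t' - u t)); last by ring.
  by rewrite (le_trans (cabsD _ _))// cabsN (splitr e) lerD.
move=> [n _ /(_ n (leqnn n)) H]; exists n => s t s1 t1 st; exact: H.
Qed.

Definition seg (z w : C) t : C := z + rc t * (w - z).

Lemma segE z w t : seg z w t = rc (1 - t) * z + rc t * w.
Proof. by rewrite /seg rcB rc1; ring. Qed.

Lemma seg_dist z w p t e : I01 t -> cabs (z - p) <= e -> cabs (w - p) <= e ->
  cabs (seg z w t - p) <= e.
Proof.
move=> /andP[t0 t1] ze we.
rewrite (_ : _ - p = rc (1 - t) * (z - p) + rc t * (w - p)); last first.
  by rewrite segE rcB rc1; ring.
rewrite (le_trans (cabsD _ _))// !cabsM !cabs_rc !ger0_norm ?subr_ge0 //.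
rewrite (_ : e = (1 - t) * e + t * e); last by ring.
by rewrite lerD // ler_wpM2l // subr_ge0.
Qed.

Lemma seg_dist_lt z w p t e : I01 t -> cabs (z - p) < e -> cabs (w - p) < e ->
  cabs (seg z w t - p) < e.
Proof.
move=> t1 ze we; apply: (@le_lt_trans _ _ (Num.max (cabs (z - p)) (cabs (w - p)))).
  by apply: seg_dist => //; rewrite le_max lexx ?orbT.
by rewrite gt_max ze.
Qed.

Lemma davg_seg_affine (q0 q1 z w : C) :
  isavg (fun t => q0 + q1 * seg z w t) (q0 + q1 * ((z + w) / 2)).
Proof.
move=> e e0; set k := cabs (q1 * (w - z)) / 2.
have k0 : 0 <= k by rewrite divr_ge0 ?cabs_ge0.
have [n Hn] := @half_powers R (e / (k + 1)) ltac:(by rewrite divr_gt0 // ltr_wpDl).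
exists n => m nm.
have -> : davg m (fun t => q0 + q1 * seg z w t) = davg m (fun t => (q0 + q1 * z) + (q1 * (w - z)) * rc t).
  by apply: davg_eq => t _; rewrite /seg; ring.
rewrite davg_affine.
rewrite (_ : _ - _ = - (q1 * (w - z) * rc (2 ^- m) / 2)); last first.
  by rewrite !(rcM, rcB, rcV) rc1 !rc_nat; move: ((rc _)^-1) => y; field.
rewrite cabsN cabs_half cabsM cabs_rc ger0_norm ?invr_ge0 ?exprn_ge0 // mulrAC -/k.
apply: (@le_trans _ _ ((k + 1) * 2 ^- n)); last first.
  by rewrite mulrC -ler_pdivlMr ?ltr_wpDl // ltW.
apply: ler_pM => //; rewrite ?invr_ge0 ?exprn_ge0 // ?lerDl //.
by rewrite lef_pV2 ?posrE ?exprn_gt0 // ler_eXn2l // ltr1n.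
Qed.

Variables (f : C -> C) (c0 : C) (rho : R).
Hypothesis fd : forall z, cabs (z - c0) < rho -> exists d, cdiff f z d.

Lemma unif_seg z w : cabs (z - c0) < rho -> cabs (w - c0) < rho ->
  unif (fun t => f (seg z w t)).
Proof.
move=> zr wr; apply: heine => t t1 e e0.
have [d /cdiff_cont/(_ e e0)[r r0 H]] := fd (seg_dist_lt t1 zr wr).
have k0 : 0 < cabs (w - z) + 1 by rewrite ltr_wpDl ?cabs_ge0.
exists (r / (cabs (w - z) + 1)); first by rewrite divr_gt0.
move=> s s1 st.
have := H (seg z w s - seg z w t); rewrite subrKC; apply.
rewrite (_ : _ - _ = rc (s - t) * (w - z)); last by rewrite /seg rcB; ring.
rewrite cabsM cabs_rc; apply: (@le_lt_trans _ _ (`|s - t| * (cabs (w - z) + 1))).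
  by rewrite ler_wpM2l // lerDl.
by rewrite -ltr_pdivlMr.
Qed.

(* The integral of f along the segment from z to w. *)
Definition J z w : C := (w - z) * xget 0 [set c | isavg (fun t => f (seg z w t)) c].

Lemma JP z w : cabs (z - c0) < rho -> cabs (w - c0) < rho ->
  exists2 a, isavg (fun t => f (seg z w t)) a & J z w = (w - z) * a.
Proof.
move=> zr wr; have [c Hc] := isavg_ex (unif_seg zr wr).
exists (xget 0 [set c | isavg (fun t => f (seg z w t)) c]) => //.
by apply: xgetPex; exists c.
Qed.

Lemma isavg_eq u v c : u =1 v -> isavg u c -> isavg v c.
Proof. by move=> uv; have -> : v = u by apply/funext => t; rewrite uv. Qed.

Lemma J_rev z w : cabs (z - c0) < rho -> cabs (w - c0) < rho -> J w z = - J z w.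
Proof.
move=> zr wr; have [a Ha ->] := JP zr wr; have [b Hb ->] := JP wr zr.
rewrite (_ : b = a); first by ring.
apply: isavg_unique Hb _.
apply: (isavg_eq _ (isavg_rev (unif_seg zr wr) Ha)) => t /=.
by congr f; rewrite /seg rcB rc1; ring.
Qed.

Lemma mid_dist (z w p : C) e : cabs (z - p) <= e -> cabs (w - p) <= e ->
  cabs ((z + w) / 2 - p) <= e.
Proof.
move=> ze we; have -> : (z + w) / 2 = seg z w (1 / 2).
  by rewrite /seg !(rcM, rcV) rc1 rc_nat; field.
by apply: seg_dist => //; rewrite /I01; lra.
Qed.

Lemma mid_dist_lt (z w p : C) e : cabs (z - p) < e -> cabs (w - p) < e ->
  cabs ((z + w) / 2 - p) < e.
Proof.
move=> ze we; have -> : (z + w) / 2 = seg z w (1 / 2).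
  by rewrite /seg !(rcM, rcV) rc1 rc_nat; field.
by apply: seg_dist_lt => //; rewrite /I01; lra.
Qed.

Lemma J_split z w : cabs (z - c0) < rho -> cabs (w - c0) < rho ->
  J z w = J z ((z + w) / 2) + J ((z + w) / 2) w.
Proof.
move=> zr wr; have mr := mid_dist_lt zr wr.
have [a Ha ->] := JP zr wr; have [b Hb ->] := JP zr mr; have [c Hc ->] := JP mr wr.
rewrite (_ : a = (b + c) / 2); first by field.
apply: isavg_unique Ha _; apply: isavg_half.
  by apply: (isavg_eq _ Hb) => t /=; congr f; rewrite /seg !(rcM, rcV) rc_nat; field.
by apply: (isavg_eq _ Hc) => t /=; congr f; rewrite /seg rcM rcV rc_nat rcD rc1; field.
Qed.

(** An affine function averages to its value at the midpoint. Near a point of differentiability f is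
    affine up to a small error, and the affine contributions cancel around a triangle. *)
Lemma J_affine z w q0 q1 e : cabs (z - c0) < rho -> cabs (w - c0) < rho ->
  (forall t, I01 t -> cabs (f (seg z w t) - (q0 + q1 * seg z w t)) <= e) ->
  cabs (J z w - (w - z) * (q0 + q1 * ((z + w) / 2))) <= cabs (w - z) * e.
Proof.
move=> zr wr H; have [a Ha ->] := JP zr wr.
rewrite -mulrBr cabsM ler_wpM2l ?cabs_ge0 //.
exact: (isavg_bound Ha (@davg_seg_affine q0 q1 z w) H).
Qed.

Definition tri := (C * C * C)%type.
Definition TJ (T : tri) := J T.1.1 T.1.2 + J T.1.2 T.2 + J T.2 T.1.1.
Definition perim (T : tri) := cabs (T.1.1 - T.1.2) + cabs (T.1.2 - T.2) + cabs (T.2 - T.1.1).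
Definition tri_in (p : C) (r : R) (T : tri) :=
  [/\ cabs (T.1.1 - p) <= r, cabs (T.1.2 - p) <= r & cabs (T.2 - p) <= r].

Lemma cabs_sub4 (a b c d : C) (x : R) : cabs (a + b + c + d) >= x ->
  [\/ x <= 4 * cabs a, x <= 4 * cabs b, x <= 4 * cabs c | x <= 4 * cabs d].
Proof.
move=> h; have := cabsD (a + b + c) d; have := cabsD (a + b) c; have := cabsD a b.
move=> h1 h2 h3.
have [?|ha] := leP x (4 * cabs a); first by constructor 1.
have [?|hb] := leP x (4 * cabs b); first by constructor 2.
have [?|hc] := leP x (4 * cabs c); first by constructor 3.
have [?|hd] := leP x (4 * cabs d); first by constructor 4.
by lra.
Qed.

(** The integral is the sum over the four midpoint triangles, one of which carries at least a
    quarter. Only vertices are recorded: the bound on the displacement of the first vertex yields a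
    Cauchy sequence, in place of an intersection of nested triangles. *)
Lemma tri_step r (T : tri) : r < rho -> tri_in c0 r T -> exists T' : tri,
  [/\ tri_in c0 r T', perim T' = perim T / 2, cabs (TJ T) <= 4 * cabs (TJ T') &
      cabs (T'.1.1 - T.1.1) <= perim T].
Proof.
case: T => [[a b] c] rr [/= ar br cr].
have [a' b' c'] : [/\ cabs (a - c0) < rho, cabs (b - c0) < rho & cabs (c - c0) < rho].
  by split; apply: le_lt_trans rr.
have [m1 M1] : exists m, m = (a + b) / 2 by eexists.
have [m2 M2] : exists m, m = (b + c) / 2 by eexists.
have [m3 M3] : exists m, m = (c + a) / 2 by eexists.
have m1r : cabs (m1 - c0) <= r by rewrite M1; exact: mid_dist.
have m2r : cabs (m2 - c0) <= r by rewrite M2; exact: mid_dist.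
have m3r : cabs (m3 - c0) <= r by rewrite M3; exact: mid_dist.
have [m1' m2' m3'] : [/\ cabs (m1 - c0) < rho, cabs (m2 - c0) < rho & cabs (m3 - c0) < rho].
  by split; apply: le_lt_trans rr.
have TE : TJ (a, b, c) = TJ (a, m1, m3) + TJ (m1, b, m2) + TJ (m3, m2, c) + TJ (m2, m3, m1).
  rewrite /TJ /= (J_split a' b') (J_split b' c') (J_split c' a') -M1 -M2 -M3.
  by rewrite (J_rev m1' m3') (J_rev m2' m1') (J_rev m3' m2'); ring.
have H2 (x y z w : C) : x - y = (z - w) / 2 -> cabs (x - y) = cabs (z - w) / 2.
  by move=> ->; rewrite cabs_half.
have e1 : cabs (a - m1) = cabs (a - b) / 2 by apply: H2; rewrite M1; field.
have e2 : cabs (m1 - b) = cabs (a - b) / 2 by apply: H2; rewrite M1; field.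
have e3 : cabs (b - m2) = cabs (b - c) / 2 by apply: H2; rewrite M2; field.
have e4 : cabs (m2 - c) = cabs (b - c) / 2 by apply: H2; rewrite M2; field.
have e5 : cabs (c - m3) = cabs (c - a) / 2 by apply: H2; rewrite M3; field.
have e6 : cabs (m3 - a) = cabs (c - a) / 2 by apply: H2; rewrite M3; field.
have e7 : cabs (m1 - m3) = cabs (b - c) / 2 by apply: H2; rewrite M1 M3; field.
have e8 : cabs (m2 - m1) = cabs (c - a) / 2 by apply: H2; rewrite M1 M2; field.
have e9 : cabs (m3 - m2) = cabs (a - b) / 2 by apply: H2; rewrite M2 M3; field.
have e10 := cabsB m1 a; have e11 := cabsB m2 m3; have e12 := cabsB m3 m1; have e13 := cabsB m1 m2.
have P0 : 0 <= perim (a, b, c) by rewrite /perim !addr_ge0 ?cabs_ge0.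
have Pge : [/\ cabs (a - b) <= perim (a, b, c), cabs (b - c) <= perim (a, b, c) & cabs (c - a) <= perim (a, b, c)].
  rewrite /perim /=.
  have := cabs_ge0 (a - b); have := cabs_ge0 (b - c); have := cabs_ge0 (c - a).
  by move=> ? ? ?; split; lra.
case: Pge => p1 p2 p3.
have := lexx (cabs (TJ (a, b, c))); rewrite {2}TE => /cabs_sub4[h|h|h|h].
- exists (a, m1, m3); split => //=; last by rewrite subrr cabs0.
  by rewrite /perim /= e1 e7 e6; field.
- exists (m1, b, m2); split => //=; first by rewrite /perim /= e2 e3 e8; field.
  by have := cabs_ge0 (a - b); rewrite e10 e1; lra.
- exists (m3, m2, c); split => //=; first by rewrite /perim /= e9 e4 e5; field.
  by have := cabs_ge0 (c - a); rewrite e6; lra.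
- exists (m2, m3, m1); split => //=.
    by rewrite /perim /= e11 e9 e12 e7 e13 e8; field.
  rewrite M2 (_ : _ - a = ((b - a) + (c - a)) / 2); last by field.
  rewrite cabs_half; have := cabsD (b - a) (c - a); rewrite (cabsB b a).
  by have := cabs_ge0 (c - a); have := cabs_ge0 (b - c); have := cabs_ge0 (a - b); rewrite /perim /=; lra.
Qed.

Lemma goursat_tri a b c : cabs (a - c0) < rho -> cabs (b - c0) < rho ->
  cabs (c - c0) < rho -> J a b + J b c + J c a = 0.
Proof.
move=> ar br cr.
(* A closed disc of radius below [rho] keeps the limit point inside the disc where f is
   differentiable. *)
set r := Num.max (cabs (a - c0)) (Num.max (cabs (b - c0)) (cabs (c - c0))).
have rr : r < rho by rewrite !gt_max ar br.
have T0r : tri_in c0 r (a, b, c) by split; rewrite /= !le_max lexx ?orbT.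
have step0 (T : tri) : exists T' : tri, tri_in c0 r T ->
  [/\ tri_in c0 r T', perim T' = perim T / 2, cabs (TJ T) <= 4 * cabs (TJ T') &
      cabs (T'.1.1 - T.1.1) <= perim T].
  have [TT|TT] := pselect (tri_in c0 r T); last by exists T.
  by have [T' HT'] := tri_step rr TT; exists T'.
have [step stepP] := choice step0.
pose Tn n := iter n step (a, b, c).
have TnS n : Tn n.+1 = step (Tn n) by [].
have Tin n : tri_in c0 r (Tn n) by elim: n => // n /stepP[].
set L := perim (a, b, c).
have Pn n : perim (Tn n) = L / 2 ^+ n.
  elim: n => [|n IH]; first by rewrite expr0 divr1.
  by have [_ + _ _] := stepP _ (Tin n); rewrite -TnS IH exprSr invfM mulrA.
have Jn n : cabs (TJ (a, b, c)) <= 4 ^+ n * cabs (TJ (Tn n)).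
  elim: n => [|n IH]; first by rewrite expr0 mul1r.
  have [_ _ h _] := stepP _ (Tin n); apply: (le_trans IH).
  by rewrite exprSr -mulrA ler_wpM2l ?exprn_ge0.
have L0 : 0 <= L by rewrite /L /perim !addr_ge0 ?cabs_ge0.
have Dn n m : cabs ((Tn (n + m)%N).1.1 - (Tn n).1.1) <= 2 * L / 2 ^+ n - 2 * L / 2 ^+ (n + m).
  elim: m => [|m IH]; first by rewrite addn0 !subrr cabs0.
  have [_ _ _] := stepP _ (Tin (n + m)%N); rewrite Pn -TnS addnS => h.
  rewrite (_ : _ - _ = ((Tn (n + m).+1).1.1 - (Tn (n + m)%N).1.1) + ((Tn (n + m)%N).1.1 - (Tn n).1.1)); last by ring.
  rewrite (le_trans (cabsD _ _))// (le_trans (lerD h IH))//.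
  by rewrite exprSr invfM; set x := (2 ^+ (n + m))^-1; rewrite le_eqVlt; apply/orP; left; apply/eqP; field.
have Dn' n m : (n <= m)%N -> cabs ((Tn m).1.1 - (Tn n).1.1) <= 2 * L / 2 ^+ n.
  move=> nm; rewrite -(subnKC nm); apply: le_trans (Dn n (m - n)%N) _.
  by rewrite lerBlDr lerDl divr_ge0 ?mulr_ge0 // exprn_ge0.
have Lsmall (e : R) : 0 < e -> exists n, 3 * L / 2 ^+ n < e.
  move=> e0; have k0 : 0 < 3 * L + 1 by rewrite ltr_wpDl // mulr_ge0.
  have [n Hn] := @half_powers R (e / (3 * L + 1)) ltac:(by rewrite divr_gt0).
  exists n; apply: (@le_lt_trans _ _ ((3 * L + 1) * 2 ^- n)).
    by rewrite ler_wpM2r ?invr_ge0 ?exprn_ge0 // lerDl.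
  by rewrite mulrC -ltr_pdivlMr.
have [p Hp] : exists p, forall e : R, 0 < e -> exists n0, forall n, (n0 <= n)%N ->
    cabs ((Tn n).1.1 - p) <= e.
  apply: complex_cauchy => e e0; have [n Hn] := Lsmall e e0; exists n => m nm.
  apply: le_trans (Dn' _ _ nm) (le_trans _ (ltW Hn)).
  by rewrite ler_wpM2r ?invr_ge0 ?exprn_ge0 // ler_wpM2r // ler_nat.
have pn n : cabs ((Tn n).1.1 - p) <= 2 * L / 2 ^+ n.
  apply/ler_addgt0Pr => e /Hp[n0 H0].
  have := Dn' n (maxn n n0) (leq_maxl _ _); have := H0 (maxn n n0) (leq_maxr _ _).
  set x := (Tn (maxn n n0)).1.1 => h1 h2.
  rewrite (_ : _ - p = (x - p) - (x - (Tn n).1.1)); last by ring.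
  by rewrite (le_trans (cabsD _ _))// cabsN addrC lerD.
have pr : cabs (p - c0) < rho.
  apply: (le_lt_trans _ rr); apply/ler_addgt0Pr => e /Hp[n0 /(_ n0 (leqnn _)) H0].
  have [h1 _ _] := Tin n0.
  rewrite (_ : p - c0 = ((Tn n0).1.1 - c0) - ((Tn n0).1.1 - p)); last by ring.
  by rewrite (le_trans (cabsD _ _))// cabsN lerD.
have [d fpd] := fd pr.
suff : cabs (TJ (a, b, c)) <= 0.
  by move=> h; apply: cabs_eq0; apply/eqP; rewrite eq_le h cabs_ge0.
have k0 : 0 < 9 * L ^+ 2 + 1 by rewrite ltr_wpDl // mulr_ge0 // sqr_ge0.
apply/ler_addgt0Pr => e0 e00; rewrite add0r.
(* The final bound is 3 L^2 e: the factor 4^n from the subdivision cancels the square of the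
   perimeter L / 2^n. *)
have [e eE] : exists e, e = e0 / (9 * L ^+ 2 + 1) by eexists.
have e_gt0 : 0 < e by rewrite eE divr_gt0.
have [s s0 Hs] := fpd _ e_gt0.
have [n Hn] := Lsmall _ s0.
apply: (le_trans (Jn n)).
case TE : (Tn n) => [[x y] z].
have [/= xr yr zr] : tri_in c0 r (x, y, z) by rewrite -TE.
have [x' y' z'] : [/\ cabs (x - c0) < rho, cabs (y - c0) < rho & cabs (z - c0) < rho].
  by split; apply: le_lt_trans rr.
have Pxyz : cabs (x - y) + cabs (y - z) + cabs (z - x) = L / 2 ^+ n.
  by rewrite -Pn TE.
set l := L / 2 ^+ n in Pxyz.
(* The first vertex is within 2 l of the limit, the other two within one more perimeter l; hence 3 l
   in all the estimates. *)
have xp : cabs (x - p) <= 2 * l by have := pn n; rewrite TE /= -mulrA.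
have := (cabs_ge0 (x - y), cabs_ge0 (y - z), cabs_ge0 (z - x)) => -[[xy0 yz0] zx0].
have yp : cabs (y - p) <= 3 * l.
  rewrite (_ : y - p = (y - x) + (x - p)); last by ring.
  by rewrite (le_trans (cabsD _ _))// cabsB; lra.
have zp : cabs (z - p) <= 3 * l.
  rewrite (_ : z - p = (z - x) + (x - p)); last by ring.
  by rewrite (le_trans (cabsD _ _))//; lra.
have l0 : 0 <= l by rewrite divr_ge0 ?exprn_ge0.
have xp' : cabs (x - p) <= 3 * l by lra.
have ls : 3 * l < s by rewrite /l mulrA.
set q0 := f p - d * p.
have edge (v w : C) : cabs (v - p) <= 3 * l -> cabs (w - p) <= 3 * l -> forall t, I01 t ->
    cabs (f (seg v w t) - (q0 + d * seg v w t)) <= e * (3 * l).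
  move=> vp wp t t1; have sp := seg_dist t1 vp wp.
  have := Hs (seg v w t - p) (le_lt_trans sp ls); rewrite subrKC.
  rewrite (_ : f (seg v w t) - (q0 + d * seg v w t) = f (seg v w t) - f p - d * (seg v w t - p)).
    by move=> h; apply: (le_trans h); rewrite ler_wpM2l // ltW.
  by rewrite /q0; ring.
have h1 := J_affine x' y' (edge _ _ xp' yp).
have h2 := J_affine y' z' (edge _ _ yp zp).
have h3 := J_affine z' x' (edge _ _ zp xp').
have -> : TJ (x, y, z) = (J x y - (y - x) * (q0 + d * ((x + y) / 2)))
   + (J y z - (z - y) * (q0 + d * ((y + z) / 2))) + (J z x - (x - z) * (q0 + d * ((z + x) / 2))).
  by rewrite /TJ /=; field.
apply: (@le_trans _ _ (4 ^+ n * (3 * e * l * l))).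
  rewrite ler_wpM2l ?exprn_ge0 //.
  rewrite (le_trans (cabsD _ _))// (le_trans (lerD (cabsD _ _) (lexx _)))//.
  rewrite (le_trans (lerD (lerD h1 h2) h3))// -2!mulrDl.
  rewrite (cabsB y) (cabsB z) (cabsB x z) Pxyz.
  by rewrite le_eqVlt; apply/orP; left; apply/eqP; ring.
have l4 : 4 ^+ n * (l * l) = L ^+ 2.
  rewrite /l (_ : 4 = 2 * 2) ?exprMn; last by rewrite -natrM.
  have : (2 ^+ n : R) != 0 by rewrite expf_neq0 // pnatr_eq0.
  by move: (2 ^+ n) => w w0; field.
rewrite (_ : _ * _ = 3 * L ^+ 2 * e); last by rewrite -l4; ring.
rewrite eE mulrA ler_pdivrMr // mulrC ler_wpM2l ?ltW //.
have := sqr_ge0 L; lra.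
Qed.

Lemma J_primitive z : cabs (z - c0) < rho -> cdiff (J c0) z (f z).
Proof.
move=> zr e e0; have [d /cdiff_cont/(_ e e0)[r r0 H]] := fd zr.
have r1 : 0 < rho - cabs (z - c0) by rewrite subr_gt0.
have cr : cabs (c0 - c0) < rho by rewrite subrr cabs0 (le_lt_trans _ zr) // cabs_ge0.
exists (Num.min r (rho - cabs (z - c0))); first by rewrite lt_min r0.
move=> h; rewrite lt_min => /andP[hr hr'].
have zhr : cabs (z + h - c0) < rho.
  by rewrite addrAC (le_lt_trans (cabsD _ _))// -ltrBrDl.
have := goursat_tri cr zr zhr; rewrite (J_rev cr zhr) => /eqP.
rewrite subr_eq0 => /eqP <-.
rewrite (_ : J c0 z + J z (z + h) - J c0 z = J z (z + h)); last by ring.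
have := @J_affine z (z + h) (f z) 0 e zr zhr.
rewrite mul0r addr0 [z + h - z]addrAC subrr add0r (mulrC h) (mulrC (cabs h)); apply.
move=> t /andP[t0 t1]; rewrite mul0r addr0 /seg [z + h - z]addrAC subrr add0r; apply: H.
rewrite cabsM cabs_rc ger0_norm //; apply: le_lt_trans hr.
by rewrite ler_piMl ?cabs_ge0.
Qed.

End Goursat.

(** * The maximum principle on a square *)

Section MaxPrinciple.
Variable R : realType.
Local Notation C := (Cplx R).

Definition rdiff (p : R -> R) (t d : R) : Prop :=
  forall e : R, 0 < e -> exists2 r : R, 0 < r &
    forall h, `|h| < r -> `|p (t + h) - p t - d * h| <= e * `|h|.

Lemma rdiff_is_derive (p : R -> R) (t d : R) : rdiff p t d -> is_derive t (1 : R) p d.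
Proof.
move=> fd.
have H : h^-1 *: (p (h *: (1:R) + t) - p t) @[h --> 0^'] --> d.
  apply/cvgrPdist_le => e e0.
  have [r r0 H] := fd _ e0.
  apply/nbhs_ballP; exists r => //= h; rewrite /ball /= sub0r normrN => hr h0.
  rewrite -(@ler_pM2r _ `|h|) ?normr_gt0 // -normrM -normrN.
  have -> : - ((d - h^-1 *: (p (h *: (1:R) + t) - p t)) * h) = p (t + h) - p t - d * h.
    rewrite mulrBl opprB /GRing.scale /= mulr1 (addrC h t) mulrAC mulVf // mul1r.
    by [].
  exact: H.
split; first by apply/cvg_ex; exists d.
exact: cvg_lim.
Qed.

(** If p'(0) >= 0, then p' > 0 just to the right of 0 and p increases there by the mean value
    theorem; if p'(0) < 0, then p exceeds p(0) just to the left. *)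
Lemma second_derivative_test (p p' : R -> R) (s r : R) : 0 < r -> 0 < s ->
  (forall t, `|t| < r -> rdiff p t (p' t)) -> rdiff p' 0 s ->
  (forall t, `|t| < r -> p t <= p 0) -> False.
Proof.
move=> r0 s0 pd p'd pmax.
have s20 : 0 < s / 2 by rewrite divr_gt0.
have [p'0|p'0] := leP 0 (p' 0).
  have [r1 r10 H] := p'd _ s20.
  set t := Num.min r r1 / 2.
  have m0 : 0 < Num.min r r1 by rewrite lt_min r0.
  have t0 : 0 < t by rewrite divr_gt0.
  have /andP[tr tr1] : (t < r) && (t < r1) by rewrite -lt_min ltr_pdivrMr // ltr_pMr // ltr1n.
  have pd' x : x \in `]0, t[ -> is_derive x 1 p (p' x).
    rewrite in_itv /= => /andP[x0 xt]; apply/rdiff_is_derive/pd.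
    by rewrite gtr0_norm // (lt_trans xt).
  have [|c ct Hc] := MVT t0 pd'.
    apply: derivable_within_continuous => x; rewrite in_itv /= => /andP[x0 xt].
    have [] : is_derive x (1:R) p (p' x); last by [].
    by apply/rdiff_is_derive/pd; rewrite ger0_norm // (le_lt_trans xt).
  move: ct; rewrite in_itv /= => /andP[c0 ct].
  have := pmax t; rewrite gtr0_norm // => /(_ tr); rewrite -subr_le0 Hc subr0.
  apply/negP; rewrite -ltNge mulr_gt0 //.
  have := H c; rewrite add0r gtr0_norm // => /(_ (lt_trans ct tr1)).
  rewrite ler_norml => /andP[h _]; have := mulr_gt0 s0 c0; lra.
have k0 : 0 < - p' 0 / 2 by rewrite divr_gt0 // oppr_gt0.
have [r1 r10 H] := pd 0 (ltac:(by rewrite normr0)) _ k0.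
set t := Num.min r r1 / 2.
have m0 : 0 < Num.min r r1 by rewrite lt_min r0.
have t0 : 0 < t by rewrite divr_gt0.
have /andP[tr tr1] : (t < r) && (t < r1) by rewrite -lt_min ltr_pdivrMr // ltr_pMr // ltr1n.
have := H (- t); rewrite normrN gtr0_norm // => /(_ tr1).
have := pmax (- t); rewrite normrN gtr0_norm // => /(_ tr).
rewrite add0r ler_norml => h1 /andP[h2 _]; nra.
Qed.

Lemma cdiff_line (F : C -> C) (c k z d : C) (t : R) : cabs k = 1 ->
  cdiff F (z + k * rc t) d -> rdiff (fun t => cre (c * F (z + k * rc t))) t (cre (c * d * k)).
Proof.
move=> k1 Fd e e0; have e' : 0 < e / (cabs c + 1) by rewrite divr_gt0 // ltr_wpDl ?cabs_ge0.
have [r r0 H] := Fd _ e'; exists r => // h hr.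
have := H (k * rc h); rewrite cabsM k1 mul1r cabs_rc => /(_ hr) {}H.
rewrite rcD mulrDr addrA.
have -> : cre (c * F (z + k * rc t + k * rc h)) - cre (c * F (z + k * rc t)) - cre (c * d * k) * h
  = cre (c * (F (z + k * rc t + k * rc h) - F (z + k * rc t) - d * (k * rc h))).
  have -> : c * (F (z + k * rc t + k * rc h) - F (z + k * rc t) - d * (k * rc h)) =
   c * F (z + k * rc t + k * rc h) - c * F (z + k * rc t) - c * d * k * rc h by ring.
  by rewrite !creD !creN [cre (_ * _ * _ * _)]creM cre_rc cim_rc mulr0 subr0.
apply: le_trans (cre_le _) _; rewrite cabsM; apply: le_trans (ler_wpM2l (cabs_ge0 _) H) _.
rewrite mulrA ler_wpM2r // mulrA ler_pdivrMr ?ltr_wpDl ?cabs_ge0 //.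
by rewrite mulrC ler_wpM2l ?(ltW e0) // lerDl.
Qed.

Lemma rdiffD p q t d d' : rdiff p t d -> rdiff q t d' -> rdiff (fun t => p t + q t) t (d + d').
Proof.
move=> pd qd e e0; have e20 : 0 < e / 2 by rewrite divr_gt0.
have [r1 r10 H1] := pd _ e20; have [r2 r20 H2] := qd _ e20.
exists (Num.min r1 r2); first by rewrite lt_min r10.
move=> h; rewrite lt_min => /andP[/H1 h1 /H2 h2].
rewrite (_ : _ - _ - _ = (p (t + h) - p t - d * h) + (q (t + h) - q t - d' * h)); last by ring.
by rewrite (le_trans (ler_normD _ _))// (splitr e) mulrDl lerD.
Qed.

Lemma rdiff_quad (a b k t : R) : rdiff (fun t => k * ((a + t) ^+ 2 + b)) t (2 * k * (a + t)).
Proof.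
move=> e e0; exists (e / (`|k| + 1)); first by rewrite divr_gt0 // ltr_wpDl.
move=> h hr; rewrite (_ : _ - _ - _ = (k * h) * h); last by ring.
rewrite normrM ler_wpM2r // normrM; apply: le_trans (_ : (`|k| + 1) * `|h| <= _).
  by rewrite ler_wpM2r // lerDl.
by rewrite mulrC -ler_pdivlMr ?ltr_wpDl // ltW.
Qed.

Lemma rdiff_lin (a k t : R) : rdiff (fun t => k * (a + t)) t k.
Proof.
move=> e e0; exists 1 => // h _; rewrite (_ : _ - _ - _ = 0); last by ring.
by rewrite normr0 mulr_ge0 // ltW.
Qed.

Definition rcont (G : C -> R) (z : C) := forall e : R, 0 < e ->
  exists2 r : R, 0 < r & forall h, cabs h < r -> `|G (z + h) - G z| <= e.

Lemma rcontD G H z : rcont G z -> rcont H z -> rcont (fun z => G z + H z) z.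
Proof.
move=> Gz Hz e e0; have e20 : 0 < e / 2 by rewrite divr_gt0.
have [r1 r10 h1] := Gz _ e20; have [r2 r20 h2] := Hz _ e20.
exists (Num.min r1 r2); first by rewrite lt_min r10.
move=> h; rewrite lt_min => /andP[/h1 {}h1 /h2 {}h2].
by rewrite opprD addrACA (le_trans (ler_normD _ _))// (splitr e) lerD.
Qed.

Lemma rcontZ G k z : rcont G z -> rcont (fun z => k * G z) z.
Proof.
move=> Gz e e0; have k0 : 0 < `|k| + 1 by rewrite ltr_wpDl.
have [r r0 H] := Gz (e / (`|k| + 1)) ltac:(by rewrite divr_gt0).
exists r => // h /H {}H; rewrite -mulrBr normrM.
apply: le_trans (_ : (`|k| + 1) * `|G (z + h) - G z| <= _).
  by rewrite ler_wpM2r // lerDl.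
by rewrite mulrC -ler_pdivlMr.
Qed.

Lemma rcont_sqr G z : rcont G z -> rcont (fun z => G z ^+ 2) z.
Proof.
move=> Gz e e0; have k0 : 0 < 2 * `|G z| + 1 by rewrite ltr_wpDl // mulr_ge0.
have m0 : 0 < Num.min 1 (e / (2 * `|G z| + 1)) by rewrite lt_min ltr01 divr_gt0.
have [r r0 H] := Gz _ m0; exists r => // h /H; rewrite le_min => /andP[h1 h2].
rewrite subr_sqr normrM.
apply: le_trans (_ : (e / (2 * `|G z| + 1)) * (2 * `|G z| + 1) <= _); last first.
  by rewrite divfK // gt_eqF.
apply: ler_pM => //; rewrite (_ : _ + _ = (G (z + h) - G z) + (G z + G z)); last by ring.
apply: le_trans (ler_normD _ _) _; rewrite addrC lerD //.
by rewrite mulr2n mulrDl mul1r ler_normD.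
Qed.

Lemma rcont_lip G z : (forall h, `|G (z + h) - G z| <= cabs h) -> rcont G z.
Proof. by move=> H e e0; exists e => // h /ltW; apply: le_trans. Qed.

Lemma rcont_comp (p : C -> R) F z d : (forall a b, `|p a - p b| <= cabs (a - b)) ->
  cdiff F z d -> rcont (fun z => p (F z)) z.
Proof.
move=> pl /cdiff_cont Fc e e0; have [r r0 H] := Fc _ e0.
by exists r => // h /H; apply: le_trans.
Qed.

(** A square rather than a disc: being a product of two segments, it is compact because segments
    are. *)
Definition sq (z0 : C) (b : R) (z : C) := `|cre (z - z0)| <= b /\ `|cim (z - z0)| <= b.

Lemma square_max (z0 : C) (b : R) (G : C -> R) : 0 <= b ->
  (forall z, sq z0 b z -> rcont G z) ->
  exists2 z1, sq z0 b z1 & forall z, sq z0 b z -> G z <= G z1.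
Proof.
move=> b0 Gc.
pose g (xy : R * R) := G (z0 + (rc xy.1 + ci R * rc xy.2)).
pose K : set (R * R) := `[- b, b]%classic `*` `[- b, b]%classic.
have sqK (xy : R * R) : K xy -> sq z0 b (z0 + (rc xy.1 + ci R * rc xy.2)).
  case: xy => x y [/= xb yb]; rewrite /sq addrAC subrr add0r creE cimE !ler_norml.
  by move: xb yb; rewrite !in_itv.
have [|||xy Kxy H] := @compact_EVT_max _ R g K.
- by exists (0, 0); split=> /=; rewrite in_itv /= oppr_le0 b0.
- by apply: compact_setX; exact: segment_compact.
- apply: continuous_in_subspaceT => xy /set_mem Kxy; apply/cvgrPdist_le => e e0.
  have [r r0 H] := Gc _ (sqK _ Kxy) _ e0.
  have r20 : 0 < r / 2 by rewrite divr_gt0.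
  exists (ball xy.1 (r / 2), ball xy.2 (r / 2)).
    by split; exact: nbhsx_ballx.
  move=> [x y] [/=]; rewrite /ball /= => xr yr.
  rewrite distrC /g /=.
  have := H (rc (x - xy.1) + ci R * rc (y - xy.2)).
  rewrite (_ : z0 + _ + _ = z0 + (rc x + ci R * rc y)); last by rewrite !rcB; ring.
  apply; rewrite (le_lt_trans (cabsD _ _))// cabsM cabs_ci mul1r !cabs_rc.
  by rewrite distrC [`|y - _|]distrC; lra.
exists (z0 + (rc xy.1 + ci R * rc xy.2)); first by apply: sqK; exact: set_mem.
move=> z [zx zy].
have := H (cre (z - z0), cim (z - z0)); rewrite /g /= -cE subrKC; apply.
by apply/mem_set; split=> /=; rewrite in_itv /= -ler_norml.
Qed.

(* If |F z| exceeds the bound M on the boundary, then for c = conj (F z) and small eps > 0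
   the function Re (c F) + eps |w - z0|^2 has an interior maximum; adding its second
   derivatives in the directions 1 and i, the part coming from F cancels and 4 eps <= 0. *)
Lemma max_principle (z0 : C) (b M : R) (F f : C -> C) : 0 <= b ->
  (forall z, sq z0 b z -> cdiff F z (f z)) ->
  (forall z, sq z0 b z -> exists d, cdiff f z d) ->
  (forall z, sq z0 b z -> `|cre (z - z0)| = b \/ `|cim (z - z0)| = b -> cabs (F z) <= M) ->
  forall z, sq z0 b z -> cabs (F z) <= M.
Proof.
move=> b0 Fd fd FM z zb; rewrite leNgt; apply/negP => Mz.
set A := cabs (F z) in Mz.
pose c : C := conjc (F z : complex R).
have cA : cabs c = A by rewrite /A /c; case: (F z) => x y; rewrite /cabs /= sqrrN.
have cF : cre (c * F z) = A ^+ 2.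
  by rewrite /A cabs_sqr creM /c; case: (F z) => x y /=; ring.
have M0 : 0 <= M.
  apply: (le_trans (cabs_ge0 _)) (FM (z0 + rc b) _ _); rewrite /sq addrAC subrr add0r /=.
    by rewrite ger0_norm // normr0 lexx.
  by left; rewrite ger0_norm.
have A0 : 0 < A by exact: le_lt_trans Mz.
(* On the boundary Re (c F) <= A M and the quadratic term is below [eta], so the perturbed function
   is below A^2 there, while it is at least A^2 at z: its maximum is interior. *)
set eta := A * (A - M).
have eta0 : 0 < eta by rewrite mulr_gt0 // subr_gt0.
have k0 : 0 < 2 * b ^+ 2 + 1 by rewrite ltr_wpDl // mulr_ge0 // sqr_ge0.
have [eps epsE] : exists eps, eps = eta / (2 * b ^+ 2 + 1) by eexists.
have eps0 : 0 < eps by rewrite epsE divr_gt0.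
have epsb : eps * (2 * b ^+ 2) < eta.
  by rewrite epsE mulrAC ltr_pdivrMr // ltr_pM2l // ltrDl.
pose G w := cre (c * F w) + eps * (cre (w - z0) ^+ 2 + cim (w - z0) ^+ 2).
have Gd w k d (x y : R) : cabs k = 1 ->
   (forall t, cre (w + k * rc t - z0) ^+ 2 + cim (w + k * rc t - z0) ^+ 2 = (x + t) ^+ 2 + y) ->
   forall t, cdiff F (w + k * rc t) d ->
   rdiff (fun t => G (w + k * rc t)) t (cre (c * d * k) + 2 * eps * (x + t)).
  move=> k1 kE t wd; have := rdiffD (cdiff_line c k1 wd) (@rdiff_quad x y eps t).
  rewrite (_ : (fun t => _ + _) = (fun t => G (w + k * rc t))) //.
  by apply/funext => u /=; rewrite /G kE.
have [z1 z1b z1max] : exists2 z1, sq z0 b z1 & forall w, sq z0 b w -> G w <= G z1.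
  apply: square_max => // w wb; apply: rcontD.
    have -> : (fun z => cre (c * F z)) = (fun z => cre c * cre (F z) + (- cim c) * cim (F z)).
      by apply/funext => v; rewrite creM mulNr.
    apply: rcontD; apply: rcontZ; apply: rcont_comp (Fd _ wb) => u v.
      by rewrite -creN -creD cre_le.
    by rewrite -cimN -cimD cim_le.
  apply: rcontZ; apply: rcontD; apply: rcont_sqr; apply: rcont_lip => h.
    by rewrite -creN -creD (_ : _ - _ = h) ?cre_le //; ring.
  by rewrite -cimN -cimD (_ : _ - _ = h) ?cim_le //; ring.
have G1 : A ^+ 2 <= G z1.
  apply: le_trans (z1max z zb); rewrite /G cF lerDl.
  by rewrite mulr_ge0 ?addr_ge0 ?sqr_ge0 // ltW.
have z1int : `|cre (z1 - z0)| < b /\ `|cim (z1 - z0)| < b.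
  have [xb yb] := z1b.
  suff : ~ (`|cre (z1 - z0)| = b \/ `|cim (z1 - z0)| = b).
    move=> /not_orP[/eqP h1 /eqP h2].
    by rewrite !lt_neqAle h1 h2 xb yb.
  move=> /(FM _ z1b) h; move: G1; apply/negP; rewrite -ltNge /G.
  have h1 : cre (c * F z1) <= A * M.
    apply: le_trans (ler_norm _) _; apply: le_trans (cre_le _) _.
    by rewrite cabsM cA ler_wpM2l // ltW.
  have h2 : eps * (cre (z1 - z0) ^+ 2 + cim (z1 - z0) ^+ 2) <= eps * (2 * b ^+ 2).
    rewrite (ler_wpM2l (ltW eps0)) // mulr2n mulrDl mul1r.
    by rewrite lerD // -real_normK ?num_real // ler_sqr ?nnegrE.
  by move: epsb; rewrite /eta; lra.
have [d dz1] := fd _ z1b.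
set x1 := cre (z1 - z0) in z1int *; set y1 := cim (z1 - z0) in z1int *.
pose r := Num.min (b - `|x1|) (b - `|y1|).
have r0 : 0 < r by case: z1int => ? ?; rewrite lt_min !subr_gt0; apply/andP.
have key (k : C) (x y : R) : cabs k = 1 ->
   (forall t, cre (z1 + k * rc t - z0) ^+ 2 + cim (z1 + k * rc t - z0) ^+ 2 = (x + t) ^+ 2 + y) ->
   cre (c * d * k * k) + 2 * eps <= 0.
  move=> k1 kE; rewrite leNgt; apply/negP => s0.
  have inb t : `|t| < r -> sq z0 b (z1 + k * rc t).
    rewrite lt_min => /andP[t1 t2].
    rewrite /sq (_ : _ - z0 = (z1 - z0) + k * rc t); last by ring.
    rewrite creD cimD -/x1 -/y1; split.
      have := ler_normD x1 (cre (k * rc t)); have := cre_le (k * rc t).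
      by rewrite cabsM k1 mul1r cabs_rc; lra.
    have := ler_normD y1 (cim (k * rc t)); have := cim_le (k * rc t).
    by rewrite cabsM k1 mul1r cabs_rc; lra.
  apply: (@second_derivative_test (fun t => G (z1 + k * rc t))
     (fun t => cre (c * k * f (z1 + k * rc t)) + 2 * eps * (x + t)) _ r r0 s0).
  - move=> t tr; have := Gd z1 k _ x y k1 kE t (Fd _ (inb _ tr)).
    by rewrite (_ : c * f _ * k = c * k * f (z1 + k * rc t)) //; ring.
  - have dz1' : cdiff f (z1 + k * rc 0) d by rewrite rc0 mulr0 addr0.
    have := rdiffD (cdiff_line (c * k) k1 dz1') (rdiff_lin x (2 * eps) 0).
    by rewrite (_ : c * k * d * k = c * d * k * k) //; ring.
  - by move=> t tr; rewrite [in G (_ + k * rc 0)]rc0 mulr0 addr0; apply: z1max; exact: inb.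
have h1 := key 1 x1 (y1 ^+ 2) (cabs1 R).
have h2 := key (ci R) y1 (x1 ^+ 2) (cabs_ci R).
have {}h1 : cre (c * d * 1 * 1) + 2 * eps <= 0.
  apply: h1 => t; rewrite (_ : _ - z0 = (z1 - z0) + rc t); last by ring.
  by rewrite creD cimD -/x1 -/y1 /= addr0.
have {}h2 : cre (c * d * ci R * ci R) + 2 * eps <= 0.
  apply: h2 => t; rewrite (_ : _ - z0 = (z1 - z0) + ci R * rc t); last by ring.
  by rewrite creD cimD creM cimM -/x1 -/y1 /= !mul0r mulr0 mul1r subr0 add0r addr0 addrC.
move: h1 h2; rewrite !mulr1 -mulrA (_ : ci R * ci R = -1); last first.
  by have := sqr_i R; rewrite expr2.
by rewrite mulrN1 creN; lra.
Qed.

End MaxPrinciple.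

(** * Propagation of zeros in one variable *)

Section Identity.
Variable R : realType.
Local Notation C := (Cplx R).
Implicit Types (f g F : C -> C) (z d : C).

Definition near0 f z := exists2 r : R, 0 < r & forall w, cabs (w - z) < r -> f w = 0.

Lemma cdiff_unique f z d d' : cdiff f z d -> cdiff f z d' -> d = d'.
Proof. by move=> /is_derive_cdiff[_ <-] /is_derive_cdiff[_ <-]. Qed.

Lemma near0_cdiff f z : near0 f z -> cdiff f z 0.
Proof.
move=> [r r0 H] e e0; exists r => // h hr.
have zh : cabs (z + h - z) < r by rewrite (_ : _ - z = h) //; ring.
have zz : cabs (z - z) < r by rewrite subrr cabs0.
by rewrite (H _ zh) (H _ zz) mul0r !subr0 cabs0 mulr_ge0 ?cabs_ge0 // ltW.
Qed.

Lemma near0_near f z : near0 f z -> exists2 r : R, 0 < r &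
  forall w, cabs (w - z) < r -> near0 f w.
Proof.
move=> [r r0 H]; exists (r / 2); first by rewrite divr_gt0.
move=> w wz; exists (r / 2); first by rewrite divr_gt0.
move=> v vw; apply: H; rewrite (_ : v - z = (v - w) + (w - z)); last by ring.
by rewrite (le_lt_trans (cabsD _ _))//; lra.
Qed.

Lemma cdiff_div f z0 z d : z != z0 -> cdiff f z d ->
  cdiff (fun z => f z / (z - z0)) z (d / (z - z0) - f z / (z - z0) ^+ 2).
Proof.
move=> zz0 fd e e0.
have k0 : z - z0 != 0 by rewrite subr_eq0.
set k := cabs (z - z0); have k_gt0 : 0 < k by exact: cabs_gt0.
have [r1 r10 h1] := fd (e * k / 4) ltac:(by rewrite divr_gt0 // mulr_gt0).
pose m := cabs (d / (z - z0) - f z / (z - z0) ^+ 2) + 1.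
have m0 : 0 < m by rewrite ltr_wpDl ?cabs_ge0.
exists (Num.min r1 (Num.min (k / 2) (e * k / (4 * m)))).
  by rewrite !lt_min r10 !divr_gt0 // ?mulr_gt0.
move=> h; rewrite !lt_min => /and3P[hr1 hk hm].
have kh : k / 2 <= cabs (z + h - z0).
  have := cabsD (z + h - z0) (- h); rewrite cabsN (_ : _ + - h = z - z0); last by ring.
  rewrite -/k; lra.
have kh0 : z + h - z0 != 0.
  by apply/eqP => h0; move: kh; rewrite h0 cabs0; lra.
pose q := d / (z - z0) - f z / (z - z0) ^+ 2.
rewrite -/q (_ : _ - _ - _ = ((f (z + h) - f z - d * h) - q * h * h) / (z + h - z0)); last first.
  by rewrite /q; field; rewrite k0 kh0.
rewrite cabsM cabsV ler_pdivrMr; last by apply: lt_le_trans kh; rewrite divr_gt0.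
apply: le_trans (cabsD _ _) _; rewrite cabsN !cabsM.
apply: le_trans (_ : e * cabs h * (k / 2) <= _); last first.
  by rewrite ler_wpM2l // mulr_ge0 ?cabs_ge0 // ltW.
have H1 := h1 _ hr1.
have H2 : cabs q * cabs h <= e * k / 4.
  apply: le_trans (_ : m * (e * k / (4 * m)) <= _); last first.
    by rewrite le_eqVlt; apply/orP; left; apply/eqP; field; rewrite gt_eqF.
  by apply: ler_pM; rewrite ?cabs_ge0 //; [rewrite /m lerDl|exact: ltW].
have := ler_wpM2r (cabs_ge0 h) H2.
by rewrite (_ : e * cabs h * (k / 2) = e * k / 4 * cabs h + e * k / 4 * cabs h); [lra|field].
Qed.

Lemma cdiffB f g z d d' : cdiff f z d -> cdiff g z d' -> cdiff (fun z => f z - g z) z (d - d').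
Proof. by move=> /is_derive_cdiff ? /is_derive_cdiff ?; apply/is_derive_cdiff; exact: is_deriveB. Qed.

Variables (c0 : C) (rho : R).
Local Notation dom z := (cabs (z - c0) < rho).

(* The derivative of F is itself differentiable: this is what the maximum principle needs,
   and, unlike analyticity, it passes to F(z) / (z - c0) without any further theory. *)
Definition smooth2 F := exists f, forall z, dom z -> cdiff F z (f z) /\ exists d, cdiff f z d.

(** No removable singularity arises: F and its derivative vanish near c0, so all quotients vanish
    there, including at c0 itself, where division by 0 gives 0. *)
Lemma smooth2_div F : smooth2 F -> near0 F c0 ->
  smooth2 (fun z => F z / (z - c0)) /\ near0 (fun z => F z / (z - c0)) c0.
Proof.
move=> [f Ff] F0; split; last first.
  by case: F0 => r r0 H; exists r => // w /H ->; rewrite mul0r.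
have [r r0 H] := near0_near F0.
have f0 w : dom w -> cabs (w - c0) < r -> f w = 0.
  by move=> wd /H/near0_cdiff; apply: cdiff_unique; case: (Ff w wd).
exists (fun z => f z / (z - c0) - F z / (z - c0) / (z - c0)) => z zd.
have [Fz [d fz]] := Ff z zd.
have [->|zc] := eqVneq z c0; last first.
  split; first by have := cdiff_div zc Fz; rewrite expr2 invfM mulrA.
  exists ((d / (z - c0) - f z / (z - c0) ^+ 2) -
    ((f z / (z - c0) - F z / (z - c0) ^+ 2) / (z - c0) - (F z / (z - c0)) / (z - c0) ^+ 2)).
  by apply: cdiffB; first exact: cdiff_div; apply: (cdiff_div zc); exact: cdiff_div.
have rho0 : 0 < rho by apply: le_lt_trans zd; exact: cabs_ge0.
have G0 : near0 (fun z => F z / (z - c0)) c0.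
  by case: F0 => r' r0' H'; exists r' => // w /H' ->; rewrite mul0r.
split.
  by rewrite subrr invr0 !mulr0 subrr; apply: near0_cdiff.
exists 0; apply: near0_cdiff; have [r' r0' H'] := G0.
exists (Num.min rho (Num.min r r')); first by rewrite !lt_min rho0 r0.
move=> w; rewrite !lt_min => /and3P[wd wr wr'].
by rewrite (f0 _ wd wr) (H' _ wr') !mul0r subrr.
Qed.

Lemma smooth2_pow F n : smooth2 F -> near0 F c0 -> smooth2 (fun z => F z / (z - c0) ^+ n).
Proof.
move=> Fs F0; suff [] : smooth2 (fun z => F z / (z - c0) ^+ n) /\
   near0 (fun z => F z / (z - c0) ^+ n) c0 by [].
elim: n => [|n [IHs IH0]].
  by rewrite (_ : (fun z => _) = F) //; apply/funext => z; rewrite expr0 divr1.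
have [] := smooth2_div IHs IH0.
by rewrite (_ : (fun z => _ / _) = (fun z => F z / (z - c0) ^+ n.+1)) //;
  apply/funext => z; rewrite exprSr invfM mulrA.
Qed.

(* On the square of half-side b = 3 rho / 5, |F z| <= M (|z - c0| / b)^n for every n, and
   |z - c0| / b <= 5/6 for z in the disc of radius rho / 2. *)
Lemma smooth2_vanish F : smooth2 F -> near0 F c0 -> forall z, cabs (z - c0) < rho / 2 -> F z = 0.
Proof.
move=> Fs F0 z zr; have rho0 : 0 < rho / 2 by apply: le_lt_trans zr; exact: cabs_ge0.
set b := rho * 3 / 5.
have b0 : 0 < b by rewrite /b; lra.
(* The square fits into the disc because 2 (3/5)^2 = 18/25 < 1. *)
have sqdom w : sq c0 b w -> dom w.
  move=> [h1 h2]; rewrite -ltr_sqr ?nnegrE ?cabs_ge0 //; last by lra.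
  rewrite cabs_sqr -(real_normK (num_real (cre _))) -(real_normK (num_real (cim _))).
  have s1 : `|cre (w - c0)| ^+ 2 <= b ^+ 2 by rewrite ler_sqr ?nnegrE // ltW.
  have s2 : `|cim (w - c0)| ^+ 2 <= b ^+ 2 by rewrite ler_sqr ?nnegrE // ltW.
  apply: le_lt_trans (lerD s1 s2) _; rewrite /b; nra.
have [z1 z1b Fmax] : exists2 z1, sq c0 b z1 & forall w, sq c0 b w -> cabs (F w) <= cabs (F z1).
  have [f Ff] := Fs; apply: square_max; first exact: ltW.
  move=> w /sqdom wd; have [Fw _] := Ff w wd; apply: rcont_comp Fw => x y.
  rewrite ler_norml lerBrDr lerBlDr; apply/andP; split.
    by have := cabsD (y - x) x; rewrite subrK (cabsB y); lra.
  by have := cabsD (x - y) y; rewrite subrK; lra.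
set M := cabs (F z1) in Fmax.
have zsq : sq c0 b z.
  split; first by apply: le_trans (cre_le _) _; rewrite /b; lra.
  by apply: le_trans (cim_le _) _; rewrite /b; lra.
have key n : cabs (F z) <= M * (cabs (z - c0) / b) ^+ n.
  have [zc|zc] := eqVneq z c0.
    have [r r0 ->] := F0; first by rewrite cabs0 mulr_ge0 ?cabs_ge0 // exprn_ge0 // divr_ge0 ?cabs_ge0 // ltW.
    by rewrite zc subrr cabs0.
  have [f Ff] := smooth2_pow n Fs F0.
  have cX w : cabs (w ^+ n) = cabs w ^+ n.
    by elim: n {f Ff} => [|n IH]; rewrite ?expr0 ?cabs1 // !exprSr cabsM IH.
  have H : cabs (F z / (z - c0) ^+ n) <= M / b ^+ n.
    apply: (max_principle (ltW b0) (fun w wb => (Ff w (sqdom w wb)).1)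
      (fun w wb => (Ff w (sqdom w wb)).2) _ zsq) => w wb wbd.
    rewrite cabsM cabsV cX; apply: ler_pM; rewrite ?cabs_ge0 ?invr_ge0 ?exprn_ge0 ?cabs_ge0 //.
      exact: Fmax.
    have wb' : b <= cabs (w - c0) by case: wbd => <-; rewrite ?cre_le ?cim_le.
    rewrite lef_pV2 ?posrE ?exprn_gt0 //; last exact: lt_le_trans wb'.
    by rewrite lerXn2r ?nnegrE ?cabs_ge0 // ltW.
  rewrite cabsM cabsV cX ler_pdivrMr ?exprn_gt0 ?cabs_gt0 ?subr_eq0 // in H.
  apply: (le_trans H); rewrite le_eqVlt; apply/orP; left; apply/eqP.
  by rewrite [in RHS]expr_div_n mulrAC mulrA.
apply: cabs_eq0; apply/eqP; rewrite eq_le cabs_ge0 andbT.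
apply/ler_addgt0Pr => e e0; rewrite add0r.
have q56 : cabs (z - c0) / b <= 5 / 6.
  by rewrite ler_pdivrMr // /b; lra.
have q0 : 0 <= cabs (z - c0) / b by rewrite divr_ge0 ?cabs_ge0 // ltW.
(* Since (5/6)^4 < 1/2, the decay along multiples of 4 is controlled by [half_powers]. *)
have q4 : (cabs (z - c0) / b) ^+ 4 <= 2^-1.
  apply: le_trans (_ : (5 / 6) ^+ 4 <= _); last by lra.
  by rewrite lerXn2r ?nnegrE //; lra.
have k0 : 0 < M + 1 by rewrite ltr_wpDl ?cabs_ge0.
have [n Hn] := @half_powers R (e / (M + 1)) ltac:(by rewrite divr_gt0).
apply: le_trans (key (4 * n)%N) _; rewrite exprM.
apply: le_trans (_ : (M + 1) * 2 ^- n <= _); last by rewrite mulrC -ler_pdivlMr // ltW.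
apply: ler_pM; rewrite ?cabs_ge0 ?exprn_ge0 ?lerDl // -exprVn.
by rewrite lerXn2r ?nnegrE ?exprn_ge0 ?invr_ge0.
Qed.

Lemma disc_vanish f : (forall z, dom z -> exists d, cdiff f z d) -> near0 f c0 ->
  forall z, cabs (z - c0) < rho / 2 -> f z = 0.
Proof.
move=> fd f0 z zr.
have rho0 : 0 < rho by have := le_lt_trans (cabs_ge0 _) zr; lra.
have cd : dom c0 by rewrite subrr cabs0.
have JF w : dom w -> cdiff (J f c0) w (f w) by exact: J_primitive.
have Js : smooth2 (J f c0) by exists f => w wd; split; [exact: JF|exact: fd].
have [r r0 H] := f0.
have J0 : near0 (J f c0) c0.
  exists (Num.min r rho); first by rewrite lt_min r0.
  move=> w; rewrite lt_min => /andP[wr wd].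
  have := @J_affine _ f c0 rho fd c0 w 0 0 0 cd wd.
  rewrite mulr0 mul0r addr0 mulr0 subr0 => h; apply: cabs_eq0.
  apply/eqP; rewrite eq_le cabs_ge0 andbT; apply: h => t t1.
  rewrite mul0r addr0 subr0 H ?cabs0 //.
  by apply: seg_dist_lt => //; rewrite subrr cabs0.
have zd : dom z by lra.
apply: cdiff_unique (JF _ zd) (near0_cdiff _).
exists (rho / 2 - cabs (z - c0)); first by rewrite subr_gt0.
move=> w wz; apply: (smooth2_vanish Js J0).
by rewrite (_ : w - c0 = (w - z) + (z - c0)) ?(le_lt_trans (cabsD _ _)) -?ltrBrDr //; ring.
Qed.

End Identity.

(** Along [0, 1] in steps of at most rho / 4: the disc of radius rho / 4 about the next point lies
    in the disc of radius rho / 2 about the present one, where [disc_vanish] applies. *)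
Lemma segment_vanish (R : realType) (f : Cplx R -> Cplx R) (rho : R) : 0 < rho ->
  (forall t, I01 t -> forall z, cabs (z - rc t) < rho -> exists d, cdiff f z d) ->
  near0 f 0 -> f 1 = 0.
Proof.
move=> rho0 fd f0.
pose t n := Num.min (n%:R * (rho / 4)) 1 : R.
have tI n : I01 (t n) by rewrite /I01 /t le_min ge_min lexx ler01 orbT !andbT mulr_ge0 ?divr_ge0 // ltW.
have key n : near0 f (rc (t n)).
  elim: n => [|n IH].
    by rewrite /t mul0r min_l ?ler01 // rc0.
  exists (rho / 4); first by rewrite divr_gt0.
  move=> w wt; apply: (disc_vanish (fd _ (tI n)) IH).
  rewrite (_ : w - _ = (w - rc (t n.+1)) + rc (t n.+1 - t n)); last by rewrite rcB; ring.
  rewrite (le_lt_trans (cabsD _ _))// cabs_rc.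
  suff : `|t n.+1 - t n| <= rho / 4 by lra.
  rewrite /t -natr1 mulrDl mul1r; set x := n%:R * _.
  by rewrite ler_norml /Num.min; case: ifP; case: ifP; lra.
have [n Hn] : exists n : nat, 1 <= n%:R * (rho / 4).
  exists (Num.Def.archi_bound (4 / rho)).
  have h4 : 0 <= 4 / rho by rewrite divr_ge0 // ltW.
  have := archi_boundP h4; set m := _%:R => h.
  by rewrite mulrA ler_pdivlMr // mul1r -ler_pdivrMr // ltW.
have [r r0 H] := key n; apply: H; rewrite /t min_r // rc1 subrr cabs0 //.
Qed.

(** * Generic identities and meromorphic functions *)

Section Generic.
Variable R : realType.
Local Notation C := (Cplx R).
Variable W : normedModType C.
Implicit Types (E U N : set W) (P Q : W -> Prop) (f g h : W -> C).

Lemma closureE E x : closure E x <-> forall N, open N -> N x -> E `&` N !=set0.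
Proof.
split=> [Ex N No Nx|H B]; first by apply: Ex; exact: open_nbhs_nbhs.
by rewrite nbhsE => -[N [No Nx] NB]; have [y [Ey Ny]] := H N No Nx; exists y; split=> //; exact: NB.
Qed.

Lemma open_nbhsP U : (forall x, U x -> exists N, [/\ open N, N x & N `<=` U]) -> open U.
Proof.
move=> H; rewrite openE => x /H[N [No Nx NU]]; rewrite /interior nbhsE.
by exists N.
Qed.

Lemma generic_all E Q : (forall x, E x -> Q x) -> generically E Q.
Proof.
move=> H; exists setT; split=> //; first exact: openT.
  by rewrite setIT; exact: subset_closure.
by move=> x Ex _; exact: H.
Qed.

Lemma generic_and E P Q : generically E P -> generically E Q ->
  generically E (fun x => P x /\ Q x).
Proof.
move=> [U [Uo EU UP]] [N [No EN NQ]]; exists (U `&` N); split.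
- exact: openI.
- move=> x Ex; apply/closureE => M Mo Mx.
  have /closureE/(_ M Mo Mx)[y [[Ey Uy] My]] := EU x Ex.
  have /closureE/(_ (M `&` U) (openI Mo Uo))[//|z [[Ez Nz] [Mz Uz]]] := EN y Ey.
  by exists z.
- by move=> x Ex [Ux Nx]; split; [exact: UP|exact: NQ].
Qed.

Lemma generic_imp E P Q : (forall x, E x -> P x -> Q x) -> generically E P -> generically E Q.
Proof.
by move=> PQ [U [Uo EU UP]]; exists U; split=> // x Ex Ux; apply: PQ => //; exact: UP.
Qed.

Lemma generic_imp2 E P Q T : (forall x, E x -> P x -> Q x -> T x) ->
  generically E P -> generically E Q -> generically E T.
Proof.
by move=> H gP gQ; apply: generic_imp (generic_and gP gQ) => x Ex [Px Qx]; exact: H.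
Qed.

Lemma generic_restrict E N Q : open N -> generically E Q -> generically (E `&` N) Q.
Proof.
move=> No [U [Uo EU UQ]]; exists U; split=> //; last by move=> x [Ex _]; exact: UQ.
move=> x [Ex Nx]; apply/closureE => M Mo Mx.
have /closureE/(_ (M `&` N) (openI Mo No))[//|y [[Ey Uy] [My Ny]]] := EU x Ex.
by exists y.
Qed.

Lemma generic_local E Q :
  (forall x, E x -> exists N, [/\ open N, N x & generically (E `&` N) Q]) -> generically E Q.
Proof.
move=> H.
(* The union over all admissible pairs: openness is immediate and no neighbourhood has to be chosen
   for each point. *)
exists (fun y => exists N U, [/\ open N, open U & N y /\ U y /\ (forall x, (E `&` N) x -> U x -> Q x)]); split.
- apply: open_nbhsP => y [N [U [No Uo [Ny [Uy HQ]]]]].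
  exists (N `&` U); split; [exact: openI|by split|].
  by move=> z [Nz Uz]; exists N, U.
- move=> x Ex; have [N [No Nx [U [Uo EU UQ]]]] := H x Ex.
  apply/closureE => M Mo Mx.
  have /closureE/(_ M Mo Mx)[y [[[Ey Ny] Uy] My]] := EU x (conj Ex Nx).
  by exists y; split=> //; split=> //; exists N, U.
- by move=> x Ex [N [U [_ _ [Nx [Ux HQ]]]]]; exact: HQ.
Qed.

(** The point x excludes the empty set, on which every property is generic. *)
Lemma generic_contra E Q x : E x -> generically E Q -> generically E (fun x => ~ Q x) -> False.
Proof.
move=> Ex gQ gN; have [U [Uo EU UQ]] := generic_and gQ gN.
have /closureE/(_ setT openT I)[y [[Ey Uy] _]] := EU x Ex.
by have [? ?] := UQ y Ey Uy.
Qed.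

Lemma generic_translate E E' (v : W) Q : (forall x, E' x <-> E (x + v)) ->
  generically E Q -> generically E' (fun x => Q (x + v)).
Proof.
move=> EE [U [Uo EU UQ]].
have tro (M : set W) (u : W) : open M -> open (fun x => M (x + u)).
  move=> Mo; apply: (@open_comp _ _ (fun x => x + u) M) => // x _.
  by apply: continuousD; [exact: cvg_id|exact: cvg_cst].
exists (fun x => U (x + v)); split.
- exact: tro.
- move=> x /EE Ex; apply/closureE => M Mo Mx.
  have /closureE/(_ (fun y => M (y + - v)) (tro _ _ Mo))[|y [[Ey Uy] My]] := EU _ Ex.
    by rewrite addrK.
  by exists (y - v); split=> //; split; [apply/EE|]; rewrite subrK.
- by move=> x /EE Ex Ux; exact: UQ.
Qed.

(** The norm of a module over [C] is [C]-valued; this is its real counterpart. *)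
Definition nm (v : W) : R := cre `|v|.
Lemma nmE v : `|v| = rc (nm v). Proof. exact: ge0_rc. Qed.
Lemma nm_ge0 v : 0 <= nm v. Proof. by rewrite -rc_le -nmE rc0. Qed.
Lemma nmD u v : nm (u + v) <= nm u + nm v.
Proof. by rewrite -rc_le rcD -!nmE ler_normD. Qed.
Lemma nmZ (a : C) v : nm (a *: v) = cabs a * nm v.
Proof. by rewrite /nm normrZ nmE normE -rcM. Qed.
Lemma open_nm U x : open U -> U x -> exists2 r : R, 0 < r & forall y, nm (y - x) < r -> U y.
Proof.
rewrite openE => H /H /nbhs_ballP[e /= e0 eU].
exists (cre e); first exact: gt0_rc.
move=> y yx; apply: eU; rewrite -ball_normE /= -normrN opprB nmE (ge0_rc (ltW e0)).
by rewrite rc_lt.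
Qed.

Lemma open_nmball x (r : R) : open (fun y => nm (y - x) < r).
Proof.
rewrite openE => y yx; apply/nbhs_ballP; exists (rc (r - nm (y - x))).
  by rewrite /= -rc0 rc_lt subr_gt0.
move=> z; rewrite -ball_normE /= -normrN opprB nmE rc_lt => zy.
rewrite (_ : z - x = (z - y) + (y - x)); last by rewrite addrA subrK.
by rewrite (le_lt_trans (nmD _ _))// -ltrBrDr.
Qed.

Lemma affine_line_cdiff g (y d : W) (z : C) : differentiable g (y + z *: d) ->
  exists c, cdiff (fun z => g (y + z *: d)) z c.
Proof.
move=> gd.
have /derivable1_diffP hd : differentiable (g \o (fun z : C^o => y + z *: d)) z.
  apply: differentiable_comp => //.
by exists ('D_1 (g \o (fun z : C^o => y + z *: d)) z); apply/is_derive_cdiff; split.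
Qed.

Definition affine_set E := forall x y (z : C), E x -> E y -> E (x + z *: (y - x)).

(* Restrict g to the complex line through y0 and y. *)
Lemma holo_vanish E (x : W) (r : R) g N : affine_set E ->
  (forall y, nm (y - x) < r -> differentiable g y) -> open N ->
  (forall y, E y -> N y -> nm (y - x) < r -> g y = 0) ->
  forall y0 y, E y0 -> N y0 -> nm (y0 - x) < r -> E y -> nm (y - x) < r -> g y = 0.
Proof.
move=> Ea gd No g0 y0 y Ey0 Ny0 y0r Ey yr.
set d := y - y0.
pose m := Num.max (nm (y0 - x)) (nm (y - x)).
have mr : m < r by rewrite gt_max y0r.
have k0 : 0 < nm d + 1 by rewrite ltr_wpDl // nm_ge0.
have rho0 : 0 < (r - m) / (nm d + 1) by rewrite divr_gt0 // subr_gt0.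
have small (z : C) : cabs z < (r - m) / (nm d + 1) -> nm (z *: d) < r - m.
  rewrite ltr_pdivlMr // => h; rewrite nmZ; apply: le_lt_trans h.
  by rewrite ler_wpM2l ?cabs_ge0 // lerDl.
have inr (t : R) (z : C) : I01 t -> cabs (z - rc t) < (r - m) / (nm d + 1) -> nm (y0 + z *: d - x) < r.
  move=> /andP[t0 t1] /small zt.
  rewrite (_ : _ - x = (z - rc t) *: d + (rc (1 - t) *: (y0 - x) + rc t *: (y - x))); last first.
    have -> : rc (1 - t) *: (y0 - x) + rc t *: (y - x) = (y0 - x) + rc t *: d.
      rewrite rcB rc1 scalerBl scale1r -addrA; congr (_ + _).
      by rewrite addrC -scalerBr; congr (_ *: _); rewrite opprB addrA subrK.
    by rewrite scalerBl [_ + rc t *: d]addrC addrA subrK addrC addrAC.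
  apply: le_lt_trans (nmD _ _) _; rewrite -ltrBrDr; apply: lt_le_trans zt _.
  rewrite lerD2l lerN2; apply: le_trans (nmD _ _) _; rewrite !nmZ !cabs_rc !ger0_norm ?subr_ge0 //.
  rewrite (_ : m = (1 - t) * m + t * m); last by ring.
  by rewrite lerD // ler_wpM2l ?subr_ge0 // /m le_max lexx ?orbT.
have := @segment_vanish R (fun z => g (y0 + z *: d)) _ rho0.
rewrite /d scale1r subrKC; apply.
  by move=> t t1 z zt; apply: affine_line_cdiff; apply: gd; exact: inr zt.
have [s s0 Hs] := open_nm No Ny0.
exists (Num.min ((r - m) / (nm d + 1)) (s / (nm d + 1))).
  by rewrite lt_min rho0 divr_gt0.
move=> z; rewrite subr0 lt_min => /andP[z1 z2]; apply: g0.
- exact: Ea.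
- apply: Hs; rewrite addrAC subrr add0r nmZ -/d.
  move: z2; rewrite ltr_pdivlMr // => h; apply: le_lt_trans h.
  by rewrite ler_wpM2l ?cabs_ge0 // lerDl.
- by apply: (inr 0); rewrite ?rc0 ?subr0 //; exact: I01_0.
Qed.

End Generic.

(** * Meromorphic functions on affine sets *)

Section Mero.
Variable R : realType.
Local Notation C := (Cplx R).
Variable W : normedModType C.
Implicit Types (E U N : set W) (P Q : W -> Prop) (f g h : W -> C).

Lemma open_neq0 g N : open N -> holomorphic_on N g -> open [set y | N y /\ g y != 0].
Proof.
move=> No gd; rewrite openE => y [Ny gy0].
have := differentiable_continuous (gd y Ny) => gc.
have h1 : nbhs y N by exact: open_nbhs_nbhs.
have h2 : nbhs y [set z | g z != 0].
  apply: (gc [set w | w != 0]); apply/nbhs_cabs; exists (cabs (g y)); first exact: cabs_gt0.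
  move=> w wg /=; apply/eqP => w0; move: wg; rewrite w0 cabsB subr0 ltxx //.
rewrite /interior; apply: filterS2 h1 h2 => z; exact: conj.
Qed.

Lemma holo_dichotomy E (x : W) (r : R) g : affine_set E ->
  holomorphic_on (fun y => nm (y - x) < r) g ->
  (forall y, E y -> nm (y - x) < r -> g y = 0) \/
  generically (E `&` (fun y => nm (y - x) < r)) (fun y => g y != 0).
Proof.
move=> Ea gd; set B := (fun y => _ : Prop).
have [[y0 [N [[Ey0 By0] No Ny0 H]]]|H] := pselect (exists y0 N, [/\ (E `&` B) y0, open N, N y0 &
    forall y, E y -> N y -> B y -> g y = 0]).
  by left=> y Ey By; exact: (holo_vanish Ea gd No H Ey0 Ny0 By0 Ey By).
right; exists [set y | B y /\ g y != 0]; split.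
- by apply: open_neq0 => //; exact: open_nmball.
- move=> y [Ey By]; apply/closureE => N No Ny.
  apply/set0P/negP => /eqP N0; apply: H; exists y, N; split=> //.
  move=> z Ez Nz Bz; apply/eqP/negPn/negP => gz.
  by have : set0 z by rewrite -N0; split.
- by move=> y _ [].
Qed.

Lemma mero_local E f : affine_set E -> meromorphic_on E f -> forall x, E x ->
  (exists N, [/\ open N, N x & generically (E `&` N) (fun y => f y = 0)]) \/
  (exists N, [/\ open N, N x & generically (E `&` N) (fun y => f y != 0)]).
Proof.
move=> Ea fm x Ex; have [U [g [h [Uo Ux gh hh gf]]]] := fm x Ex.
have [r r0 rU] := open_nm Uo Ux.
set B := (fun y : W => nm (y - x) < r).
have Bo : open B by exact: open_nmball.
have Bx : B x by rewrite /B subrr /nm normr0.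
have gB : holomorphic_on B g by move=> y /rU; exact: gh.
have gf' : generically (E `&` B) (fun y => h y != 0 /\ f y = g y / h y).
  have := generic_restrict Bo gf; congr generically; apply/seteqP; split=> y.
    by move=> [[Ey _] By].
  by move=> [Ey By]; split=> //; split=> //; exact: rU.
have [g0|g0] := holo_dichotomy Ea gB; [left|right]; exists B; split => //.
  by apply: generic_imp gf' => y [Ey By] [_ ->]; rewrite g0 // mul0r.
apply: generic_imp2 gf' g0 => y [Ey By] [h0 ->] gy0.
by rewrite mulf_neq0 // invr_neq0.
Qed.

Lemma continuous_line (x d : W) : continuous (fun t : R => x + rc t *: d).
Proof.
move=> t; apply/cvgrPdist_lt => e e0.
have k0 : 0 < nm d + 1 by rewrite ltr_wpDl // nm_ge0.
apply/nbhs_ballP; exists (cre e / (nm d + 1)); first by rewrite /= divr_gt0 // gt0_rc.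
move=> s; rewrite /ball /= => ts.
rewrite opprD addrACA subrr add0r -scalerBl -rcB nmE nmZ cabs_rc (ge0_rc (ltW e0)) rc_lt.
rewrite ltr_pdivlMr // in ts; apply: le_lt_trans ts.
by rewrite ler_wpM2l // lerDl.
Qed.

(* The sets where f is locally generically zero, resp. nonzero, are open and disjoint on E;
   the segment between two points of E is connected. *)
Lemma mero_generic E f : affine_set E -> meromorphic_on E f ->
  eq_mero E f (fun=> 0) \/ generically E (fun x => f x != 0).
Proof.
move=> Ea fm.
pose OZ : set W := fun x => exists N, [/\ open N, N x & generically (E `&` N) (fun y => f y = 0)].
pose ON : set W := fun x => exists N, [/\ open N, N x & generically (E `&` N) (fun y => f y != 0)].
have OZo : open OZ by apply: open_nbhsP => x [N [No Nx HN]]; exists N; split=> // y Ny; exists N.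
have ONo : open ON by apply: open_nbhsP => x [N [No Nx HN]]; exists N; split=> // y Ny; exists N.
have disj x : E x -> OZ x -> ON x -> False.
  move=> Ex [N [No Nx HN]] [M [Mo Mx HM]].
  have h1 := generic_restrict Mo HN; have h2 := generic_restrict No HM.
  rewrite -setIA (setIC N M) setIA in h1.
  have ENM : (E `&` M `&` N) x by [].
  apply: (generic_contra ENM h1); apply: generic_imp h2 => y _ /eqP; exact.
have [[x0 Ex0 Zx0]|NZ] := pselect (exists2 x, E x & OZ x); last first.
  right; apply: generic_local => x Ex.
  by have [Zx|//] := mero_local Ea fm Ex; exfalso; apply: NZ; exists x.
left; apply: generic_local => x1 Ex1.
suff : OZ x1 by [].
pose p t := x0 + rc t *: (x1 - x0).
have pE t : E (p t) by exact: Ea.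
have pc : continuous p by exact: continuous_line.
have cI : connected `[(0:R), 1] by exact: segment_connected.
have := cI (`[0, 1]%classic `&` p @^-1` OZ) => H.
have : `[0, 1]%classic `&` p @^-1` OZ = `[(0:R), 1]%classic.
  apply: H.
  - exists 0; split; first by rewrite /= in_itv /= lexx ler01.
    by rewrite /= /p rc0 scale0r addr0.
  - by exists (p @^-1` OZ) => //; apply: open_comp => // t _; exact: pc.
  - exists (p @^-1` (~` ON)).
      by apply: closed_comp => [t _|]; [exact: pc|exact: open_closedC].
    apply/seteqP; split=> t [tI pO]; split=> //.
      by move=> pN; exact: (disj _ (pE t) pO pN).
    by have [Z|pN] := mero_local Ea fm (pE t); [exact: Z|exfalso; exact: pO].
move=> /seteqP[_ /(_ 1)] []; first by rewrite /= in_itv /= lexx ler01.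
by move=> _; rewrite /= /p rc1 scale1r subrKC.
Qed.

Lemma mero_eq E f f' : eq_mero E f f' -> meromorphic_on E f -> meromorphic_on E f'.
Proof.
move=> ff fm x Ex; have [U [g [h [Uo Ux gd hd gh]]]] := fm x Ex.
exists U, g, h; split=> //; have ff' := generic_restrict Uo ff.
by apply: generic_imp2 gh ff' => y _ [h0 fE] <-.
Qed.

Lemma mero_holo E g : holomorphic_on setT g -> meromorphic_on E g.
Proof.
move=> gd x Ex; exists setT, g, (fun=> 1); split.
- exact: openT.
- by [].
- by move=> y _; exact: gd.
- by move=> y _; exact: differentiable_cst.
- by apply: generic_all => y _; rewrite oner_neq0 divr1.
Qed.

(** The two local fractions live on different neighbourhoods and are restricted to the intersection
    once for all operations; [opg] and [oph] are the numerator and denominator of the result. *)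
Lemma mero_pair E f1 f2 (op : C -> C -> C) (opg oph : C -> C -> C -> C -> C) :
  meromorphic_on E f1 -> meromorphic_on E f2 ->
  (forall x, E x -> forall U g1 h1 g2 h2, open U -> U x ->
     holomorphic_on U g1 -> holomorphic_on U h1 -> holomorphic_on U g2 -> holomorphic_on U h2 ->
     generically (E `&` U) (fun y => h1 y != 0 /\ f1 y = g1 y / h1 y) ->
     generically (E `&` U) (fun y => h2 y != 0 /\ f2 y = g2 y / h2 y) ->
     [/\ holomorphic_on U (fun y => opg (g1 y) (h1 y) (g2 y) (h2 y)),
         holomorphic_on U (fun y => oph (g1 y) (h1 y) (g2 y) (h2 y)) &
         generically (E `&` U) (fun y => oph (g1 y) (h1 y) (g2 y) (h2 y) != 0 /\
          op (f1 y) (f2 y) = opg (g1 y) (h1 y) (g2 y) (h2 y) / oph (g1 y) (h1 y) (g2 y) (h2 y))]) ->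
  meromorphic_on E (fun y => op (f1 y) (f2 y)).
Proof.
move=> m1 m2 H x Ex.
have [U1 [g1 [h1 [U1o U1x g1d h1d gh1]]]] := m1 x Ex.
have [U2 [g2 [h2 [U2o U2x g2d h2d gh2]]]] := m2 x Ex.
have r1 := generic_restrict U2o gh1; have r2 := generic_restrict U1o gh2.
rewrite -setIA in r1; rewrite -setIA (setIC U2 U1) in r2.
have [] := H x Ex (U1 `&` U2) g1 h1 g2 h2 _ _ _ _ _ _ r1 r2 => //.
- exact: openI.
- by move=> y [] /g1d.
- by move=> y [] /h1d.
- by move=> y [_ /g2d].
- by move=> y [_ /h2d].
move=> a b c.
by exists (U1 `&` U2), (fun y => opg (g1 y) (h1 y) (g2 y) (h2 y)), (fun y => oph (g1 y) (h1 y) (g2 y) (h2 y)); split=> //; exact: openI.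
Qed.

Lemma holoM U f g : holomorphic_on U f -> holomorphic_on U g -> holomorphic_on U (fun y => f y * g y).
Proof. by move=> fd gd y Uy; apply: differentiableM; [exact: fd|exact: gd]. Qed.
Lemma holoD U f g : holomorphic_on U f -> holomorphic_on U g -> holomorphic_on U (fun y => f y + g y).
Proof. by move=> fd gd y Uy; apply: differentiableD; [exact: fd|exact: gd]. Qed.
Lemma holo_cst U (c : C) : holomorphic_on U (fun=> c).
Proof. by move=> y Uy; exact: differentiable_cst. Qed.

Lemma meroM E f g : meromorphic_on E f -> meromorphic_on E g -> meromorphic_on E (fun y => f y * g y).
Proof.
move=> fm gm.
apply: (mero_pair (op := *%R) (opg := fun a b c d => a * c) (oph := fun a b c d => b * d)) fm gm _.
move=> x Ex U g1 h1 g2 h2 Uo Ux g1d h1d g2d h2d r1 r2; split; [exact: holoM|exact: holoM|].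
apply: generic_imp2 r1 r2 => y _ [n1 ->] [n2 ->]; split; first by rewrite mulf_neq0.
by rewrite mulf_div.
Qed.

Lemma meroD E f g : meromorphic_on E f -> meromorphic_on E g -> meromorphic_on E (fun y => f y + g y).
Proof.
move=> fm gm.
apply: (mero_pair (op := +%R) (opg := fun a b c d => a * d + c * b) (oph := fun a b c d => b * d)) fm gm _.
move=> x Ex U g1 h1 g2 h2 Uo Ux g1d h1d g2d h2d r1 r2; split; [by apply: holoD; exact: holoM|exact: holoM|].
apply: generic_imp2 r1 r2 => y _ [n1 ->] [n2 ->]; split; first by rewrite mulf_neq0.
by rewrite addf_div.
Qed.

Lemma meroN E f : meromorphic_on E f -> meromorphic_on E (fun y => - f y).
Proof.
move=> fm; have := meroM (mero_holo (@holo_cst setT (-1))) fm.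
by rewrite (_ : (fun y => -1 * f y) = (fun y => - f y)) //; apply/funext => y; rewrite mulN1r.
Qed.

(** If g is generically 0, so is the quotient, as x / 0 = 0. Otherwise the dichotomy makes the
    numerator of g generically nonzero, so that it can serve as a denominator. *)
Lemma mero_div E f g : affine_set E -> meromorphic_on E f -> meromorphic_on E g ->
  meromorphic_on E (fun y => f y / g y).
Proof.
move=> Ea fm gm; have [g0|g0] := mero_generic Ea gm.
  apply: mero_eq (mero_holo (@holo_cst setT 0)).
  by apply: generic_imp g0 => y _ ->; rewrite invr0 mulr0.
apply: (mero_pair (op := fun a b => a / b) (opg := fun a b c d => a * d) (oph := fun a b c d => b * c)) fm gm _.
move=> x Ex U g1 h1 g2 h2 Uo Ux g1d h1d g2d h2d r1 r2; split; [exact: holoM|exact: holoM|].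
have := generic_restrict Uo g0.
apply: generic_imp2 (generic_and r1 r2) => y _ [[n1 ->] [n2 gE]] gy.
have n3 : g2 y != 0 by apply: contra_neq gy => e; rewrite gE e mul0r.
split; first by rewrite mulf_neq0.
by rewrite gE invf_div mulf_div.
Qed.

Lemma mero_translate E E' (v : W) f : (forall x, E' x <-> E (x + v)) ->
  meromorphic_on E f -> meromorphic_on E' (fun x => f (x + v)).
Proof.
move=> EE fm x /EE Ex; have [U [g [h [Uo Ux gd hd gh]]]] := fm _ Ex.
have tro (M : set W) (u : W) : open M -> open (fun x => M (x + u)).
  move=> Mo; apply: (@open_comp _ _ (fun x => x + u) M) => // z _.
  by apply: continuousD; [exact: cvg_id|exact: cvg_cst].
have trh k : holomorphic_on U k -> holomorphic_on (fun x => U (x + v)) (fun x => k (x + v)).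
  move=> kd y Uy; apply: (@differentiable_comp _ _ _ _ (fun x => x + v) k) => //; exact: kd.
exists (fun x => U (x + v)), (fun x => g (x + v)), (fun x => h (x + v)); split.
- exact: tro.
- by [].
- exact: trh.
- exact: trh.
- have EE' y : (E' `&` (fun x => U (x + v))) y <-> (E `&` U) (y + v).
    by split=> -[] /EE.
  exact: (generic_translate EE' gh).
Qed.

End Mero.

(** * Functions on the hyperplanes of constant (phi|x) *)

Section Hyper.
Variable R : realType.
Local Notation C := (Cplx R).
Local Notation V := (Vec R).
Implicit Types (E U N : set V) (P Q : V -> Prop) (f g h : V -> C) (x y a b v : V).

Lemma dotC a b : dot a b = dot b a.
Proof. by apply: eq_bigr => i _; rewrite mulrC. Qed.
Lemma dotDl a b v : dot (a + b) v = dot a v + dot b v.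
Proof. by rewrite ![dot _ v]dotC dotDr. Qed.
Lemma dotZl (c : C) a v : dot (c *: a) v = c * dot a v.
Proof. by rewrite ![dot _ v]dotC dotZr. Qed.
Lemma dotNr a v : dot a (- v) = - dot a v.
Proof. by rewrite -scaleN1r dotZr mulN1r. Qed.
Lemma dotNl a v : dot (- a) v = - dot a v.
Proof. by rewrite -scaleN1r dotZl mulN1r. Qed.
Lemma dotBr a u v : dot a (u - v) = dot a u - dot a v.
Proof. by rewrite dotDr dotNr. Qed.
Lemma dotBl a u v : dot (a - u) v = dot a v - dot u v.
Proof. by rewrite dotDl dotNl. Qed.
Lemma dotMnr a v n : dot a (v *+ n) = dot a v *+ n.
Proof. by rewrite -scaler_nat dotZr mulr_natl. Qed.
Lemma dotMnl a v n : dot (v *+ n) a = dot v a *+ n.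
Proof. by rewrite dotC dotMnr dotC. Qed.
Lemma dot_phiphi : dot (phi R) (phi R) = 2.
Proof. by rewrite /dot (eq_bigr (fun=> 4^-1)) ?sumr_const ?card_ord; [field|move=> i _; rewrite !mxE; field]. Qed.

Lemma dot_holo a : holomorphic_on setT (dot a).
Proof.
move=> x _; have -> : dot a = \sum_(i < 8) (fun v : V => a 0 i * v 0 i).
  by apply/funext => v; rewrite fct_sumE.
apply: differentiable_sum => i.
by apply: differentiableM; [exact: differentiable_cst|exact: differentiable_coord].
Qed.

Lemma hyper_affine (k : C) : affine_set (hyperplane k).
Proof.
move=> x y z xk yk; rewrite /hyperplane /= dotDr dotZr dotBr.
by rewrite (xk : dot _ _ = _) (yk : dot _ _ = _) subrr mulr0 addr0.
Qed.

Lemma hyper_point (k : C) : hyperplane k ((k / 2) *: phi R).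
Proof. by rewrite /hyperplane /= dotZr dot_phiphi divfK // pnatr_eq0. Qed.

Lemma generic_shift (k k' : C) v Q : k' + dot (phi R) v = k ->
  generically (hyperplane k) Q -> generically (hyperplane k') (fun x => Q (x + v)).
Proof.
move=> <-; apply: generic_translate => x; rewrite /hyperplane /= dotDr.
by split=> [->|/addIr].
Qed.

Lemma mero_shift (k k' : C) v f : k' + dot (phi R) v = k ->
  meromorphic_on (hyperplane k) f -> meromorphic_on (hyperplane k') (fun x => f (x + v)).
Proof.
move=> <-; apply: mero_translate => x; rewrite /hyperplane /= dotDr.
by split=> [->|/addIr].
Qed.

Lemma br_dot_holo (br : C -> C) a (s : C) : entire br -> holomorphic_on setT (fun x : V => br (dot a x + s)).
Proof.
move=> brd x _; apply: (@differentiable_comp _ _ _ _ (fun x : V => dot a x + s) br); last exact: brd.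
by apply: differentiableD; [exact: dot_holo|exact: differentiable_cst].
Qed.

(** As (phi|phi) = 2, the inequality says (a|d) <> 0 for the component d of a orthogonal to phi.
    Moving along d stays in the hyperplane and gives (a|x) every value, in particular one where the
    bracket is nonzero. *)
Lemma br_generic (br : C -> C) a (s k : C) : entire br -> (exists z, br z != 0) ->
  dot a a != dot (phi R) a ^+ 2 / 2 ->
  generically (hyperplane k) (fun x : V => br (dot a x + s) != 0).
Proof.
move=> brd [z0 bz0] aphi.
have gh := br_dot_holo a s brd.
have [[U [Uo EU U0]]|//] := mero_generic (@hyper_affine k) (mero_holo gh).
exfalso.
have /closureE/(_ setT openT I)[y0 [[Ey0 Uy0] _]] := EU _ (hyper_point k).
pose d := a - (dot (phi R) a / 2) *: phi R.
have d0 : dot (phi R) d = 0 by rewrite dotBr dotZr dot_phiphi divfK ?subrr // pnatr_eq0.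
have ad : dot a d != 0.
  rewrite dotBr dotZr (dotC a (phi R)) subr_eq0.
  by apply: contra_neq aphi => ->; rewrite expr2 mulrAC.
pose y := y0 + ((z0 - s - dot a y0) / dot a d) *: d.
have Ey : hyperplane k y by rewrite /hyperplane /= dotDr dotZr d0 mulr0 addr0.
have : br (dot a y + s) = 0.
  apply: (@holo_vanish R _ (hyperplane k) y0 (nm (y - y0) + 1) (fun x => br (dot a x + s)) U _ _ Uo _ y0).
  - exact: hyper_affine.
  - by move=> v _; exact: gh.
  - by move=> v Ev Uv _; exact: U0.
  - exact: Ey0.
  - exact: Uy0.
  - by rewrite subrr /nm normr0 /= ltr_wpDl // nm_ge0.
  - exact: Ey.
  - by rewrite ltrDl.
apply/eqP; rewrite /y dotDr dotZr divfK //.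
by rewrite (_ : dot a y0 + _ + s = z0) //; ring.
Qed.

Section Strips.
Variables (omega delta : C).
Hypothesis delta0 : delta != 0.
Local Notation H n := (hyperplane (omega + n%:~R * delta)).
Local Notation D := (D_omega omega delta).

(* D_omega is the disjoint union of the closed hyperplanes, each isolated by an open strip. *)
Definition strip (n : int) : set V :=
  [set x | cabs (dot (phi R) x - (omega + n%:~R * delta)) < cabs delta].

Lemma strip_open n : open (strip n).
Proof.
apply: (@open_comp _ _ (dot (phi R)) [set w | cabs (w - (omega + n%:~R * delta)) < cabs delta]).
  by move=> x _; apply: differentiable_continuous; exact: dot_holo.
rewrite openE => w wr; apply/nbhs_cabs.
exists (cabs delta - cabs (w - (omega + n%:~R * delta))); first by rewrite subr_gt0.
move=> v vw /=; rewrite (_ : _ - _ = (v - w) + (w - (omega + n%:~R * delta))); last by ring.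
by rewrite (le_lt_trans (cabsD _ _))// -ltrBrDr.
Qed.

Lemma cabs_int (n : int) : cabs (n%:~R) = `|n%:~R : R|.
Proof. by rewrite -cabs_rc /rc rmorph_int. Qed.

Lemma H_strip n : H n `&` strip n = H n.
Proof.
apply/seteqP; split=> [x []//|x Hx]; split=> //.
by rewrite /strip /= (Hx : dot _ _ = _) subrr cabs0 cabs_gt0.
Qed.

Lemma H_inj n m x : H n x -> H m x -> n = m.
Proof.
move=> nx mx; have : n%:~R * delta = m%:~R * delta.
  by apply: (addrI omega); rewrite -(nx : dot _ _ = _) -(mx : dot _ _ = _).
by move=> /(mulIf delta0)/intr_inj.
Qed.

Lemma D_strip n : D `&` strip n = H n.
Proof.
apply/seteqP; split=> [x [[m Hx]]|x Hx]; last by rewrite -H_strip in Hx; case: Hx => Hx sx; split=> //; exists n.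
rewrite /strip /= (Hx : dot _ _ = _) => h.
suff -> : n = m by [].
move: h; rewrite opprD addrACA subrr add0r -mulrBl cabsM -subr_lt0 -[X in _ - X]mul1r -mulrBl.
rewrite pmulr_llt0 ?cabs_gt0 // subr_lt0 -rmorphB /= cabs_int -intr_norm (_ : 1 = 1%:~R) // ltr_int.
move=> h; have : `|m - n| = 0 by apply/eqP; rewrite eq_le normr_ge0 andbT -ltzD1.
by move/normr0_eq0/eqP; rewrite subr_eq0 => /eqP.
Qed.

Lemma generic_D Q : (forall n, generically (H n) Q) <-> generically D Q.
Proof.
split=> [HQ|DQ n]; last by have := generic_restrict (@strip_open n) DQ; rewrite D_strip.
apply: generic_local => x [n Hx]; exists (strip n); split.
- exact: strip_open.
- by have : (H n `&` strip n) x by [rewrite H_strip]; case.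
- by rewrite D_strip.
Qed.

Lemma mero_D f : (forall n, meromorphic_on (H n) f) <-> meromorphic_on D f.
Proof.
split=> [Hf x [n Hx]|Df n x Hx].
  have [U [g [h [Uo Ux gd hd gh]]]] := Hf n x Hx.
  have sx : strip n x by have : (H n `&` strip n) x by [rewrite H_strip]; case.
  exists (U `&` strip n), g, h; split.
  - by apply: openI => //; exact: strip_open.
  - by [].
  - by move=> y [/gd].
  - by move=> y [/hd].
  - by rewrite (setIC U) setIA D_strip.
have [U [g [h [Uo Ux gd hd gh]]]] := Df x (ex_intro _ n Hx).
exists U, g, h; split=> //.
by have := generic_restrict (@strip_open n) gh; rewrite setIAC D_strip.
Qed.

End Strips.
End Hyper.

(** * The lattice and its frames *)

Section Lattice.
Variable R : realType.
Local Notation C := (Cplx R).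
Local Notation V := (Vec R).
Local Notation P := (@E8_lattice R).
Local Notation phi := (phi R).
Implicit Types (a b c u v : V).

Definition isint (z : C) := exists n : int, z = n%:~R.
Lemma isintD z w : isint z -> isint w -> isint (z + w).
Proof. by move=> [n ->] [m ->]; exists (n + m); rewrite rmorphD. Qed.
Lemma isintN z : isint z -> isint (- z).
Proof. by move=> [n ->]; exists (- n); rewrite rmorphN. Qed.
Lemma isintM z w : isint z -> isint w -> isint (z * w).
Proof. by move=> [n ->] [m ->]; exists (n * m); rewrite rmorphM. Qed.
Lemma isint_sum (F : 'I_8 -> C) : (forall i, isint (F i)) -> isint (\sum_(i < 8) F i).
Proof. by move=> H; elim/big_ind: _ => //; [exists 0|exact: isintD]. Qed.

Lemma Z8D a b : Z8 a -> Z8 b -> Z8 (a + b).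
Proof. by move=> ha hb i; rewrite mxE; exact: isintD. Qed.
Lemma Z8N a : Z8 a -> Z8 (- a).
Proof. by move=> ha i; rewrite mxE; exact: isintN. Qed.
Lemma Z8_2phi : Z8 (phi + phi).
Proof. by move=> i; exists 1; rewrite !mxE; field. Qed.
Lemma Z8_dot a b : Z8 a -> Z8 b -> isint (dot a b).
Proof. by move=> ha hb; apply: isint_sum => i; exact: isintM. Qed.

Lemma PN a : P a -> P (- a).
Proof.
move=> [[za|za] fa]; (split; last by rewrite dotNr; exact: isintN); [left|right].
  exact: Z8N.
rewrite (_ : - a - phi = - (a - phi) - (phi + phi)).
  by apply: Z8D; apply: Z8N => //; exact: Z8_2phi.
by rewrite opprB opprD addrA [phi - a]addrC addrK.
Qed.

Lemma PD a b : P a -> P b -> P (a + b).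
Proof.
move=> [za fa] [zb fb]; split; last by rewrite dotDr; exact: isintD.
case: za => za; case: zb => zb.
- by left; exact: Z8D.
- by right; rewrite -addrA; exact: Z8D.
- by right; rewrite addrAC; exact: Z8D.
- left; rewrite (_ : a + b = (a - phi) + (b - phi) + (phi + phi)).
    by apply: Z8D Z8_2phi; exact: Z8D.
  by rewrite addrACA !subrK.
Qed.

Lemma PB a b : P a -> P b -> P (a - b).
Proof. by move=> Pa Pb; apply: PD => //; exact: PN. Qed.

Lemma P_phi : P phi.
Proof.
split; last by exists 2; rewrite dot_phiphi.
by right; rewrite subrr => i; exists 0; rewrite mxE.
Qed.

Lemma P_phi_int a : P a -> isint (dot phi a). Proof. by case. Qed.

Lemma P_dot a b : P a -> P b -> isint (dot a b).
Proof.
have key u v : Z8 u -> isint (dot phi u) -> Z8 v \/ Z8 (v - phi) -> isint (dot u v).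
  move=> zu fu [zv|zv]; first exact: Z8_dot.
  rewrite -(subrK phi v) dotDr; apply: isintD; first exact: Z8_dot.
  by rewrite dotC.
move=> [za fa] [zb fb]; case: za => za; first exact: key.
rewrite -(subrK phi a) dotDl; apply: isintD => //.
apply: key => //; rewrite dotBr dot_phiphi; apply: isintD => //.
by exists (- 2).
Qed.

Definition realv a := forall i, a 0 i \is Num.real.
Lemma realvD a b : realv a -> realv b -> realv (a + b).
Proof. by move=> ha hb i; rewrite mxE rpredD. Qed.
Lemma realvZ (x : C) a : x \is Num.real -> realv a -> realv (x *: a).
Proof. by move=> hx ha i; rewrite mxE rpredM. Qed.
Lemma realvN a : realv a -> realv (- a).
Proof. by move=> ha i; rewrite mxE rpredN. Qed.
Lemma isint_real z : isint z -> z \is Num.real.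
Proof. by move=> [n ->]; by rewrite realz. Qed.
Lemma realv_phi : realv phi.
Proof. by move=> i; rewrite mxE rpredV realn. Qed.
Lemma P_real a : P a -> realv a.
Proof.
move=> [[za|za] _] i; first exact: isint_real.
by rewrite -(subrK phi a) mxE rpredD ?realv_phi //; exact: isint_real.
Qed.
Lemma half_real a : P (a *+ 2) -> realv a.
Proof.
move=> /P_real h; rewrite (_ : a = 2^-1 *: (a *+ 2)).
  by apply: realvZ => //; rewrite rpredV realn.
by rewrite -(scaler_nat 2 a) scalerA mulVf ?scale1r // pnatr_eq0.
Qed.
Lemma dot_ge0 a : realv a -> 0 <= dot a a.
Proof. by move=> ha; apply: sumr_ge0 => i _; rewrite -expr2 real_exprn_even_ge0. Qed.
Lemma dot_eq0 a : realv a -> dot a a = 0 -> a = 0.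
Proof.
move=> ha /eqP; rewrite psumr_eq0; last by move=> i _; rewrite -expr2 real_exprn_even_ge0.
move=> /allP h; apply/rowP => i; rewrite mxE; apply/eqP.
by have := h i (mem_index_enum i); rewrite -expr2 expf_eq0.
Qed.

(** Congruence modulo the lattice. Since 2 a lies in P, it also gives a + b in P, so a frame amounts
    to three orthogonal, mutually congruent [half] vectors. *)
Definition compat a b := P (a - b).

Definition half a := P (a *+ 2) /\ dot a a = 1.

Lemma compat_sum a b : half a -> compat a b -> P (a + b).
Proof.
move=> [ha _] h; rewrite (_ : a + b = a *+ 2 - (a - b)); first exact: PB.
by rewrite mulr2n opprB addrA addrAC addrK.
Qed.

Lemma compat_sym a b : compat a b -> compat b a.
Proof. by move=> /PN; rewrite opprB. Qed.

Lemma compat_trans a b c : compat a b -> compat b c -> compat a c.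
Proof. by move=> h1 h2; have := PD h1 h2; rewrite addrA subrK. Qed.

Lemma compatN a b : half b -> compat a b -> compat a (- b).
Proof. by move=> hb h; rewrite /compat opprK addrC; apply: compat_sum => //; exact: compat_sym. Qed.

Lemma halfN a : half a -> half (- a).
Proof. by move=> [h1 h2]; split; [rewrite mulNrn; exact: PN|rewrite dotNl dotNr opprK]. Qed.

Lemma C3P a b c : C3_frame a b c <->
  [/\ half a, half b & half c] /\ [/\ dot a b = 0, dot a c = 0 & dot b c = 0] /\
  (compat a b /\ compat a c).
Proof.
split=> [[[n1 n2 n3] [p1 p2 p3] _ [s1 s2 s3] [t1 t2 t3]]|].
  by split.
move=> [[h1 h2 h3] [[p1 p2 p3] [c1 c2]]].
have c3 : compat b c by apply: compat_trans c2; exact: compat_sym.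
case: (h1) (h2) (h3) => t1 n1 [t2 n2] [t3 n3].
by split=> //; split=> //; exact: compat_sum.
Qed.

(* c makes dot a b an integer: it is dot (a + c) (b + c) - 1. *)
Lemma compat_orth a b c : half a -> half b -> half c -> compat c a -> compat c b ->
  dot c a = 0 -> dot c b = 0 -> [\/ b = a, b = - a | dot a b = 0].
Proof.
move=> ha hb hc ca cb oa ob.
have [n Hn] : isint (dot a b).
  have := P_dot (compat_sum hc ca) (compat_sum hc cb).
  rewrite dotDl !dotDr ob (dotC a c) oa (hc.2) addr0 add0r => h.
  by have := isintD h (isintN (ex_intro _ 1 erefl : isint 1)); rewrite addrAC subrr add0r.
have ra := half_real ha.1; have rb := half_real hb.1.
have h1 := dot_ge0 (realvD ra rb); have h2 := dot_ge0 (realvD ra (realvN rb)).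
have e1 : dot (a + b) (a + b) = (2 + 2 * n)%:~R.
  by rewrite dotDl !dotDr (dotC b a) Hn ha.2 hb.2 intrD intrM; ring.
have e2 : dot (a - b) (a - b) = (2 - 2 * n)%:~R.
  by rewrite dotBl !dotBr (dotC b a) Hn ha.2 hb.2 intrB intrM; ring.
rewrite e1 (ler_int _ 0) in h1; rewrite e2 (ler_int _ 0) in h2.
have [n0|[n1|n1]] : n = 0 \/ n = 1 \/ n = -1 by lia.
- by constructor 3; rewrite Hn n0.
- constructor 1; apply/esym/eqP; rewrite -subr_eq0; apply/eqP/dot_eq0.
    exact: realvD ra (realvN rb).
  by rewrite e2 n1.
- constructor 2; apply/eqP; rewrite -addr_eq0 addrC; apply/eqP/dot_eq0.
    exact: realvD.
  by rewrite e1 n1.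
Qed.

(* Bessel's inequality for phi, whose square norm is 2. *)
Lemma frame_types a b c : C3_frame a b c ->
  [/\ dot phi a ^+ 2 = 4^-1, dot phi b ^+ 2 = 4^-1 & dot phi c ^+ 2 = 4^-1] \/
  exists k l m : int, [/\ dot phi a = k%:~R, dot phi b = l%:~R, dot phi c = m%:~R &
     k ^+ 2 + l ^+ 2 + m ^+ 2 <= 2].
Proof.
move=> /C3P[[ha hb hc] [[pab pac pbc] [cab cac]]].
have [n Hn] := P_phi_int ha.1; have [m Hm] := P_phi_int hb.1; have [k Hk] := P_phi_int hc.1.
have [p Hp] := P_phi_int cab; have [q Hq] := P_phi_int cac.
rewrite dotMnr in Hn; rewrite dotMnr in Hm; rewrite dotMnr in Hk.
rewrite dotBr in Hp; rewrite dotBr in Hq.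
have e (x : C) (j : int) : x *+ 2 = j%:~R -> x = j%:~R / 2.
  by move=> <-; rewrite -(mulr_natr x 2) mulfK // pnatr_eq0.
have {}Hn := e _ _ Hn; have {}Hm := e _ _ Hm; have {}Hk := e _ _ Hk.
have np : n - m = 2 * p.
  by apply/eqP; rewrite -(eqr_int C) intrB intrM -Hp Hn Hm; apply/eqP; field.
have nq : n - k = 2 * q.
  by apply/eqP; rewrite -(eqr_int C) intrB intrM -Hq Hn Hk; apply/eqP; field.
have Rn (j : int) : (j%:~R / 2 : C) \is Num.real by rewrite rpredM ?rpredV ?realn ?realz.
pose w := phi - ((n%:~R / 2) *: a + (m%:~R / 2) *: b + (k%:~R / 2) *: c).
have rw : realv w.
  by apply: realvD; [exact: realv_phi|apply: realvN; do 2? apply: realvD; apply: realvZ => //; exact: half_real (_ : half _).1].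
have := dot_ge0 rw.
have -> : dot w w = (8 - n ^+ 2 - m ^+ 2 - k ^+ 2)%:~R / 4.
  rewrite /w dotBl !dotBr !(dotDl, dotDr, dotZl, dotZr) (dotC b a) (dotC c a) (dotC c b) pab pac pbc.
  rewrite ha.2 hb.2 hc.2 (dotC a phi) (dotC b phi) (dotC c phi) Hn Hm Hk dot_phiphi.
  by rewrite !expr2 !intrB !intrM; field.
rewrite pmulr_lge0 ?invr_gt0 ?ltr0n // (ler_int _ 0) => h8.
(* n, m, k have the same parity and squares with sum at most 8. If they are even, halving gives
   integers; if odd, each square is at least 1, hence at most 6, hence 1. *)
have [[r Hr]|[r Hr]] : (exists r, n = 2 * r) \/ (exists r, n = 2 * r + 1).
  by have [] : ((n %% 2)%Z = 0 \/ (n %% 2)%Z = 1) by [lia]; move=> E; [left|right]; exists (n %/ 2)%Z; lia.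
  right; exists r, (r - p), (r - q); split.
  - by rewrite Hn Hr intrM mulrC mulKf ?pnatr_eq0.
  - by rewrite Hm (_ : m = 2 * (r - p)) ?intrM ?[2 * _]mulrC ?mulfK ?pnatr_eq0 //; lia.
  - by rewrite Hk (_ : k = 2 * (r - q)) ?intrM ?[2 * _]mulrC ?mulfK ?pnatr_eq0 //; lia.
  - have E : 8 - n ^+ 2 - m ^+ 2 - k ^+ 2 = 4 * (2 - (r ^+ 2 + (r - p) ^+ 2 + (r - q) ^+ 2)).
      have -> : m = 2 * (r - p) by lia.
      have -> : k = 2 * (r - q) by lia.
      by rewrite Hr; ring.
    by move: h8; rewrite E; move: (_ + _ + _) => X; lia.
have odd1 (j s : int) : j = 2 * s + 1 -> 1 <= j ^+ 2.
  by move=> ->; rewrite expr2; case: (lerP 0 s) => s0; nia.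
have odd2 (j s : int) : j = 2 * s + 1 -> j ^+ 2 <= 6 -> j ^+ 2 = 1.
  move=> js; rewrite expr2 => j6.
  have [?|[?|[?|?]]] : (2 < j \/ j < - 2 \/ j = 1 \/ j = - 1) by lia.
  - nia.
  - nia.
  - by lia.
  - by lia.
left; have o_n := odd1 n r Hr.
have o_m : 1 <= m ^+ 2 by apply: (odd1 _ (r - p)); lia.
have o_k : 1 <= k ^+ 2 by apply: (odd1 _ (r - q)); lia.
have n1 : n ^+ 2 = 1 by apply: (odd2 _ r) => //; move: h8 o_n o_m o_k; move: (n ^+ 2) (m ^+ 2) (k ^+ 2) => A B D; lia.
have m1 : m ^+ 2 = 1 by apply: (odd2 _ (r - p)); [lia|move: h8 o_n o_m o_k; move: (n ^+ 2) (m ^+ 2) (k ^+ 2) => A B D; lia].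
have k1 : k ^+ 2 = 1 by apply: (odd2 _ (r - q)); [lia|move: h8 o_n o_m o_k; move: (n ^+ 2) (m ^+ 2) (k ^+ 2) => A B D; lia].
have sq (j : int) : j ^+ 2 = 1 -> (j%:~R / 2 : C) ^+ 2 = 4^-1.
  by move=> j1; rewrite expr_div_n -rmorphXn /= j1; field.
by rewrite Hn Hm Hk !sq.
Qed.

(** The square norm of a + b - phi is 2 - 4 + 2 = 0. *)
Lemma frame_sum_phi a b c : C3_frame a b c -> dot phi a = 1 -> dot phi b = 1 -> a + b = phi.
Proof.
move=> /C3P[[ha hb hc] [[pab pac pbc] _]] fa fb; apply/eqP; rewrite -subr_eq0; apply/eqP/dot_eq0.
  apply: realvD; last exact: realvN realv_phi.
  by apply: realvD; [exact: half_real ha.1|exact: half_real hb.1].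
rewrite dotBl !dotBr !dotDl !dotDr (dotC b a) pab ha.2 hb.2 dot_phiphi (dotC a) (dotC b) fa fb.
by ring.
Qed.

End Lattice.

(* Enumeration of the short vectors *)
Delimit Scope Z_scope with ZZ.

Fixpoint zdot (k l : seq Z) : Z :=
  match k, l with x :: k', y :: l' => Z.add (Z.mul x y) (zdot k' l') | _, _ => Z0 end.
Fixpoint zsum (k : seq Z) : Z := match k with x :: k' => Z.add x (zsum k') | _ => Z0 end.
Fixpoint zsub (k l : seq Z) : seq Z :=
  match k, l with x :: k', y :: l' => Z.sub x y :: zsub k' l' | _, _ => [::] end.

Fixpoint zgen (vals : seq Z) (n : nat) (s : Z) : seq (seq Z) :=
  match n with
  | O => if Z.eqb s Z0 then [:: [::]] else [::]
  | S m => flatten (map (fun x => if Z.leb (Z.mul x x) s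
                      then map (cons x) (zgen vals m (Z.sub s (Z.mul x x))) else [::]) vals)
  end.

(* A list k stands for the vector E k with coordinates k_i / 4.  The vectors a with 2 a in P and
   (a|a) = 1 have all k_i even or all k_i odd; zhalf t lists those with (phi|a) = t / 8. *)
Definition zhalf (t : Z) : seq (seq Z) :=
  seq.filter (fun k => Z.eqb (zsum k) t)
   (zgen [:: (-4)%ZZ; (-2)%ZZ; 0%ZZ; 2%ZZ; 4%ZZ] 8 16%ZZ ++ zgen [:: (-3)%ZZ; (-1)%ZZ; 1%ZZ; 3%ZZ] 8 16%ZZ).

(** Divisibility is read off the binary digits, so that the checks are evaluated without any
    division. *)
Definition zdiv4 (x : Z) : bool :=
  match x with Z0 | Zpos (xO (xO _)) | Zneg (xO (xO _)) => true | _ => false end.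
Definition zdiv8 (x : Z) : bool :=
  match x with Z0 | Zpos (xO (xO (xO _))) | Zneg (xO (xO (xO _))) => true | _ => false end.
Definition zmod2 (x : Z) : bool :=
  match x with Zpos (xO (xI _)) | Zneg (xO (xI _)) | Zpos (xO xH) | Zneg (xO xH) => true | _ => false end.
Definition zlat (k : seq Z) : bool :=
  (if all zdiv4 k then true else all zmod2 k) && zdiv8 (zsum k).
Definition zcompat k l := zlat (zsub k l).
Definition zorth k l := Z.eqb (zdot k l) 0.

(* The vectors 2 a - phi, for the unit vectors a with (phi|a) = 1. *)
Definition zroots : seq (seq Z) := map (fun k => zsub (map (Z.mul 2) k) (nseq 8 2%ZZ)) (zhalf 8).

(** With coordinates scaled by 4, the value 16 stands for the product 1. For roots a, b with (a|b) =
    (v|a) = (v|b) = 1 the unit vectors v, v - a, v - b are orthonormal: this is a move between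
    roots. *)
Definition zstep (h : seq (seq Z)) (a b : seq Z) : bool :=
  Z.eqb (zdot a b) 16 && has (fun v => Z.eqb (zdot v a) 16 && Z.eqb (zdot v b) 16) h.
Definition zgrow (h r L : seq (seq Z)) := seq.filter (fun b => has (fun a => zstep h a b) L) r.
Definition zroot0 : seq Z := [:: 4; -4; 0; 0; 0; 0; 0; 0]%ZZ.
Section Checks.
Variables (h0 h4 h8 r : seq (seq Z)).
Implicit Types (k l g : seq Z).

(** In the order of the enumeration the first three candidates already have pairwise products 1, so
    no search over triples is made. *)
Definition triple_ok (L : seq (seq Z)) : bool :=
  match L with
  | a :: b :: c :: _ => [&& Z.eqb (zdot a b) 16, Z.eqb (zdot a c) 16 & Z.eqb (zdot b c) 16]
  | _ => false
  end.

Definition check_triple : bool :=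
  all (fun k => triple_ok (seq.filter (fun g => Z.eqb (zdot k g) 16) r)) h4.
Definition check_quarter : bool := all (fun k => has (fun b => Z.eqb (zdot b k) 12) h4) h0.
Definition check_unit : bool := all (fun k => has (fun b => zorth b k && zcompat k b) h8) h0.
Definition check_null : bool := all (fun k => has (fun g => Z.eqb (zdot k g) 16) r) h0.
(** Three rounds are enough to reach every root orthogonal to phi; these roots form a system of type
    E_7. *)
Definition check_connected (g0 : seq Z) : bool :=
  let L1 := zgrow h4 r [:: g0] in
  let L2 := zgrow h4 r L1 in
  let L3 := zgrow h4 r L2 in
  all (fun b => b \in g0 :: L1 ++ L2 ++ L3) r.

Lemma check_tripleP k : check_triple -> k \in h4 -> exists g1 g2 g3,
  [/\ g1 \in r, g2 \in r & g3 \in r] /\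
  [/\ zdot k g1 = 16%ZZ, zdot k g2 = 16%ZZ & zdot k g3 = 16%ZZ] /\
  [/\ zdot g1 g2 = 16%ZZ, zdot g1 g3 = 16%ZZ & zdot g2 g3 = 16%ZZ].
Proof.
move=> /allP H /H; case e : (seq.filter _ _) => [|g1 [|g2 [|g3 s]]] //.
move=> /and3P[/Z.eqb_spec e12 /Z.eqb_spec e13 /Z.eqb_spec e23].
have key g : g \in [:: g1, g2, g3 & s] -> g \in r /\ zdot k g = 16%ZZ.
  by rewrite -e mem_filter => /andP[/Z.eqb_spec].
have [r1 k1] := key g1 (ltac:(by rewrite !inE eqxx)).
have [r2 k2] := key g2 (ltac:(by rewrite !inE eqxx orbT)).
have [r3 k3] := key g3 (ltac:(by rewrite !inE eqxx !orbT)).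
by exists g1, g2, g3.
Qed.

Lemma check_quarterP k : check_quarter -> k \in h0 -> exists2 l, l \in h4 & zdot l k = 12%ZZ.
Proof. by move=> /allP H /H/hasP[l lz /Z.eqb_spec kl]; exists l. Qed.

Lemma check_unitP k : check_unit -> k \in h0 ->
  exists2 l, l \in h8 & zdot l k = 0%ZZ /\ zlat (zsub k l).
Proof. by move=> /allP H /H/hasP[l lz /andP[/Z.eqb_spec kl ckl]]; exists l. Qed.

Lemma check_nullP k : check_null -> k \in h0 -> exists2 g, g \in r & zdot k g = 16%ZZ.
Proof. by move=> /allP H /H/hasP[l lz /Z.eqb_spec kl]; exists l. Qed.

Lemma check_connectedP g0 (T : seq Z -> Prop) : check_connected g0 -> g0 \in r -> T g0 ->
  (forall g1 g2 l, g1 \in r -> g2 \in r -> l \in h4 -> zdot g1 g2 = 16%ZZ ->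
     zdot l g1 = 16%ZZ -> zdot l g2 = 16%ZZ -> T g1 -> T g2) ->
  forall g, g \in r -> T g.
Proof.
move=> /allP ck r0 T0 step g gr.
have grow L : (forall h, h \in L -> h \in r /\ T h) ->
    forall h, h \in zgrow h4 r L -> h \in r /\ T h.
  move=> HL h; rewrite mem_filter => /andP[/hasP[h' /HL[z' T'] st] hz]; split=> //.
  move: st => /andP[/Z.eqb_spec e12 /hasP[l lz /andP[/Z.eqb_spec l1 /Z.eqb_spec l2]]].
  exact: step z' hz lz e12 l1 l2 T'.
have L0 h : h \in [:: g0] -> h \in r /\ T h by rewrite inE => /eqP ->.
have L1 := grow _ L0; have L2 := grow _ L1; have L3 := grow _ L2.
have := ck g gr; rewrite inE !mem_cat.
by move=> /or4P[/eqP ->|/L1[]|/L2[]|/L3[]].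
Qed.
End Checks.

Lemma check_triple_true : check_triple (zhalf 4) zroots. Proof. by lazy. Qed.
Lemma check_quarter_true : check_quarter (zhalf 0) (zhalf 4). Proof. by lazy. Qed.
Lemma check_unit_true : check_unit (zhalf 0) (zhalf 8). Proof. by lazy. Qed.
Lemma check_null_true : check_null (zhalf 0) zroots. Proof. by lazy. Qed.
Lemma check_connected_true : check_connected (zhalf 4) zroots zroot0. Proof. by lazy. Qed.
Lemma zroot0_in : zroot0 \in zroots. Proof. by lazy. Qed.

(* Wrappers for membership in the two lists: with a bare membership in the context, [done]
   would evaluate the lists. *)
Variant in_half (t : Z) (k : seq Z) : Prop := InHalf of k \in zhalf t.
Definition zroot_of (k : seq Z) : seq Z := zsub (map (Z.mul 2) k) (nseq 8 2%ZZ).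
Lemma zroot_of_in k : k \in zhalf 8 -> zroot_of k \in zroots.
Proof. exact: (map_f zroot_of). Qed.
Variant in_roots (g : seq Z) : Prop := InRoots of g \in zroots.

(** * From integer lists to vectors *)

Section Reflect.
Variable R : realType.
Local Notation C := (Cplx R).
Local Notation V := (Vec R).
Local Notation P := (@E8_lattice R).
Local Notation phi := (phi R).
Implicit Types (a b c u v : V) (k l g : seq Z).

Definition zc (x : Z) : C := (int_of_Z x)%:~R.
Lemma zcD x y : zc (x + y)%ZZ = zc x + zc y.
Proof. by rewrite /zc (rmorphD int_of_Z) rmorphD. Qed.
Lemma zcM x y : zc (x * y)%ZZ = zc x * zc y.
Proof. by rewrite /zc (rmorphM int_of_Z) rmorphM. Qed.
Lemma zcB x y : zc (x - y)%ZZ = zc x - zc y.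
Proof. by rewrite /zc (rmorphB int_of_Z) rmorphB. Qed.
Lemma zc_inj x y : zc x = zc y -> x = y.
Proof. by move=> /intr_inj/(can_inj int_of_ZK). Qed.
Lemma zc1 : zc 1 = 1. Proof. by []. Qed.
Lemma zc2 : zc 2 = 2. Proof. by []. Qed.
Lemma zc4 : zc 4 = 4. Proof. by []. Qed.
Lemma zc8 : zc 8 = 8. Proof. by []. Qed.
Lemma zc12 : zc 12 = 12. Proof. by []. Qed.
Lemma zc16 : zc 16 = 16. Proof. by []. Qed.
Lemma zcZ n : zc (Z_of_int n) = n%:~R. Proof. by rewrite /zc Z_of_intK. Qed.
Definition zcE := (zcD, zcM, zcB, zc1, zc2, zc4, zc8, zc12, zc16, zcZ).
Lemma zc_int x : isint (zc x). Proof. by exists (int_of_Z x). Qed.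

Definition E k : V := \row_i (zc (nth Z0 k i) / 4).

Lemma sum_zdot n k l : size k = n -> size l = n ->
  \sum_(i < n) zc (nth Z0 k i) * zc (nth Z0 l i) = zc (zdot k l).
Proof.
elim: n k l => [|n IH] [|x k] [|y l] //=; first by rewrite big_ord0.
by move=> [sk] [sl]; rewrite big_ord_recl /= zcD zcM -(IH k l).
Qed.

Lemma sum_zsum n k : size k = n -> \sum_(i < n) zc (nth Z0 k i) = zc (zsum k).
Proof.
elim: n k => [|n IH] [|x k] //=; first by rewrite big_ord0.
by move=> [sk]; rewrite big_ord_recl /= zcD -(IH k).
Qed.

Lemma dotE k l : size k = 8%N -> size l = 8%N -> dot (E k) (E l) = zc (zdot k l) / 16.
Proof.
move=> sk sl; rewrite -(sum_zdot sk sl) mulr_suml; apply: eq_bigr => i _.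
by rewrite !mxE; field.
Qed.

Lemma dotphiE k : size k = 8%N -> dot phi (E k) = zc (zsum k) / 8.
Proof.
move=> sk; rewrite -(sum_zsum sk) mulr_suml; apply: eq_bigr => i _.
by rewrite !mxE; field.
Qed.

Lemma size_zsub k l n : size k = n -> size l = n -> size (zsub k l) = n.
Proof. by elim: n k l => [|n IH] [|x k] [|y l] //= [sk] [sl]; rewrite (IH k l). Qed.

Lemma nth_zsub k l n i : size k = n -> size l = n ->
  nth Z0 (zsub k l) i = (nth Z0 k i - nth Z0 l i)%ZZ.
Proof.
elim: n k l i => [|n IH] [|x k] [|y l] //=; first by move=> i; rewrite !nth_nil.
by move=> [|i] [sk] [sl] //=; exact: IH.
Qed.

Lemma EB k l : size k = 8%N -> size l = 8%N -> E (zsub k l) = E k - E l.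
Proof. by move=> sk sl; apply/rowP => i; rewrite !mxE (nth_zsub _ sk sl) zcB mulrBl. Qed.

Lemma zgen_sound vals n s k : k \in zgen vals n s ->
  [/\ size k = n, all (fun x => x \in vals) k & zdot k k = s].
Proof.
elim: n s k => [|n IH] s k /=.
  by case: Z.eqb_spec => // ->; rewrite inE => /eqP ->.
move=> /flattenP[L /mapP[x xv ->]]; case: ifP => // _ /mapP[k' /IH[sk vk dk] ->].
by split=> /=; [rewrite sk|rewrite xv|rewrite dk; lia].
Qed.

Lemma zdot_ge0 k : (0 <= zdot k k)%ZZ.
Proof. by elim: k => //= x k IH; nia. Qed.

Lemma zgen_complete vals n s k : size k = n -> all (fun x => x \in vals) k -> zdot k k = s ->
  k \in zgen vals n s.
Proof.
elim: n s k => [|n IH] s [|x k] //=; first by move=> _ _ <-.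
move=> [sk] /andP[xv vk] dk; apply/flattenP.
exists (map (cons x) (zgen vals n (s - x * x)%ZZ)); last first.
  by apply: map_f; apply: IH => //; lia.
apply/mapP; exists x => //; case: Z.leb_spec => //.
by have := @zdot_ge0 k; lia.
Qed.

Lemma half_E a : half a -> forall t, dot phi a = zc t / 8 -> exists2 k, in_half t k & a = E k.
Proof.
move=> [[za _] na] t fa.
have e1 (p : int -> Z) : (forall i, exists n : int, a 0 i = zc (p n) / 4) ->
    exists2 k, size k = 8%N & a = E k /\ forall x, x \in k -> exists n, x = p n.
  move=> /choice[f Hf]; exists (mkseq (fun i => p (f (inord i))) 8); first by rewrite size_mkseq.
  split; last by move=> x /mapP[i _ ->]; exists (f (inord i)).
  by apply/rowP => i; rewrite mxE nth_mkseq // inord_val.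
have key k : size k = 8%N -> a = E k -> zdot k k = 16%ZZ /\ zsum k = t.
  move=> sk aE; split; apply: zc_inj.
    have := na; rewrite aE dotE // => h.
    have n16 : (16 : C) != 0 by rewrite pnatr_eq0.
    by apply: (divIf n16); rewrite h /zc /= divff.
  have n8 : (8 : C) != 0 by rewrite pnatr_eq0.
  by apply: (divIf n8); rewrite -dotphiE // -aE.
have bound x k : x \in k -> (x * x <= zdot k k)%ZZ.
  elim: k => // y k IH; rewrite inE => /orP[/eqP ->|/IH] /=; have := @zdot_ge0 k; nia.
case: za => za.
  (* If 2 a has integer coordinates n, then 4 a has coordinates 2 n; in the coset of phi they are 2
     n + 1. *)
  have [|k sk [aE Hk]] := e1 (fun n => 2 * Z_of_int n)%ZZ.
    move=> i; have [n Hn] := za i; exists n.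
    move: Hn; rewrite mulr2n mxE => Hn.
    by rewrite !zcE -Hn; field.
  have [dk tk] := key k sk aE; exists k; last exact: aE.
  split; rewrite mem_filter; apply/andP; split; first exact/Z.eqb_spec.
  rewrite mem_cat; apply/orP; left.
  apply: zgen_complete => //; apply/allP => x xk.
  have := bound x k xk; have [n ->] := Hk x xk; rewrite dk.
  move: (Z_of_int n) => m hm.
  have : (m = -2 \/ m = -1 \/ m = 0 \/ m = 1 \/ m = 2)%ZZ by nia.
  by move=> [->|[->|[->|[->|->]]]].
have [|k sk [aE Hk]] := e1 (fun n => 2 * Z_of_int n + 1)%ZZ.
  move=> i; have [n Hn] := za i; exists n.
  move: Hn; rewrite mulr2n !mxE => Hn.
  by rewrite !zcE -Hn; field.
have [dk tk] := key k sk aE; exists k; last exact: aE.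
split; rewrite mem_filter; apply/andP; split; first exact/Z.eqb_spec.
rewrite mem_cat; apply/orP; right.
apply: zgen_complete => //; apply/allP => x xk.
have := bound x k xk; have [n ->] := Hk x xk; rewrite dk.
move: (Z_of_int n) => m hm.
have : (m = -2 \/ m = -1 \/ m = 0 \/ m = 1)%ZZ by nia.
by move=> [->|[->|[->|->]]].
Qed.

Lemma zhalf_sound t k : in_half t k -> isint (zc t / 4) ->
  [/\ size k = 8%N, half (E k) & dot phi (E k) = zc t / 8].
Proof.
case; rewrite mem_filter => /andP[/Z.eqb_spec tk kz] ti.
have [sk dk zk] : [/\ size k = 8%N, zdot k k = 16%ZZ & Z8 (E k *+ 2) \/ Z8 (E k *+ 2 - phi)].
  move: kz; rewrite mem_cat => /orP[] /zgen_sound[sk vk dk]; split; [exact: sk|exact: dk|left=> i|exact: sk|exact: dk|right=> i].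
    have : nth Z0 k i \in [:: -4; -2; 0; 2; 4]%ZZ by apply: (allP vk); rewrite mem_nth // sk.
    rewrite !inE => h; rewrite mulr2n !mxE.
    have [m ->] : exists m, nth Z0 k i = (2 * m)%ZZ.
      by case/or4P: h => [/eqP->|/eqP->|/eqP->|/orP[]/eqP->]; [exists (-2)%ZZ|exists (-1)%ZZ|exists 0%ZZ|exists 1%ZZ|exists 2%ZZ].
    have [j Hj] := zc_int m; exists j.
    by rewrite -Hj !zcE; field.
  have : nth Z0 k i \in [:: -3; -1; 1; 3]%ZZ by apply: (allP vk); rewrite mem_nth // sk.
  rewrite !inE => h; rewrite mulr2n !mxE.
  have [m ->] : exists m, nth Z0 k i = (2 * m + 1)%ZZ.
    by case/or4P: h => /eqP->; [exists (-2)%ZZ|exists (-1)%ZZ|exists 0%ZZ|exists 1%ZZ].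
  have [j Hj] := zc_int m; exists j.
  by rewrite -Hj !zcE; field.
move: kz => _.
have fE : dot phi (E k) = zc t / 8 by rewrite dotphiE // tk.
split=> //; split; last by rewrite dotE // dk zc16 divff // pnatr_eq0.
split=> //; rewrite dotMnr fE.
by case: ti => j Hj; exists j; rewrite -Hj mulr2n; field.
Qed.

Lemma zdiv4P x : zdiv4 x -> exists y, x = (4 * y)%ZZ.
Proof.
case: x => [|[p|[p|p|]|]|[p|[p|p|]|]] // _.
- by exists 0%ZZ.
- by exists (Zpos p).
- by exists (Zneg p).
Qed.

Lemma zdiv8P x : zdiv8 x -> exists y, x = (8 * y)%ZZ.
Proof.
case: x => [|[p|[p|[p|p|]|]|]|[p|[p|[p|p|]|]|]] // _.
- by exists 0%ZZ.
- by exists (Zpos p).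
- by exists (Zneg p).
Qed.

Lemma zmod2P x : zmod2 x -> exists y, x = (4 * y + 2)%ZZ.
Proof.
case: x => [|[p|[p|p|]|]|[p|[p|p|]|]] // _.
- by exists (Zpos p).
- by exists 0%ZZ.
- by exists (Zneg p - 1)%ZZ; rewrite -[LHS]/(4 * Zneg p - 2)%ZZ; lia.
- by exists (-1)%ZZ.
Qed.

Lemma zlat_sound k : size k = 8%N -> zlat k -> P (E k).
Proof.
move=> sk /andP[zk sk8]; split; last first.
  have [y Hy] := zdiv8P sk8; rewrite dotphiE // Hy.
  by have [j Hj] := zc_int y; exists j; rewrite -Hj !zcE; field.
have kI (i : 'I_8) : nth Z0 k i \in k by rewrite mem_nth // sk.
move: zk; case: ifP => [/allP h _|_ /allP h]; [left|right] => i; rewrite !mxE.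
  have [y ->] := zdiv4P (h _ (kI i)); have [j Hj] := zc_int y.
  by exists j; rewrite -Hj !zcE; field.
have [y ->] := zmod2P (h _ (kI i)); have [j Hj] := zc_int y.
by exists j; rewrite -Hj !zcE; field.
Qed.

Lemma zroots_sound g : in_roots g -> [/\ size g = 8%N, P (E g), dot (E g) (E g) = 2 & dot phi (E g) = 0].
Proof.
move=> [/mapP[k /InHalf kz ->]].
have [sk [h1 h2] fk] := zhalf_sound kz (ex_intro _ 2 (ltac:(by rewrite zc8; field) : zc 8 / 4 = 2%:~R)).
have fk1 : dot phi (E k) = 1 by rewrite fk zc8 divff // pnatr_eq0.
have s2 : size (map (Z.mul 2) k) = 8%N by rewrite size_map.
have s3 : size (nseq 8 2%ZZ) = 8%N by [].
have EE : E (zsub (map (Z.mul 2) k) (nseq 8 2%ZZ)) = 2 *: E k - phi.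
  rewrite EB //; congr (_ - _); apply/rowP => i.
    by rewrite !mxE (nth_map Z0) ?sk // zcM zc2 mulrA.
  by rewrite !mxE nth_nseq ltn_ord zc2; field.
split; first exact: size_zsub.
- by rewrite EE scaler_nat; exact: PB h1 (@P_phi R).
- by rewrite EE dotBl !dotBr !dotZl !dotZr (dotC (E k) phi) h2 fk1 dot_phiphi; ring.
- by rewrite EE dotBr dotZr fk1 dot_phiphi; ring.
Qed.

Lemma zhalf4 k : in_half 4 k -> [/\ size k = 8%N, half (E k) & dot phi (E k) = 2^-1].
Proof.
move=> /zhalf_sound[|? ? ->]; first by exists 1; rewrite zc4 divff // pnatr_eq0.
by split=> //; rewrite zc4; field.
Qed.
Lemma zhalf8 k : in_half 8 k -> [/\ size k = 8%N, half (E k) & dot phi (E k) = 1].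
Proof.
move=> /zhalf_sound[|? ? ->]; first by exists 2; rewrite zc8; field.
by split=> //; rewrite zc8; field.
Qed.
Lemma zhalf0 k : in_half 0 k -> [/\ size k = 8%N, half (E k) & dot phi (E k) = 0].
Proof.
move=> /zhalf_sound[|? ? ->]; first by exists 0; rewrite /zc /= mul0r.
by split=> //; rewrite /zc /= mul0r.
Qed.
Lemma half_E4 a : half a -> dot phi a = 2^-1 -> exists2 k, in_half 4 k & a = E k.
Proof. by move=> ha fa; apply: half_E => //; rewrite fa zc4; field. Qed.
Lemma half_E8 a : half a -> dot phi a = 1 -> exists2 k, in_half 8 k & a = E k.
Proof. by move=> ha fa; apply: half_E => //; rewrite fa zc8; field. Qed.
Lemma half_E0 a : half a -> dot phi a = 0 -> exists2 k, in_half 0 k & a = E k.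
Proof. by move=> ha fa; apply: half_E => //; rewrite fa /zc /= mul0r. Qed.

(** The vector a - c is the image of a under the reflection in the root c. *)
Lemma half_subroot a c : half a -> P c -> dot c c = 2 -> dot a c = 1 ->
  [/\ half (a - c), compat a (a - c) & dot a (a - c) = 0].
Proof.
move=> [h1 h2] Pc c2 ac; split.
- split; first by rewrite mulrnBl; apply: PB => //; rewrite mulr2n; exact: PD.
  by rewrite dotBl !dotBr (dotC c a) h2 ac c2; ring.
- by rewrite /compat opprB addrC subrK.
- by rewrite dotBr h2 ac subrr.
Qed.

Lemma three_neighbours a : half a -> dot phi a = 2^-1 -> exists d1 d2 d3,
  [/\ [/\ half d1, half d2 & half d3],
      [/\ dot phi d1 = 2^-1, dot phi d2 = 2^-1 & dot phi d3 = 2^-1],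
      [/\ compat a d1, compat a d2 & compat a d3],
      [/\ dot a d1 = 0, dot a d2 = 0 & dot a d3 = 0] &
      [/\ dot d1 d2 = 0, dot d1 d3 = 0 & dot d2 d3 = 0]].
Proof.
move=> ha fa; have [k kz aE] := half_E4 ha fa; have [sk _ _] := zhalf4 kz.
case: kz => /(check_tripleP check_triple_true).
move=> [g1 [g2 [g3 [[/InRoots r1 /InRoots r2 /InRoots r3] [[k1 k2 k3] [e12 e13 e23]]]]]].
have key g : in_roots g -> zdot k g = 16%ZZ ->
    [/\ size g = 8%N, P (E g), dot (E g) (E g) = 2, dot phi (E g) = 0 & dot a (E g) = 1].
  move=> /zroots_sound[sg Pg g2' fg] kg; split=> //.
  by rewrite aE dotE // kg zc16 divff // pnatr_eq0.
have [sg1 P1 n1 f1 a1] := key g1 r1 k1.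
have [sg2 P2 n2 f2 a2] := key g2 r2 k2.
have [sg3 P3 n3 f3 a3] := key g3 r3 k3.
have d12 : dot (E g1) (E g2) = 1 by rewrite dotE // e12 zc16 divff // pnatr_eq0.
have d13 : dot (E g1) (E g3) = 1 by rewrite dotE // e13 zc16 divff // pnatr_eq0.
have d23 : dot (E g2) (E g3) = 1 by rewrite dotE // e23 zc16 divff // pnatr_eq0.
have [h1 c1 z1] := half_subroot ha P1 n1 a1.
have [h2 c2 z2] := half_subroot ha P2 n2 a2.
have [h3 c3 z3] := half_subroot ha P3 n3 a3.
exists (a - E g1), (a - E g2), (a - E g3); split=> //.
- by split; rewrite dotBr fa ?f1 ?f2 ?f3 subr0.
- by split; rewrite dotBl !dotBr ?(dotC (E g1) a) ?(dotC (E g2) a) ha.2 ?a1 ?a2 ?a3 ?d12 ?d13 ?d23; ring.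
Qed.

(** Pigeonhole: each of the three neighbours of a equals b or c or is orthogonal to both, and the
    three are distinct. *)
Lemma fourth_vector a b c : C3_frame a b c -> dot phi a = 2^-1 -> dot phi b = 2^-1 ->
  dot phi c = 2^-1 -> exists d, [/\ half d, dot phi d = 2^-1, compat a d &
    [/\ dot a d = 0, dot b d = 0 & dot c d = 0]].
Proof.
move=> /C3P[[ha hb hc] [[pab pac pbc] [cab cac]]] fa fb fc.
have [d1 [d2 [d3 [[h1 h2 h3] [f1 f2 f3] [c1 c2 c3] [z1 z2 z3] [z12 z13 z23]]]]] := three_neighbours ha fa.
have nhalf : (2^-1 : C) != - 2^-1.
  have h21 : 2^-1 + 2^-1 = 1 :> C by field.
  by rewrite -addr_eq0 h21 oner_eq0.
have dich d e : half d -> half e -> dot phi d = 2^-1 -> dot phi e = 2^-1 -> compat a d -> compat a e ->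
    dot a d = 0 -> dot a e = 0 -> e = d \/ dot d e = 0.
  move=> hd he fd fe cd ce zd ze; have [->|ed|->] := compat_orth hd he ha cd ce zd ze.
  - by left.
  - by exfalso; move/eqP: nhalf; apply; rewrite -{1}fe ed dotNr fd.
  - by right.
have nd d : half d -> dot d d = 0 -> False.
  by move=> [_ ->] /eqP; rewrite oner_eq0.
have D d : half d -> dot phi d = 2^-1 -> compat a d -> dot a d = 0 -> (b = d \/ c = d) \/ (dot b d = 0 /\ dot c d = 0).
  move=> hd fd cd zd.
  have [?|h] := dich d b hd hb fd fb cd cab zd pab; first by left; left.
  have [?|h'] := dich d c hd hc fd fc cd cac zd pac; first by left; right.
  by right; rewrite (dotC b) (dotC c).
have [e1|[? ?]] := D d1 h1 f1 c1 z1; last by exists d1.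
have [e2|[? ?]] := D d2 h2 f2 c2 z2; last by exists d2.
have [e3|[? ?]] := D d3 h3 f3 c3 z3; last by exists d3.
have n12 : d1 <> d2 by move=> e; move: z12; rewrite e; exact: nd h2.
have n13 : d1 <> d3 by move=> e; move: z13; rewrite e; exact: nd h3.
have n23 : d2 <> d3 by move=> e; move: z23; rewrite e; exact: nd h3.
exfalso; clear - e1 e2 e3 n12 n13 n23.
by case: e1 => e1; case: e2 => e2; case: e3 => e3; congruence.
Qed.

(** The value 3/4 = 1/4 + 1/2 is what makes b - a/2 have product 1/4 with a, as [center] demands. *)
Lemma quarter_vector a : half a -> dot phi a = 0 -> exists b,
  [/\ half b, dot phi b = 2^-1 & dot b a = 3 / 4].
Proof.
move=> ha fa; have [k kz aE] := half_E0 ha fa; have [sk _ _] := zhalf0 kz.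
case: kz => /(check_quarterP check_quarter_true)[l /InHalf lz kl].
have [sl hl fl] := zhalf4 lz; exists (E l); split=> //.
by rewrite aE dotE // kl zc12; field.
Qed.

(** Supplies the auxiliary vector that yields relation II_0 at the level omega, where f = 0. *)
Lemma unit_partner a : half a -> dot phi a = 0 -> exists b,
  [/\ half b, dot phi b = 1, compat a b & dot a b = 0].
Proof.
move=> ha fa; have [k kz aE] := half_E0 ha fa; have [sk _ _] := zhalf0 kz.
case: kz => /(check_unitP check_unit_true)[l /InHalf lz [kl ckl]].
have [sl hl fl] := zhalf8 lz; exists (E l); split=> //.
  rewrite aE /compat -EB //; apply: zlat_sound; last exact: ckl.
  exact: size_zsub.
by rewrite aE dotC dotE // kl /zc /= mul0r.
Qed.

Lemma null_partner a : half a -> dot phi a = 0 -> exists b,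
  [/\ half b, dot phi b = 0, compat a b & dot a b = 0].
Proof.
move=> ha fa; have [k kz aE] := half_E0 ha fa; have [sk _ _] := zhalf0 kz.
case: kz => /(check_nullP check_null_true)[g /InRoots gz kg].
have [sg Pg g2 fg] := zroots_sound gz.
have ag : dot a (E g) = 1 by rewrite aE dotE // kg zc16 divff // pnatr_eq0.
have [h1 c1 z1] := half_subroot ha Pg g2 ag.
by exists (a - E g); split=> //; rewrite dotBr fa fg subrr.
Qed.

Lemma root_connected (S : V -> Prop) :
  S (2^-1 *: (phi + E zroot0)) ->
  (forall u v w, C3_frame u v w -> dot phi u = 2^-1 -> dot phi v = 2^-1 -> dot phi w = 2^-1 ->
     S (2^-1 *: (phi + (u - v))) -> S (2^-1 *: (phi + (u - w)))) ->
  forall a, half a -> dot phi a = 1 -> S a.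
Proof.
move=> S0 Sstep a ha fa; have [k kz aE] := half_E8 ha fa; have [sk _ _] := zhalf8 kz.
set g := zroot_of k.
have gz : in_roots g by case: kz => /zroot_of_in; exact: InRoots.
have aE' : a = 2^-1 *: (phi + E g).
  rewrite aE; apply/rowP => i; rewrite !mxE (nth_zsub (n := 8)) ?size_map //.
  by rewrite (nth_map Z0) ?sk // nth_nseq ltn_ord !zcE; field.
rewrite aE'.
case: gz; move: g {aE'}.
apply: (check_connectedP (T := fun g => S (2^-1 *: (phi + E g))) check_connected_true zroot0_in S0).
move=> h1 h2 l /InRoots/zroots_sound[s1 P1 n1 f1] /InRoots/zroots_sound[s2 P2 n2 f2].
move=> /InHalf/zhalf4[sl hl fl] e12 l1 l2 T1.
have d12 : dot (E h1) (E h2) = 1 by rewrite dotE // e12 zc16 divff // pnatr_eq0.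
have d1 : dot (E l) (E h1) = 1 by rewrite dotE // l1 zc16 divff // pnatr_eq0.
have d2 : dot (E l) (E h2) = 1 by rewrite dotE // l2 zc16 divff // pnatr_eq0.
have [k1 c1 z1] := half_subroot hl P1 n1 d1.
have [k2 c2 z2] := half_subroot hl P2 n2 d2.
have Fr : C3_frame (E l) (E l - E h1) (E l - E h2).
  apply/C3P; split=> //; split=> //; split=> //.
  by rewrite dotBl !dotBr hl.2 d2 (dotC _ (E l)) d1 d12; ring.
have sub h : E l - (E l - E h) = E h by rewrite opprB addrC subrK.
have := Sstep _ _ _ Fr fl; rewrite !dotBr fl f1 f2 subr0 => /(_ erefl erefl).
by rewrite !sub; apply.
Qed.

End Reflect.

Lemma E_zroot0 (R : realType) (i : 'I_8) :
  E R zroot0 0 i = (nat_of_ord i == 0)%:R - (nat_of_ord i == 1)%:R.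
Proof.
rewrite mxE; have z0 : zc R 0 = 0 by [].
have z4 : zc R (-4) = -4 by rewrite /zc /= NegzE rmorphN.
by case: i => [[|[|[|[|[|[|[|[|//]]]]]]]] i8] /=; rewrite ?z0 ?z4 ?zc4; field.
Qed.

(** * The bilinear relations *)

Ltac veq := apply/rowP => ?; rewrite !mxE; field.
Ltac dots := rewrite ?(dotDl, dotDr, dotZl, dotZr, dotNl, dotNr).

Section Relations.
Variable R : realType.
Local Notation C := (Cplx R).
Local Notation V := (Vec R).
Local Notation P := (@E8_lattice R).
Local Notation phi := (phi R).
Local Notation H := (@hyperplane R).
Variables (br : C -> C) (delta : C).
Hypothesis br_entire : entire br.
Hypothesis br_nonzero : exists z, br z != 0.
Hypothesis br_three_term : three_term br.
Hypothesis br0 : br 0 = 0.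
Implicit Types (a b c d u v w x : V) (f g h : V -> C) (k : C).

(** Two generic conditions hold simultaneously somewhere; a root orthogonal to phi carries the
    statement on a hyperplane over to one variable. *)
Lemma br_avoid (s1 s2 : C) : exists z, br (z + s1) != 0 /\ br (z + s2) != 0.
Proof.
have [_ _ n2 f0] := zroots_sound R (InRoots zroot0_in).
have ne : dot (E R zroot0) (E R zroot0) != dot phi (E R zroot0) ^+ 2 / 2.
  by rewrite n2 f0 expr0n mul0r pnatr_eq0.
have g1 := br_generic s1 0 br_entire br_nonzero ne.
have g2 := br_generic s2 0 br_entire br_nonzero ne.
have [U [_ EU HU]] := generic_and g1 g2.
have /closureE/(_ setT openT I)[y [[Ey Uy] _]] := EU _ (@hyper_point R 0).
by exists (dot (E R zroot0) y); exact: HU.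
Qed.

(** Taking alpha = beta = (s + z)/2 and gamma = (s - z)/2 in the three-term identity kills the last
    term and leaves [s] ([z] + [-z]) [z0 +- alpha] = 0. *)
Lemma br_odd z : br (- z) = - br z.
Proof.
have [s bs] := br_nonzero.
have [z0 [h1 h2]] := br_avoid ((s + z) / 2) (- ((s + z) / 2)).
have := br_three_term z0 ((s + z) / 2) ((s + z) / 2) ((s - z) / 2).
rewrite /br_pm subrr br0 mulr0 mul0r addr0.
rewrite (_ : (s + z) / 2 + (s - z) / 2 = s); last by field.
rewrite (_ : (s - z) / 2 + (s + z) / 2 = s); last by field.
rewrite (_ : (s + z) / 2 - (s - z) / 2 = z); last by field.
rewrite (_ : (s - z) / 2 - (s + z) / 2 = - z); last by field.
rewrite -mulrDl -mulrDr => /eqP; rewrite !mulf_eq0 (negbTE h1) (negbTE h2) (negbTE bs) /= orbF.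
by rewrite addrC addr_eq0 => /eqP.
Qed.

(** The arguments are arranged so that [w] and [w + k] kill the outer terms of the three-term
    identity; the middle one is, up to sign, [k] times three values made nonzero by the choice of s
    and q. *)
Lemma zeros_diff (w k : C) : br w = 0 -> br (w + k) = 0 -> br k = 0.
Proof.
move=> bw bwk; have [s bs] := br_nonzero.
pose p := s - w.
have [q [h1 h2]] := br_avoid (- w) (k - p).
pose a := (q + p) / 2; pose b := (q - p) / 2.
have := br_three_term (b + k) a b (w - b); rewrite /br_pm.
rewrite (_ : b + (w - b) = w); last by ring.
rewrite (_ : b + k + (w - b) = w + k); last by ring.
rewrite bw bwk !mul0r mulr0 add0r addr0.
rewrite (_ : w - b + a = s); last by rewrite /a /b /p; field.
rewrite (_ : w - b - a = - (q - w)); last by rewrite /a /b /p; field.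
rewrite (_ : b + k + b = q + (k - p)); last by rewrite /b; field.
rewrite (_ : b + k - b = k); last by ring.
move=> /eqP; rewrite br_odd !mulf_eq0 oppr_eq0 (negbTE bs) (negbTE h1) (negbTE h2) /=.
by move=> /eqP.
Qed.

Lemma br_dotC a b x : br_dot br b a x = - br_dot br a b x.
Proof.
rewrite /br_dot (addrC b a) (_ : b - a = - (a - b)); last by rewrite opprB.
by rewrite dotNl br_odd mulrN.
Qed.
Lemma br_dotNr a b x : br_dot br a (- b) x = br_dot br a b x.
Proof. by rewrite /br_dot opprK mulrC. Qed.
Lemma br_dotNl a b x : br_dot br (- a) b x = br_dot br a b x.
Proof.
rewrite /br_dot (_ : - a + b = - (a - b)); last by rewrite opprB addrC.
rewrite (_ : - a - b = - (a + b)); last by rewrite opprD.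
by rewrite !dotNl !br_odd mulrNN mulrC.
Qed.

Lemma br_dot_three a b c d x : br_dot br b c x * br_dot br d a x + br_dot br c a x * br_dot br d b x
  + br_dot br a b x * br_dot br d c x = 0.
Proof.
have := br_three_term (dot d x) (dot a x) (dot b x) (dot c x).
by rewrite /br_pm /br_dot !dotDl !dotNl.
Qed.

Lemma lin_generic a (s k : C) : dot a a != dot phi a ^+ 2 / 2 ->
  generically (H k) (fun x => br (dot a x + s) != 0).
Proof. exact: br_generic. Qed.

Lemma br_dot_generic a b k : dot (a + b) (a + b) != dot phi (a + b) ^+ 2 / 2 ->
  dot (a - b) (a - b) != dot phi (a - b) ^+ 2 / 2 ->
  generically (H k) (fun x => br_dot br a b x != 0).
Proof.
move=> h1 h2; apply: generic_imp2 (lin_generic 0 k h1) (lin_generic 0 k h2) => x _.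
by rewrite !addr0 /br_dot => ? ?; rewrite mulf_neq0.
Qed.

(* The ORG equations on one hyperplane, by the values of (phi|.) on the frame: all 1/2 for I,
   all 0 for II_0, (1, 0, 0) for II_1 and (1, 1, 0) for II_2.  The functions f, g, h stand
   for tau^(n-1), tau^(n), tau^(n+1). *)
Definition relI f g k := forall a b c, C3_frame a b c ->
  dot phi a = 2^-1 -> dot phi b = 2^-1 -> dot phi c = 2^-1 ->
  generically (H k) (fun x =>
    br_dot br b c x * (f (x - delta *: a) * g (x + delta *: a))
  + br_dot br c a x * (f (x - delta *: b) * g (x + delta *: b))
  + br_dot br a b x * (f (x - delta *: c) * g (x + delta *: c)) = 0).

Definition relII0_at g k a b c := generically (H k) (fun x =>
    br_dot br b c x * (g (x + delta *: a) * g (x - delta *: a))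
  + br_dot br c a x * (g (x + delta *: b) * g (x - delta *: b))
  + br_dot br a b x * (g (x + delta *: c) * g (x - delta *: c)) = 0).

Definition relII0 g k := forall a b c, C3_frame a b c ->
  dot phi a = 0 -> dot phi b = 0 -> dot phi c = 0 -> relII0_at g k a b c.

Definition relII1_at f g h k a b c := generically (H k) (fun x =>
    br_dot br b c x * (f (x - delta *: a) * h (x + delta *: a))
  + br_dot br c a x * (g (x + delta *: b) * g (x - delta *: b))
  + br_dot br a b x * (g (x + delta *: c) * g (x - delta *: c)) = 0).

Definition relII1 f g h k := forall a b c, C3_frame a b c ->
  dot phi a = 1 -> dot phi b = 0 -> dot phi c = 0 -> relII1_at f g h k a b c.

Definition relII2 f g h k := forall a b c, C3_frame a b c ->
  dot phi a = 1 -> dot phi b = 1 -> dot phi c = 0 -> generically (H k) (fun x =>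
    br_dot br b c x * (f (x - delta *: a) * h (x + delta *: a))
  + br_dot br c a x * (f (x - delta *: b) * h (x + delta *: b))
  + br_dot br a b x * (g (x + delta *: c) * g (x - delta *: c)) = 0).

Lemma relII0_at_N2 g k a b c : relII0_at g k a (- b) c -> relII0_at g k a b c.
Proof.
apply: generic_imp => x _; rewrite br_dotNl !br_dotNr scalerN opprK.
by rewrite [g (x - delta *: b) * _]mulrC.
Qed.

Lemma relII0_at_N3 g k a b c : relII0_at g k a b (- c) -> relII0_at g k a b c.
Proof.
apply: generic_imp => x _; rewrite br_dotNl !br_dotNr scalerN opprK.
by rewrite [g (x - delta *: c) * _]mulrC.
Qed.

(** Translated points and linear forms enter through equations, so that relations coming from
    different frames can be written in common terms and then combined as polynomials. *)
Lemma relI_shift f g k k' v a b c (pa pb pc qa qb qc : V) (l1 l2 l3 l4 l5 l6 : V -> C) :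
  relI f g k -> k' + dot phi v = k -> C3_frame a b c ->
  dot phi a = 2^-1 -> dot phi b = 2^-1 -> dot phi c = 2^-1 ->
  v - delta *: a = pa -> v + delta *: a = qa ->
  v - delta *: b = pb -> v + delta *: b = qb ->
  v - delta *: c = pc -> v + delta *: c = qc ->
  (forall x, dot (b + c) (x + v) = l1 x) -> (forall x, dot (b - c) (x + v) = l2 x) ->
  (forall x, dot (c + a) (x + v) = l3 x) -> (forall x, dot (c - a) (x + v) = l4 x) ->
  (forall x, dot (a + b) (x + v) = l5 x) -> (forall x, dot (a - b) (x + v) = l6 x) ->
  generically (H k') (fun x =>
    br (l1 x) * br (l2 x) * (f (x + pa) * g (x + qa))
  + br (l3 x) * br (l4 x) * (f (x + pb) * g (x + qb))
  + br (l5 x) * br (l6 x) * (f (x + pc) * g (x + qc)) = 0).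
Proof.
move=> rI kk F fa fb fc <- <- <- <- <- <- e1 e2 e3 e4 e5 e6.
have := generic_shift kk (rI a b c F fa fb fc).
by apply: generic_imp => x _; rewrite !addrA /br_dot e1 e2 e3 e4 e5 e6.
Qed.

(** * Relation II_0 from three relations I *)

Lemma relII0_alg (M F0 F12 F13 F23 m1 m2 m3 s12 s13 s23 d32 d13 d21 p1 p2 p3 n1 n2 n3 : C) :
  M != 0 -> F0 != 0 ->
  M * d32 * (F0 * p1) - m3 * s13 * (F12 * n2) + m2 * s12 * (F13 * n3) = 0 ->
  M * d13 * (F0 * p2) - m1 * s12 * (F23 * n3) + m3 * s23 * (F12 * n1) = 0 ->
  M * d21 * (F0 * p3) - m2 * s23 * (F13 * n1) + m1 * s13 * (F23 * n2) = 0 ->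
  s23 * - d32 * (p1 * n1) + s13 * - d13 * (p2 * n2) + s12 * - d21 * (p3 * n3) = 0.
Proof.
move=> M0 F00 E1 E2 E3; apply: (mulfI (mulf_neq0 M0 F00)); rewrite mulr0.
transitivity (- (s23 * n1 * (M * d32 * (F0 * p1) - m3 * s13 * (F12 * n2) + m2 * s12 * (F13 * n3))
  + s13 * n2 * (M * d13 * (F0 * p2) - m1 * s12 * (F23 * n3) + m3 * s23 * (F12 * n1))
  + s12 * n3 * (M * d21 * (F0 * p3) - m2 * s23 * (F13 * n1) + m1 * s13 * (F23 * n2)))).
  by ring.
by rewrite E1 E2 E3 !mulr0 !addr0 oppr0.
Qed.

Definition null3 a b c := [/\ C3_frame a b c, dot phi a = 0, dot phi b = 0 & dot phi c = 0].

Lemma C3_cycle a b c : C3_frame a b c -> C3_frame b c a.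
Proof.
move=> /C3P[[ha hb hc] [[p1 p2 p3] [c1 c2]]]; apply/C3P; split=> //; split.
  by rewrite (dotC b a) (dotC c a).
split; last exact: compat_sym.
by apply: compat_trans c2; exact: compat_sym.
Qed.

Lemma C3_swap a b c : C3_frame a b c -> C3_frame a c b.
Proof.
move=> /C3P[[ha hb hc] [[p1 p2 p3] [c1 c2]]]; apply/C3P; split=> //; split=> //.
by rewrite (dotC c b).
Qed.

Lemma C3_N1 a b c : C3_frame a b c -> C3_frame (- a) b c.
Proof.
move=> /C3P[[ha hb hc] [[p1 p2 p3] [c1 c2]]]; apply/C3P.
split; first by split=> //; exact: halfN.
split; first by rewrite !dotNl p1 p2 p3 oppr0.
by split; apply: compat_sym; apply: compatN => //; exact: compat_sym.
Qed.

(* Then u + a1/2, u - a1/2 - a2, u - a1/2 - a3 is a frame of type I, and so are its images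
   under the cyclic permutations of a1, a2, a3. *)
Definition center u a1 a2 a3 := [/\ half (u + 2^-1 *: a1), dot phi u = 2^-1, dot u u = 2^-1 &
  [/\ dot u a1 = 4^-1, dot u a2 = 4^-1 & dot u a3 = 4^-1]].

Lemma center_cycle u a1 a2 a3 : null3 a1 a2 a3 -> center u a1 a2 a3 -> center u a2 a3 a1.
Proof.
move=> [/C3P[[h1 h2 h3] [[p1 p2 p3] [c1 c2]]] _ _ _] [[hu nu] fu uu [u1 u2 u3]]; split=> //.
split.
  rewrite (_ : _ *+ 2 = (u + 2^-1 *: a1) *+ 2 - (a1 - a2)); first exact: PB.
  by rewrite !mulr2n; veq.
by dots; rewrite uu u2 (dotC a2) u2 h2.2; field.
Qed.

(** The translation by -delta (u - a1/2) puts g at x + delta a1, x - delta a2, x - delta a3, and f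
    at x - 2 delta u and two other points. The point x - 2 delta u is invariant under cyclic
    permutations of a1, a2, a3; the other values of f cancel in pairs in [relII0_alg]. *)
Lemma relII0_step f g k u a1 a2 a3 : relI f g (k - delta / 2) -> null3 a1 a2 a3 ->
  center u a1 a2 a3 ->
  generically (H k) (fun x =>
    br (dot (2 *: u) x - dot a1 x - dot a2 x - dot a3 x - delta / 2) * br (dot a3 x - dot a2 x) *
      (f (x - delta *: (2 *: u)) * g (x + delta *: a1))
  - br (dot (2 *: u) x - dot a3 x - delta / 2) * br (dot a1 x + dot a3 x) *
      (f (x - delta *: (2 *: u - (a1 + a2))) * g (x - delta *: a2))
  + br (dot (2 *: u) x - dot a2 x - delta / 2) * br (dot a1 x + dot a2 x) *
      (f (x - delta *: (2 *: u - (a1 + a3))) * g (x - delta *: a3)) = 0).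
Proof.
move=> rI [/C3P[[h1 h2 h3] [[p12 p13 p23] [c1 c2]]] f1 f2 f3] [hu fu uu [u1 u2 u3]].
have [q12 q13 q23] : [/\ dot a2 a1 = 0, dot a3 a1 = 0 & dot a3 a2 = 0] by rewrite (dotC a2) (dotC a3 a1) (dotC a3).
have [w1 w2 w3] : [/\ dot a1 u = 4^-1, dot a2 u = 4^-1 & dot a3 u = 4^-1] by rewrite !(dotC _ u).
have [[P1 n1] [P2 n2] [P3 n3]] := And3 h1 h2 h3.
pose e := (uu, u1, u2, u3, w1, w2, w3, p12, p13, p23, q12, q13, q23, n1, n2, n3).
have [A AE] : exists A, A = u + 2^-1 *: a1 by eexists.
have [B BE] : exists B, B = u - 2^-1 *: a1 - a2 by eexists.
have [D DE] : exists D, D = u - 2^-1 *: a1 - a3 by eexists.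
have [v vE] : exists v, v = - (delta *: (u - 2^-1 *: a1)) by eexists.
rewrite -AE in hu.
have hB : half B.
  split; last by rewrite BE; dots; rewrite !e; field.
  rewrite (_ : B *+ 2 = A *+ 2 - (a1 + a2) *+ 2).
    by apply: PB; [exact: hu.1|rewrite mulr2n; apply: PD; exact: compat_sum].
  by rewrite ?AE ?BE !mulr2n; veq.
have hD : half D.
  split; last by rewrite DE; dots; rewrite !e; field.
  rewrite (_ : D *+ 2 = A *+ 2 - (a1 + a3) *+ 2).
    by apply: PB; [exact: hu.1|rewrite mulr2n; apply: PD; exact: compat_sum].
  by rewrite ?AE ?DE !mulr2n; veq.
have F : C3_frame A B D.
  apply/C3P; split=> //; split.
    by split; rewrite ?AE ?BE ?DE; dots; rewrite !e; field.
  split.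
    by rewrite /compat (_ : A - B = a1 + a2); [exact: compat_sum|rewrite ?AE ?BE ; veq].
  by rewrite /compat (_ : A - D = a1 + a3); [exact: compat_sum|rewrite ?AE ?DE ; veq].
have fA : dot phi A = 2^-1 by rewrite AE; dots; rewrite fu f1; field.
have fB : dot phi B = 2^-1 by rewrite BE; dots; rewrite fu f1 f2; field.
have fD : dot phi D = 2^-1 by rewrite DE; dots; rewrite fu f1 f3; field.
have kv : k + dot phi v = k - delta / 2 by rewrite vE; dots; rewrite fu f1; field.
have := @relI_shift f g _ k v A B D (- (delta *: (2 *: u))) (- (delta *: (2 *: u - (a1 + a2))))
  (- (delta *: (2 *: u - (a1 + a3)))) (delta *: a1) (- (delta *: a2)) (- (delta *: a3))
  (fun x => dot (2 *: u) x - dot a1 x - dot a2 x - dot a3 x - delta / 2)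
  (fun x => dot a3 x - dot a2 x)
  (fun x => dot (2 *: u) x - dot a3 x - delta / 2)
  (fun x => - (dot a1 x + dot a3 x))
  (fun x => dot (2 *: u) x - dot a2 x - delta / 2)
  (fun x => dot a1 x + dot a2 x) rI kv F fA fB fD.
move=> HS; suff : generically (H k) (fun x =>
    br (dot (2 *: u) x - dot a1 x - dot a2 x - dot a3 x - delta / 2) * br (dot a3 x - dot a2 x) *
      (f (x - delta *: (2 *: u)) * g (x + delta *: a1))
  + br (dot (2 *: u) x - dot a3 x - delta / 2) * br (- (dot a1 x + dot a3 x)) *
      (f (x - delta *: (2 *: u - (a1 + a2))) * g (x - delta *: a2))
  + br (dot (2 *: u) x - dot a2 x - delta / 2) * br (dot a1 x + dot a2 x) *
      (f (x - delta *: (2 *: u - (a1 + a3))) * g (x - delta *: a3)) = 0).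
  by apply: generic_imp => x _; rewrite br_odd mulrN mulNr.
apply: HS.
- by rewrite vE AE -opprD -scalerDr; congr (- (_ *: _)); veq.
- by rewrite vE AE addrC -scalerBr -?scalerN; congr (_ *: _); veq.
- by rewrite vE BE -opprD -scalerDr; congr (- (_ *: _)); veq.
- by rewrite vE BE addrC -scalerBr -?scalerN; congr (_ *: _); veq.
- by rewrite vE DE -opprD -scalerDr; congr (- (_ *: _)); veq.
- by rewrite vE DE addrC -scalerBr -?scalerN; congr (_ *: _); veq.
- by move=> x; rewrite BE DE vE; dots; rewrite !e; field.
- by move=> x; rewrite BE DE vE; dots; rewrite !e; field.
- by move=> x; rewrite AE DE vE; dots; rewrite !e; field.
- by move=> x; rewrite AE DE vE; dots; rewrite !e; field.
- by move=> x; rewrite AE BE vE; dots; rewrite !e; field.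
- by move=> x; rewrite AE BE vE; dots; rewrite !e; field.
Qed.

Lemma relII0_core f g k u a1 a2 a3 : relI f g (k - delta / 2) ->
  generically (H (k - delta)) (fun x => f x != 0) ->
  null3 a1 a2 a3 -> center u a1 a2 a3 -> relII0_at g k a1 a2 a3.
Proof.
move=> rI fn N1 c1.
have N2 : null3 a2 a3 a1 by case: N1 => F ? ? ?; split=> //; exact: C3_cycle.
have N3 : null3 a3 a1 a2 by case: N2 => F ? ? ?; split=> //; exact: C3_cycle.
have c2 := center_cycle N1 c1; have c3 := center_cycle N2 c2.
have r1 := relII0_step rI N1 c1; have r2 := relII0_step rI N2 c2; have r3 := relII0_step rI N3 c3.
have [/C3P[[h1 h2 h3] [[p12 p13 p23] _]] f1 f2 f3] := N1.
have [_ fu uu [u1 u2 u3]] := c1.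
have f0 : generically (H k) (fun x => f (x - delta *: (2 *: u)) != 0).
  by apply: (generic_shift _ fn); dots; rewrite fu; field.
have M0 : generically (H k) (fun x => br (dot (2 *: u - a1 - a2 - a3) x + - (delta / 2)) != 0).
  apply: br_generic => //.
  have -> : dot phi (2 *: u - a1 - a2 - a3) = 1 by dots; rewrite fu f1 f2 f3; field.
  have -> : dot (2 *: u - a1 - a2 - a3) (2 *: u - a1 - a2 - a3) = 2.
    dots; rewrite !(dotC _ u) u1 u2 u3 uu (dotC a2 a1) (dotC a3) (dotC a3 a2) p12 p13 p23.
    by rewrite h1.2 h2.2 h3.2; field.
  by rewrite expr1n -subr_eq0 (_ : _ - _ = 3 / 2) ?mulf_neq0 ?invr_neq0 ?pnatr_eq0 //; field.
apply: generic_imp2 (generic_and r1 (generic_and r2 r3)) (generic_and f0 M0) => x _ [E1 [E2 E3]] [F0 MM].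
move: MM; rewrite (_ : dot _ x + _ = dot (2 *: u) x - dot a1 x - dot a2 x - dot a3 x - delta / 2); last first.
  by dots.
move=> MM.
have e2 : dot (2 *: u) x - dot a2 x - dot a3 x - dot a1 x - delta / 2 =
  dot (2 *: u) x - dot a1 x - dot a2 x - dot a3 x - delta / 2 by ring.
have e3 : dot (2 *: u) x - dot a3 x - dot a1 x - dot a2 x - delta / 2 =
  dot (2 *: u) x - dot a1 x - dot a2 x - dot a3 x - delta / 2 by ring.
rewrite e2 (addrC a2 a1) (addrC (dot a2 x) (dot a1 x)) in E2.
rewrite e3 (addrC a3 a1) (addrC a3 a2) (addrC (dot a3 x) (dot a1 x)) (addrC (dot a3 x) (dot a2 x)) in E3.
have := relII0_alg MM F0 E1 E2 E3.
rewrite /br_dot !dotDl !dotNl (addrC (dot a3 x) (dot a1 x)).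
by rewrite -!br_odd !opprB.
Qed.

(** As (2 c|a - b) is an integer n, (c|b) = (3 - 2 n)/4; Bessel's inequality 9/16 + (c|b)^2 <= 1
    leaves two values. *)
Lemma quarter_sign a b c : half a -> half b -> half c -> compat a b -> dot a b = 0 ->
  dot c a = 3 / 4 -> dot c b = 4^-1 \/ dot c b = - 4^-1.
Proof.
move=> ha hb hc cab pab ca.
have [n Hn] := P_dot hc.1 cab.
rewrite dotMnl dotBr ca -mulr_natr in Hn.
have tE : dot c b = (3 - 2 * n)%:~R / 4.
  by rewrite intrB intrM -Hn; field.
pose w := c - (3 / 4) *: a - ((3 - 2 * n)%:~R / 4) *: b.
have Rn (j : int) : (j%:~R / 4 : C) \is Num.real by rewrite rpredM ?rpredV ?realn ?realz.
have rw : realv w.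
  apply: realvD; last by apply: realvN; apply: realvZ => //; exact: half_real hb.1.
  apply: realvD; first exact: half_real hc.1.
  by apply: realvN; apply: realvZ; [rewrite (_ : 3 = 3%:~R :> C) //; exact: Rn|exact: half_real ha.1].
have := dot_ge0 rw.
have -> : dot w w = (7 - (3 - 2 * n) ^+ 2)%:~R / 16.
  rewrite /w; dots; rewrite (dotC a c) (dotC b c) (dotC b a) ha.2 hb.2 hc.2 ca pab tE.
  by rewrite expr2 (intrB _ 7) intrM; field.
rewrite pmulr_lge0 ?invr_gt0 ?ltr0n // (ler_int _ 0) => h7.
have [e|e] : (3 - 2 * n = 1 \/ 3 - 2 * n = -1)%R.
  have [?|[?|[?|?]]] : (n = 1 \/ n = 2 \/ n < 1 \/ 2 < n)%R by lia.
  - by left; lia.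
  - by right; lia.
  - by exfalso; move: h7; rewrite expr2; nia.
  - by exfalso; move: h7; rewrite expr2; nia.
- by left; rewrite tE e mul1r.
- by right; rewrite tE e mulN1r.
Qed.

(** The vector b - a1/2 has products 1/4 with a2 and a3 up to sign, and relation II_0 is insensitive
    to the signs of a2 and a3. *)
Lemma relII0_of_relI f g k : relI f g (k - delta / 2) ->
  generically (H (k - delta)) (fun x => f x != 0) -> relII0 g k.
Proof.
move=> rI fn a1 a2 a3 F f1 f2 f3.
have /C3P[[h1 h2 h3] [[p12 p13 p23] [c12 c13]]] := F.
have [b [hb fb ba]] := quarter_vector h1 f1.
have [u uE] : exists u, u = b - 2^-1 *: a1 by eexists.
have ua : dot u a1 = 4^-1 by rewrite uE; dots; rewrite ba h1.2; field.
have uu : dot u u = 2^-1.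
  by rewrite uE; dots; rewrite (dotC a1 b) ba h1.2 hb.2; field.
have fu : dot phi u = 2^-1 by rewrite uE; dots; rewrite fb f1; field.
have key a2' a3' : C3_frame a1 a2' a3' -> dot phi a2' = 0 -> dot phi a3' = 0 ->
    dot b a2' = 4^-1 -> dot b a3' = 4^-1 -> relII0_at g k a1 a2' a3'.
  move=> F' f2' f3' b2 b3; have /C3P[_ [[q12 q13 q23] _]] := F'.
  have c0 : center u a1 a2' a3'.
    split; [by rewrite uE subrK|exact: fu|exact: uu|split; first exact: ua].
      by rewrite uE; dots; rewrite q12 b2; field.
    by rewrite uE; dots; rewrite q13 b3; field.
  exact: (relII0_core rI fn (And4 F' f1 f2' f3') c0).
have F2 := C3_cycle F.
have FN2 c d : C3_frame a1 c d -> C3_frame a1 (- c) d.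
  by move=> /C3_cycle/C3_N1/C3_cycle/C3_cycle.
have FN3 c d : C3_frame a1 c d -> C3_frame a1 c (- d).
  by move=> /C3_swap/FN2/C3_swap.
have [e2|e2] := quarter_sign h1 h2 hb c12 p12 ba; have [e3|e3] := quarter_sign h1 h3 hb c13 p13 ba.
- exact: key.
- apply: relII0_at_N3 => //; apply: key => //; first exact: FN3.
  + by rewrite dotNr f3 oppr0.
  + by rewrite dotNr e3 opprK.
- apply: relII0_at_N2 => //; apply: key => //; first exact: FN2.
  + by rewrite dotNr f2 oppr0.
  + by rewrite dotNr e2 opprK.
- apply: relII0_at_N2 => //; apply: relII0_at_N3 => //; apply: key => //; first by apply: FN3; exact: FN2.
  + by rewrite dotNr f2 oppr0.
  + by rewrite dotNr f3 oppr0.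
  + by rewrite dotNr e2 opprK.
  + by rewrite dotNr e3 opprK.
Qed.

(** Both a + b and a - b have square norm 2, which turns the criterion of [br_generic] into (phi|a
    +- b)^2 <> 4. *)
Lemma frame_generic a b k : half a -> half b -> dot a b = 0 ->
  (dot phi a + dot phi b) ^+ 2 != 4 -> (dot phi a - dot phi b) ^+ 2 != 4 ->
  generically (H k) (fun x => br_dot br a b x != 0).
Proof.
move=> ha hb ab n1 n2.
have n (z : C) : z != 4 -> 2 != z / 2.
  by apply: contra_neq => e; rewrite -[z](@divfK _ 2) ?pnatr_eq0 // -e -natrM.
apply: br_dot_generic => //.
  have -> : dot (a + b) (a + b) = 2 by dots; rewrite (dotC b a) ab ha.2 hb.2; ring.
  by rewrite dotDr; exact: n.
have -> : dot (a - b) (a - b) = 2 by dots; rewrite (dotC b a) ab ha.2 hb.2; ring.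
by rewrite dotBr; exact: n.
Qed.

(** * Changing the frame in relation II_1 *)

Lemma relII1_swap f g h k a b c : relII1_at f g h k a b c -> relII1_at f g h k a c b.
Proof.
apply: generic_imp => x _ e; apply/eqP; rewrite -oppr_eq0; apply/eqP; rewrite -[RHS]e.
by rewrite (br_dotC c b) (br_dotC b a) (br_dotC a c); ring.
Qed.

Lemma relII1_N3 f g h k a b c : relII1_at f g h k a b (- c) -> relII1_at f g h k a b c.
Proof.
apply: generic_imp => x _; rewrite br_dotNl !br_dotNr scalerN opprK.
by rewrite [g (x - delta *: c) * _]mulrC.
Qed.

Lemma three_alg (X12 X20 X01 X2b Xb1 Xb0 X02 X0b W0 W1 W2 Wb : C) :
  X12 != 0 -> X20 = - X02 -> X0b = - Xb0 ->
  X2b * X01 + Xb1 * X02 + X12 * X0b = 0 ->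
  X12 * W0 + X20 * W1 + X01 * W2 = 0 ->
  X2b * W1 + Xb1 * W2 + X12 * Wb = 0 ->
  X2b * W0 + Xb0 * W2 + X02 * Wb = 0.
Proof.
move=> n e1 e2 T E1 E2; apply: (mulfI n); rewrite mulr0.
transitivity (X2b * (X12 * W0 + X20 * W1 + X01 * W2) + X02 * (X2b * W1 + Xb1 * W2 + X12 * Wb)
  - W2 * (X2b * X01 + Xb1 * X02 + X12 * X0b)); first by rewrite e1 e2; ring.
by rewrite T E1 E2 !mulr0 addr0 subr0.
Qed.

(** Relation II_0 for b, c, d trades b for d; in [three_alg], [W0] is the term with h and [W1],
    [W2], [Wb] are the products of g along b, c, d. *)
Lemma relII1_move f g h k a b c d : null3 b c d -> relII0 g k ->
  relII1_at f g h k a b c -> relII1_at f g h k a c d.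
Proof.
move=> [F fb fc fd] r0 r1.
have /C3P[[hb hc hd] [[pbc pbd pcd] _]] := F.
have n4 : (0 : C) != 4 by rewrite eq_sym pnatr_eq0.
have nz : generically (H k) (fun x => br_dot br b c x != 0).
  by apply: frame_generic => //; rewrite fb fc ?addr0 ?subr0 expr0n.
apply: generic_imp2 (generic_and r1 (r0 b c d F fb fc fd)) nz => x _ [E1 E2] n.
apply: (three_alg n _ _ _ E1 E2).
- exact: br_dotC.
- exact: br_dotC.
- have := br_dot_three b c d a x.
  by rewrite mulrC addrC.
Qed.

(** By [compat_orth] any two of the admissible vectors are equal, opposite or orthogonal, so
    [relII1_move] reaches every pair by exchanging one vector at a time. *)
Lemma relII1_all f g h k a b0 c0 : relII0 g k -> C3_frame a b0 c0 ->
  dot phi a = 1 -> dot phi b0 = 0 -> dot phi c0 = 0 -> relII1_at f g h k a b0 c0 ->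
  forall b c, C3_frame a b c -> dot phi b = 0 -> dot phi c = 0 -> relII1_at f g h k a b c.
Proof.
move=> r0 F0 fa fb0 fc0 r1.
have step b c d : C3_frame a b c -> C3_frame a c d -> dot phi b = 0 -> dot phi c = 0 -> dot phi d = 0 ->
    relII1_at f g h k a b c -> relII1_at f g h k a c d.
  move=> /C3P[[ha hb hc] [[pab pac pbc] [cab cac]]] /C3P[[_ _ hd] [[_ pad pcd] [_ cad]]] fb fc fd r.
  have [->|->|pbd] := compat_orth hb hd ha cab cad pab pad.
  - exact: relII1_swap.
  - by apply: relII1_N3; rewrite opprK; exact: relII1_swap.
  - apply: (relII1_move _ r0 r); split=> //; apply/C3P; split=> //; split=> //.
    by split; [apply: compat_trans cac|apply: compat_trans cad]; exact: compat_sym.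
have start c d : C3_frame a c d -> C3_frame a c0 c -> dot phi c = 0 -> dot phi d = 0 -> relII1_at f g h k a c d.
  move=> F F1 fc fd; apply: (step c0) => //; exact: (step b0).
move=> b c F fb fc.
have /C3P[[ha hc0' hc0] [[_ pac0 _] [_ cac0]]] := F0.
have /C3P[[_ hb hc] [[pab pac pbc] [cab cac]]] := F.
have [bE|bE|pcb] := compat_orth hc0 hb ha cac0 cab pac0 pab.
- by rewrite bE; rewrite bE in F; apply: (step b0) F _ _ _ _.
- apply: relII1_swap; apply: relII1_N3; apply: relII1_swap.
  have -> : - b = c0 by rewrite bE opprK.
  apply: (step b0) => //.
  have := C3_cycle (C3_N1 (C3_cycle F)); rewrite bE opprK => h1.
  exact: C3_cycle.
- apply: start => //; apply/C3P; split=> //; split=> //.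
Qed.

Lemma relII1_shift f g h k k' v a b c (pa pb pc qa qb qc : V) (l1 l2 l3 l4 l5 l6 : V -> C) :
  relII1_at f g h k a b c -> k' + dot phi v = k ->
  v - delta *: a = pa -> v + delta *: a = qa ->
  v - delta *: b = pb -> v + delta *: b = qb ->
  v - delta *: c = pc -> v + delta *: c = qc ->
  (forall x, dot (b + c) (x + v) = l1 x) -> (forall x, dot (b - c) (x + v) = l2 x) ->
  (forall x, dot (c + a) (x + v) = l3 x) -> (forall x, dot (c - a) (x + v) = l4 x) ->
  (forall x, dot (a + b) (x + v) = l5 x) -> (forall x, dot (a - b) (x + v) = l6 x) ->
  generically (H k') (fun x =>
    br (l1 x) * br (l2 x) * (f (x + pa) * h (x + qa))
  + br (l3 x) * br (l4 x) * (g (x + qb) * g (x + pb))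
  + br (l5 x) * br (l6 x) * (g (x + qc) * g (x + pc)) = 0).
Proof.
move=> r kk <- <- <- <- <- <- e1 e2 e3 e4 e5 e6.
have := generic_shift kk r.
by apply: generic_imp => x _; rewrite !addrA /br_dot e1 e2 e3 e4 e5 e6.
Qed.

Lemma relII1_unshift f g h k k' v a b c (pa pb pc qa qb qc : V) (l1 l2 l3 l4 l5 l6 : V -> C) :
  k' + dot phi v = k ->
  v - delta *: a = pa -> v + delta *: a = qa ->
  v - delta *: b = pb -> v + delta *: b = qb ->
  v - delta *: c = pc -> v + delta *: c = qc ->
  (forall x, dot (b + c) (x + v) = l1 x) -> (forall x, dot (b - c) (x + v) = l2 x) ->
  (forall x, dot (c + a) (x + v) = l3 x) -> (forall x, dot (c - a) (x + v) = l4 x) ->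
  (forall x, dot (a + b) (x + v) = l5 x) -> (forall x, dot (a - b) (x + v) = l6 x) ->
  generically (H k') (fun x =>
    br (l1 x) * br (l2 x) * (f (x + pa) * h (x + qa))
  + br (l3 x) * br (l4 x) * (g (x + qb) * g (x + pb))
  + br (l5 x) * br (l6 x) * (g (x + qc) * g (x + pc)) = 0) -> relII1_at f g h k a b c.
Proof.
move=> kk <- <- <- <- <- <- e1 e2 e3 e4 e5 e6 r.
have kk' : k + dot phi (- v) = k' by rewrite dotNr -kk addrK.
have := generic_shift kk' r; apply: generic_imp => x _.
by rewrite !addrA -e1 -e2 -e3 -e4 -e5 -e6 !subrK.
Qed.

(* For an orthonormal quadruple u, v, w, w' of type I, upv u v, lwv u v w, lwv u v w' is a
   frame of type II_1. *)
Definition upv u v : V := 2^-1 *: (phi + (u - v)).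
Definition lwv u v w : V := 2^-1 *: (phi - (u + v)) - w.

Definition typeI4 a b c d :=
  [/\ [/\ half a, half b, half c & half d],
      [/\ dot phi a = 2^-1, dot phi b = 2^-1, dot phi c = 2^-1 & dot phi d = 2^-1],
      [/\ compat a b, compat a c & compat a d] &
      [/\ dot a b = 0, dot a c = 0 & dot a d = 0] /\ [/\ dot b c = 0, dot b d = 0 & dot c d = 0]].

Lemma upv_frame i j m l : typeI4 i j m l ->
  [/\ C3_frame (upv i j) (lwv i j m) (lwv i j l), dot phi (upv i j) = 1,
      dot phi (lwv i j m) = 0 & dot phi (lwv i j l) = 0].
Proof.
move=> [[hi hj hm hl] [fi fj fm fl] [cij cim cil] [[pij pim pil] [pjm pjl pml]]].
have e := (hi.2, hj.2, hm.2, hl.2, fi, fj, fm, fl, pij, pim, pil, (pjm, pjl, pml), dot_phiphi R).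
have e' : [/\ dot i phi = 2^-1, dot j phi = 2^-1, dot m phi = 2^-1 & dot l phi = 2^-1] by rewrite !(dotC _ phi).
have e'' : [/\ dot j i = 0, dot m i = 0, dot l i = 0 & [/\ dot m j = 0, dot l j = 0 & dot l m = 0]].
  by rewrite (dotC j i) (dotC m i) (dotC l i) (dotC m j) (dotC l j) (dotC l m).
case: e' => ei ej em el; case: e'' => eji emi eli [emj elj elm].
pose E := (e, ei, ej, em, el, eji, emi, eli, emj, (elj, elm)).
have cjm : compat j m by apply: compat_trans cim; exact: compat_sym.
have cjl : compat j l by apply: compat_trans cil; exact: compat_sym.
have cml : compat m l by apply: compat_trans cil; exact: compat_sym.
have Pphi := P_phi R.
have Pij := compat_sum hi cij.
have lw w : half w -> dot phi w = 2^-1 -> dot i w = 0 -> dot j w = 0 -> half (lwv i j w).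
  move=> hw fw iw jw; split.
    rewrite (_ : _ *+ 2 = phi - (i + j) - w *+ 2); last by rewrite /lwv !mulr2n; veq.
    by apply: PB hw.1; exact: PB.
  by rewrite /lwv; dots; rewrite !(dotC w) !E hw.2 fw iw jw; field.
split; last 3 first.
- by rewrite /upv; dots; rewrite !E; field.
- by rewrite /lwv; dots; rewrite !E; field.
- by rewrite /lwv; dots; rewrite !E; field.
apply/C3P; split.
  split; [|exact: lw|exact: lw].
  split; last by rewrite /upv; dots; rewrite !E; field.
  rewrite (_ : _ *+ 2 = phi + (i - j)); last by rewrite /upv !mulr2n; veq.
  exact: PD.
split; first by split; rewrite /upv /lwv; dots; rewrite !E; field.
split.
  by rewrite /compat (_ : _ - _ = i + m); [exact: compat_sum|rewrite /upv /lwv; veq].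
by rewrite /compat (_ : _ - _ = i + l); [exact: compat_sum|rewrite /upv /lwv; veq].
Qed.

Lemma vsubD (d : C) u w p : u + w = p -> - (d *: u) - d *: w = - (d *: p).
Proof. by move=> <-; rewrite scalerDr opprD. Qed.
Lemma vsubB (d : C) u w p : u - w = p -> - (d *: u) + d *: w = - (d *: p).
Proof. by move=> <-; rewrite scalerBr opprB addrC. Qed.

Lemma root_alg (E Dlm Djl Dmj Sml Sjl Sjm Tij Tim Til Fj Fm Fl Gj Gm Gl Qml Qjl Qjm h : C) :
  Dlm != 0 -> Fj != 0 ->
  E * Dlm * (Fj * h) + Sjl * - Til * (Gm * Qjm) + Sjm * Tim * (Gl * Qjl) = 0 ->
  Sml * Dlm * (Fj * Gj) + Sjl * Djl * (Fm * Gm) + Sjm * Dmj * (Fl * Gl) = 0 ->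
  Tij * Dlm * (Fj * Qml) + Tim * Djl * (Fm * Qjl) + Til * Dmj * (Fl * Qjm) = 0 ->
  E * - Djl * (Fm * h) + Sml * - Til * (Gj * Qjm) + Sjm * Tij * (Gl * Qml) = 0.
Proof.
move=> n1 n2 E1 E2 E3; apply: (mulfI (mulf_neq0 n1 n2)); rewrite mulr0.
transitivity (- Djl * Fm * (E * Dlm * (Fj * h) + Sjl * - Til * (Gm * Qjm) + Sjm * Tim * (Gl * Qjl))
  - Til * Qjm * (Sml * Dlm * (Fj * Gj) + Sjl * Djl * (Fm * Gm) + Sjm * Dmj * (Fl * Gl))
  + Sjm * Gl * (Tij * Dlm * (Fj * Qml) + Tim * Djl * (Fm * Qjl) + Til * Dmj * (Fl * Qjm))).
  by ring.
by rewrite E1 E2 E3 !mulr0 subr0 addr0.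
Qed.

Lemma typeI4_dots i j m l : typeI4 i j m l ->
  [/\ [/\ dot i i = 1, dot j j = 1, dot m m = 1 & dot l l = 1],
      [/\ dot phi i = 2^-1, dot phi j = 2^-1, dot phi m = 2^-1 & dot phi l = 2^-1] /\
      [/\ dot i phi = 2^-1, dot j phi = 2^-1, dot m phi = 2^-1 & dot l phi = 2^-1],
      [/\ dot i j = 0, dot i m = 0, dot i l = 0 & [/\ dot j m = 0, dot j l = 0 & dot m l = 0]] &
      [/\ dot j i = 0, dot m i = 0, dot l i = 0 & [/\ dot m j = 0, dot l j = 0 & dot l m = 0]]].
Proof.
move=> [[hi hj hm hl] [fi fj fm fl] _ [[pij pim pil] [pjm pjl pml]]].
split.
- by split; [exact: hi.2|exact: hj.2|exact: hm.2|exact: hl.2].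
- by split; split; rewrite // dotC.
- by [].
- by split; rewrite ?(dotC j) ?(dotC m) ?(dotC l) //; split; rewrite ?(dotC m) ?(dotC l).
Qed.

Lemma typeI4_swap i j m l : typeI4 i j m l -> typeI4 i m j l.
Proof.
move=> [[hi hj hm hl] [fi fj fm fl] [c1 c2 c3] [[pij pim pil] [pjm pjl pml]]].
split; [by split|by split|by split|split; first by split].
by split; rewrite // dotC.
Qed.

Lemma typeI4_C3 i j m l : typeI4 i j m l -> C3_frame j m l.
Proof.
move=> [[hi hj hm hl] [fi fj fm fl] [c1 c2 c3] [[pij pim pil] [pjm pjl pml]]].
apply/C3P; split=> //; split=> //; split.
  by apply: compat_trans c2; exact: compat_sym.
by apply: compat_trans c3; exact: compat_sym.
Qed.

(** With h moved to x, relation II_1 for [upv i j] contains f at x - delta (phi + i - j). The two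
    type I frames [FR] and [FB] are translated so that both relations contain f at the same three
    points x - delta (phi + i - w), w = j, m, l. In [root_alg] the value for l cancels and that for
    j factors out, which leaves the one for m. *)
Lemma relII1_root f g h k i j m l : typeI4 i j m l -> relI f g (k - delta / 2) ->
  generically (H (k - delta)) (fun x => f x != 0) ->
  relII1_at f g h k (upv i j) (lwv i j m) (lwv i j l) ->
  relII1_at f g h k (upv i m) (lwv i m j) (lwv i m l).
Proof.
move=> F4 rI fn r1.
have [[nii njj nmm nll] [[fi fj fm fl] [ei ej em el]] [pij pim pil [pjm pjl pml]] [qji qmi qli [qmj qlj qlm]]] := typeI4_dots F4.
pose e := (nii, njj, nmm, nll, (fi, fj, fm, fl), (ei, ej, em, el), (pij, pim, pil, pjm, pjl, pml),
  (qji, qmi, qli, qmj, qlj, qlm), dot_phiphi R).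
have F4' := typeI4_swap F4.
have F3 := typeI4_C3 F4.
have /C3P[[[Pj2 _] [Pm2 _] [Pl2 _]] [_ [cjm cjl]]] := F3.
have cml : compat m l by apply: compat_trans cjl; exact: compat_sym.
have [[hi hj hm hl] _ [cij cim cil] _] := F4.
have Pphi := P_phi R.
have r1' := @relII1_shift f g h k (k + delta) (- (delta *: upv i j)) _ _ _
  (- (delta *: (phi + (i - j)))) (- (delta *: (phi - j - m))) (- (delta *: (phi - j - l)))
  0 (- (delta *: (i + m))) (- (delta *: (i + l)))
  (fun x => dot (phi - i - j - m - l) x) (fun x => dot l x - dot m x)
  (fun x => dot phi x - dot j x - dot l x - delta) (fun x => - (dot i x + dot l x - delta))
  (fun x => dot phi x - dot j x - dot m x - delta) (fun x => dot i x + dot m x - delta) r1.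
have {}r1' : generically (H (k + delta)) (fun x =>
   br (dot (phi - i - j - m - l) x) * br (dot l x - dot m x) *
     (f (x - delta *: (phi + (i - j))) * h (x + 0))
   + br (dot phi x - dot j x - dot l x - delta) * br (- (dot i x + dot l x - delta)) *
     (g (x - delta *: (i + m)) * g (x - delta *: (phi - j - m)))
   + br (dot phi x - dot j x - dot m x - delta) * br (dot i x + dot m x - delta) *
     (g (x - delta *: (i + l)) * g (x - delta *: (phi - j - l))) = 0).
  apply: r1'.
  8-13: by move=> x; rewrite /upv /lwv; dots; rewrite !e; field.
  - by rewrite /upv; dots; rewrite !e; field.
  - by apply: vsubD; rewrite /upv; veq.
  - by rewrite addrC subrr.
  - by apply: vsubD; rewrite /upv /lwv; veq.
  - by apply: vsubB; rewrite /upv /lwv; veq.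
  - by apply: vsubD; rewrite /upv /lwv; veq.
  - by apply: vsubB; rewrite /upv /lwv; veq.
have FR : C3_frame (2^-1 *: phi - j) (2^-1 *: phi - m) (2^-1 *: phi - l).
  have hh w : half w -> dot phi w = 2^-1 -> half (2^-1 *: phi - w).
    move=> hw fw; split; last by dots; rewrite (dotC w phi) fw hw.2 dot_phiphi; field.
    rewrite (_ : _ *+ 2 = phi - w *+ 2); last by rewrite !mulr2n; veq.
    exact: PB hw.1.
  apply/C3P; split; first by split; exact: hh.
  split; first by split; dots; rewrite !e; field.
  split; rewrite /compat.
    by rewrite (_ : _ - _ = m - j); [exact: compat_sym|veq].
  by rewrite (_ : _ - _ = l - j); [exact: compat_sym|veq].
have rR : generically (H (k + delta)) (fun x =>
   br (dot phi x - dot m x - dot l x - delta) * br (dot l x - dot m x) *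
     (f (x - delta *: (phi + (i - j))) * g (x - delta *: (i + j)))
   + br (dot phi x - dot j x - dot l x - delta) * br (dot j x - dot l x) *
     (f (x - delta *: (phi + (i - m))) * g (x - delta *: (i + m)))
   + br (dot phi x - dot j x - dot m x - delta) * br (dot m x - dot j x) *
     (f (x - delta *: (phi + (i - l))) * g (x - delta *: (i + l))) = 0).
  apply: (@relI_shift f g (k - delta / 2) (k + delta) (- (delta *: (2^-1 *: phi + i))) _ _ _
    (- (delta *: (phi + (i - j)))) (- (delta *: (phi + (i - m)))) (- (delta *: (phi + (i - l))))
    (- (delta *: (i + j))) (- (delta *: (i + m))) (- (delta *: (i + l)))
    (fun x => dot phi x - dot m x - dot l x - delta) (fun x => dot l x - dot m x)
    (fun x => dot phi x - dot j x - dot l x - delta) (fun x => dot j x - dot l x)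
    (fun x => dot phi x - dot j x - dot m x - delta) (fun x => dot m x - dot j x) rI _ FR).
  11-16: by move=> x; dots; rewrite !e; field.
  1-4: by dots; rewrite !e; field.
  - by apply: vsubD; veq.
  - by apply: vsubB; veq.
  - by apply: vsubD; veq.
  - by apply: vsubB; veq.
  - by apply: vsubD; veq.
  - by apply: vsubB; veq.
have FB : C3_frame (2^-1 *: (i - j + m + l)) (2^-1 *: (i + j - m + l)) (2^-1 *: (i + j + m - l)).
  apply/C3P; split.
    split; split; try by dots; rewrite !e; field.
    - rewrite (_ : _ *+ 2 = (i - j) + (m + l)); last by rewrite !mulr2n; veq.
      by apply: PD => //; exact: compat_sum.
    - rewrite (_ : _ *+ 2 = (i - m) + (j + l)); last by rewrite !mulr2n; veq.
      by apply: PD => //; exact: compat_sum.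
    - rewrite (_ : _ *+ 2 = (i - l) + (j + m)); last by rewrite !mulr2n; veq.
      by apply: PD => //; exact: compat_sum.
  split; first by split; dots; rewrite !e; field.
  split; rewrite /compat.
    by rewrite (_ : _ - _ = m - j); [exact: compat_sym|veq].
  by rewrite (_ : _ - _ = l - j); [exact: compat_sym|veq].
have rB : generically (H (k + delta)) (fun x =>
   br (dot i x + dot j x - delta) * br (dot l x - dot m x) *
     (f (x - delta *: (phi + (i - j))) * g (x - delta *: (phi - m - l)))
   + br (dot i x + dot m x - delta) * br (dot j x - dot l x) *
     (f (x - delta *: (phi + (i - m))) * g (x - delta *: (phi - j - l)))
   + br (dot i x + dot l x - delta) * br (dot m x - dot j x) *
     (f (x - delta *: (phi + (i - l))) * g (x - delta *: (phi - j - m))) = 0).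
  apply: (@relI_shift f g (k - delta / 2) (k + delta) (- (delta *: (phi + 2^-1 *: (i - j - m - l)))) _ _ _
    (- (delta *: (phi + (i - j)))) (- (delta *: (phi + (i - m)))) (- (delta *: (phi + (i - l))))
    (- (delta *: (phi - m - l))) (- (delta *: (phi - j - l))) (- (delta *: (phi - j - m)))
    (fun x => dot i x + dot j x - delta) (fun x => dot l x - dot m x)
    (fun x => dot i x + dot m x - delta) (fun x => dot j x - dot l x)
    (fun x => dot i x + dot l x - delta) (fun x => dot m x - dot j x) rI _ FB).
  11-16: by move=> x; dots; rewrite !e; field.
  1-4: by dots; rewrite !e; field.
  - by apply: vsubD; veq.
  - by apply: vsubB; veq.
  - by apply: vsubD; veq.
  - by apply: vsubB; veq.
  - by apply: vsubD; veq.
  - by apply: vsubB; veq.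
have fn' : generically (H (k + delta)) (fun x => f (x - delta *: (phi + (i - j))) != 0).
  by apply: (generic_shift _ fn); dots; rewrite !e; field.
have Dn : generically (H (k + delta)) (fun x => br (dot l x - dot m x) != 0).
  have := @lin_generic (l - m) 0 (k + delta).
  rewrite (_ : dot (l - m) (l - m) = 2); last by dots; rewrite !e; ring.
  rewrite (_ : dot phi (l - m) = 0); last by dots; rewrite !e subrr.
  rewrite expr0n mul0r pnatr_eq0 => /(_ isT).
  by apply: generic_imp => x _; rewrite addr0; dots.
apply: (@relII1_unshift f g h k (k + delta) (- (delta *: upv i m)) _ _ _
  (- (delta *: (phi + (i - m)))) (- (delta *: (phi - j - m))) (- (delta *: (phi - m - l)))
  0 (- (delta *: (i + j))) (- (delta *: (i + l)))
  (fun x => dot (phi - i - j - m - l) x) (fun x => - (dot j x - dot l x))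
  (fun x => dot phi x - dot m x - dot l x - delta) (fun x => - (dot i x + dot l x - delta))
  (fun x => dot phi x - dot j x - dot m x - delta) (fun x => dot i x + dot j x - delta)).
8-13: by move=> x; rewrite /upv /lwv; dots; rewrite !e; field.
- by rewrite /upv; dots; rewrite !e; field.
- by apply: vsubD; rewrite /upv; veq.
- by rewrite addrC subrr.
- by apply: vsubD; rewrite /upv /lwv; veq.
- by apply: vsubB; rewrite /upv /lwv; veq.
- by apply: vsubD; rewrite /upv /lwv; veq.
- by apply: vsubB; rewrite /upv /lwv; veq.
apply: generic_imp2 (generic_and r1' (generic_and rR rB)) (generic_and fn' Dn) => x _ [E1 [E2 E3]] [n1 n2].
rewrite (br_odd (dot i x + dot l x - delta)) in E1; rewrite !br_odd.
exact: (root_alg n2 n1 E1 E2 E3).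
Qed.

(** * Relations I and II_2 for the next component *)

Lemma relI_next_alg (E F0 cjk cki cij sij sjk ski qi qj qk Gi Gj Gk hi hj hk Pij Pik Pjk : C) :
  E != 0 -> F0 != 0 ->
  E * - cjk * (F0 * hi) + qk * - ski * (Gj * Pij) + qj * sij * (Gk * Pik) = 0 ->
  E * - cki * (F0 * hj) + qi * - sij * (Gk * Pjk) + qk * sjk * (Gi * Pij) = 0 ->
  E * - cij * (F0 * hk) + qj * - sjk * (Gi * Pik) + qi * ski * (Gj * Pjk) = 0 ->
  sjk * cjk * (Gi * hi) + ski * cki * (Gj * hj) + sij * cij * (Gk * hk) = 0.
Proof.
move=> n1 n2 E1 E2 E3; apply: (mulfI (mulf_neq0 n1 n2)); rewrite mulr0.
transitivity (- (sjk * Gi * (E * - cjk * (F0 * hi) + qk * - ski * (Gj * Pij) + qj * sij * (Gk * Pik))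
  + ski * Gj * (E * - cki * (F0 * hj) + qi * - sij * (Gk * Pjk) + qk * sjk * (Gi * Pij))
  + sij * Gk * (E * - cij * (F0 * hk) + qj * - sjk * (Gi * Pik) + qi * ski * (Gj * Pjk)))).
  by ring.
by rewrite E1 E2 E3 !mulr0 !addr0 oppr0.
Qed.

Lemma vsubB' (d : C) u w p : w - u = p -> - (d *: u) + d *: w = d *: p.
Proof. by move=> <-; rewrite scalerBr addrC. Qed.

Lemma typeI4_fourth a b c : C3_frame a b c -> dot phi a = 2^-1 -> dot phi b = 2^-1 ->
  dot phi c = 2^-1 -> exists d, typeI4 a b c d.
Proof.
move=> F fa fb fc; have [d [hd fd cd [z1 z2 z3]]] := fourth_vector F fa fb fc.
have /C3P[[ha hb hc] [[pab pac pbc] [cab cac]]] := F.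
by exists d; split; [by split|by split|by split|split; by split].
Qed.

Lemma typeI4_perm i j m l : typeI4 i j m l -> typeI4 j m i l /\ typeI4 i l j m /\ typeI4 i j l m.
Proof.
move=> [[hi hj hm hl] [fi fj fm fl] [c1 c2 c3] [[pij pim pil] [pjm pjl pml]]].
split; [|split].
- split; [by split|by split| |].
    split; [|exact: compat_sym|]; [apply: compat_trans c2|apply: compat_trans c3]; exact: compat_sym.
  by split; split; rewrite // dotC.
- by split; [by split|by split|by split|split; split; rewrite // dotC].
- by split; [by split|by split|by split|split; split; rewrite // dotC].
Qed.

(* Relation II_1 for the frame upv i m, lwv i m j, lwv i m n, translated so that h is taken at
   y + delta i. *)
Lemma relI_next_step f g h k i j n m : typeI4 i j n m -> relII1 f g h k ->
  generically (H (k + delta / 2)) (fun y =>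
    br (dot phi y - dot i y - dot j y - dot n y - dot m y - delta / 2) * - br (dot j y - dot n y) *
      (f (y - delta *: (phi - m)) * h (y + delta *: i))
  + br (dot phi y - dot m y - dot n y - delta / 2) * - br (dot n y + dot i y) *
      (g (y - delta *: j) * g (y - delta *: (phi - (i + j + m))))
  + br (dot phi y - dot m y - dot j y - delta / 2) * br (dot i y + dot j y) *
      (g (y - delta *: n) * g (y - delta *: (phi - (i + n + m)))) = 0).
Proof.
move=> F4 r1.
have [[nii njj nnn nmm] [[fi fj fn fm] [ei ej en em]] [pij pin pim [pjn pjm pnm]] [qji qni qmi [qnj qmj qmn]]] := typeI4_dots F4.
pose e := (nii, njj, nmm, nnn, (fi, fj, fm, fn), (ei, ej, em, en), (pij, pim, pin, pjm, pjn, pnm),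
  (qji, qmi, qni, qmj, qnj, qmn), dot_phiphi R).
have [_ [T1 _]] := typeI4_perm F4.
have [F fa fb fc] := upv_frame T1.
suff : generically (H (k + delta / 2)) (fun y =>
    br (dot phi y - dot i y - dot j y - dot n y - dot m y - delta / 2) * br (- (dot j y - dot n y)) *
      (f (y - delta *: (phi - m)) * h (y + delta *: i))
  + br (dot phi y - dot m y - dot n y - delta / 2) * br (- (dot n y + dot i y)) *
      (g (y - delta *: j) * g (y - delta *: (phi - (i + j + m))))
  + br (dot phi y - dot m y - dot j y - delta / 2) * br (dot i y + dot j y) *
      (g (y - delta *: n) * g (y - delta *: (phi - (i + n + m)))) = 0).
  by apply: generic_imp => y _; rewrite !br_odd.
have [v vE] : exists v, v = - (delta *: (2^-1 *: (phi - (i + m)))) by eexists.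
apply: (@relII1_shift f g h k (k + delta / 2) v _ _ _
  (- (delta *: (phi - m))) (- (delta *: (phi - (i + j + m)))) (- (delta *: (phi - (i + n + m))))
  (delta *: i) (- (delta *: j)) (- (delta *: n))
  (fun y => dot phi y - dot i y - dot j y - dot n y - dot m y - delta / 2)
  (fun y => - (dot j y - dot n y))
  (fun y => dot phi y - dot m y - dot n y - delta / 2) (fun y => - (dot n y + dot i y))
  (fun y => dot phi y - dot m y - dot j y - delta / 2) (fun y => dot i y + dot j y)
  (r1 _ _ _ F fa fb fc)).
8-13: by move=> x; rewrite vE /upv /lwv; dots; rewrite !e; field.
- by rewrite vE; dots; rewrite !e; field.
- by rewrite vE; apply: vsubD; rewrite /upv; veq.
- by rewrite vE; apply: vsubB'; rewrite /upv; veq.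
- by rewrite vE; apply: vsubD; rewrite /lwv; veq.
- by rewrite vE; apply: vsubB; rewrite /lwv; veq.
- by rewrite vE; apply: vsubD; rewrite /lwv; veq.
- by rewrite vE; apply: vsubB; rewrite /lwv; veq.
Qed.

(** The vector m completing i, j, n to an orthonormal quadruple makes f (y - delta (phi - m)) common
    to the three relations II_1; the remaining products of g cancel in pairs. *)
Lemma relI_next f g h k : relII1 f g h k -> generically (H (k - delta)) (fun x => f x != 0) ->
  relI g h (k + delta / 2).
Proof.
move=> r1 fn i j n F fi fj fn'.
have [m T] := typeI4_fourth F fi fj fn'.
have [T2 _] := typeI4_perm T; have [T3 _] := typeI4_perm T2.
have s1 := relI_next_step T r1; have s2 := relI_next_step T2 r1; have s3 := relI_next_step T3 r1.
have [[nii njj nnn nmm] [[_ _ _ fm] _] [pij pin pim [pjn pjm pnm]] [qji qni qmi [qnj qmj qmn]]] := typeI4_dots T.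
have f0 : generically (H (k + delta / 2)) (fun y => f (y - delta *: (phi - m)) != 0).
  by apply: (generic_shift _ fn); dots; rewrite fm dot_phiphi; field.
have En : generically (H (k + delta / 2)) (fun y =>
    br (dot phi y - dot i y - dot j y - dot n y - dot m y - delta / 2) != 0).
  have := @lin_generic (phi - i - j - n - m) (- (delta / 2)) (k + delta / 2).
  rewrite (_ : dot (phi - i - j - n - m) (phi - i - j - n - m) = 2); last first.
    dots; rewrite (dotC i phi) (dotC j phi) (dotC n phi) (dotC m phi) dot_phiphi fi fj fn' fm.
    by rewrite pij pin pim pjn pjm pnm qji qni qmi qnj qmj qmn nii njj nnn nmm; field.
  rewrite (_ : dot phi (phi - i - j - n - m) = 0); last by dots; rewrite dot_phiphi fi fj fn' fm; field.
  rewrite expr0n mul0r pnatr_eq0 => /(_ isT).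
  by apply: generic_imp => x _; dots.
apply: generic_imp2 (generic_and s1 (generic_and s2 s3)) (generic_and f0 En) => y _ [E1 [E2 E3]] [n1 n2].
rewrite /br_dot !dotDl !dotNl.
have e2 : dot phi y - dot j y - dot n y - dot i y - dot m y - delta / 2 =
  dot phi y - dot i y - dot j y - dot n y - dot m y - delta / 2 by ring.
have e3 : dot phi y - dot n y - dot i y - dot j y - dot m y - delta / 2 =
  dot phi y - dot i y - dot j y - dot n y - dot m y - delta / 2 by ring.
rewrite e2 in E2; rewrite e3 in E3.
have a1 : j + i + m = i + j + m by rewrite (addrC j).
have a2 : n + i + m = i + n + m by rewrite (addrC n).
have a3 : n + j + m = j + n + m by rewrite (addrC n).
rewrite a1 in E2; rewrite a2 a3 in E3.
exact: (relI_next_alg n2 n1 E1 E2 E3).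
Qed.

(** A null vector d congruent and orthogonal to c is also orthogonal to a and b, since (phi|d) = 0
    rules out d = +-a and d = +-b. Relations II_1 for (a, c, d) and (b, c, d) then combine by the
    three-term identity. *)
Lemma relII2_of f g h k : relII1 f g h k -> relII2 f g h k.
Proof.
move=> r1 a b c F fa fb fc.
have /C3P[[ha hb hc] [[pab pac pbc] [cab cac]]] := F.
have [d [hd fd ccd pcd]] := null_partner hc fc.
have cbc : compat b c by apply: compat_trans cac; exact: compat_sym.
have cad := compat_trans cac ccd; have cbd := compat_trans cbc ccd.
have n10 : (1 : C) <> 0 by apply/eqP; rewrite oner_eq0.
have orth e : half e -> dot phi e = 1 -> compat e c -> compat e d -> dot e c = 0 -> dot e d = 0.
  move=> he fe cec ced pec.
  have [eE|eE|//] := compat_orth he hd hc (compat_sym cec) ccd (etrans (dotC _ _) pec) pcd.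
  - by move: fd; rewrite eE fe => /n10.
  - by exfalso; move: fd; rewrite eE dotNr fe => /eqP; rewrite oppr_eq0 oner_eq0.
have pad := orth a ha fa cac cad pac.
have pbd := orth b hb fb cbc cbd pbc.
have Fa : C3_frame a c d by apply/C3P.
have Fb : C3_frame b c d by apply/C3P.
have nz : generically (H k) (fun x => br_dot br c d x != 0).
  have n4 : (0 : C) != 4 by rewrite eq_sym pnatr_eq0.
  by apply: frame_generic => //; rewrite fc fd ?addr0 ?subr0 expr0n.
apply: generic_imp2 (generic_and (r1 _ _ _ Fa fa fc fd) (r1 _ _ _ Fb fb fc fd)) nz => x _ [E1 E2] n.
set W0 := f _ * _ in E1 *; set W1 := f _ * _ in E2 *.
move: E1 E2.
set W2 := g _ * _; set W3 := g _ * _ => E1 E2.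
apply: (mulfI n); rewrite mulr0.
have T := br_dot_three a b c d x.
transitivity (br_dot br b c x * (br_dot br c d x * W0 + br_dot br d a x * W2 + br_dot br a c x * W3)
  + br_dot br c a x * (br_dot br c d x * W1 + br_dot br d b x * W2 + br_dot br b c x * W3)
  - W2 * (br_dot br b c x * br_dot br d a x + br_dot br c a x * br_dot br d b x + br_dot br a b x * br_dot br d c x)).
  by rewrite (br_dotC c a) (br_dotC d c); ring.
by rewrite E1 E2 T !mulr0 addr0 subr0.
Qed.

(** * The base frame *)

Definition ev (n : nat) : V := delta_mx 0 (inord n).

Lemma dot_ev n v : dot (ev n) v = v 0 (inord n).
Proof.
rewrite /dot (bigD1 (inord n)) //= !mxE !eqxx mul1r big1 ?addr0 // => i /negbTE ni.
by rewrite !mxE ni mul0r.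
Qed.

Lemma ev_half n : half (ev n).
Proof.
split; last by rewrite dot_ev mxE !eqxx.
split; last by exists 1; rewrite dotC dotMnl dot_ev mxE mulr2n; field.
left=> i; exists ((i == inord n)%:R *+ 2); rewrite !mulr2n !mxE eqxx /= intrD.
by case: (i == _).
Qed.

Lemma ev_compat (n m : nat) : compat (ev n) (ev m).
Proof.
split; last by exists 0; rewrite dotC dotBl !dot_ev !mxE subrr.
left=> i; exists ((i == inord n)%:R - (i == inord m)%:R); rewrite !mxE eqxx /= intrB.
by case: (i == _); case: (i == _).
Qed.

Lemma ev_orth (n m : nat) : (n < 8)%N -> (m < 8)%N -> n != m -> dot (ev n) (ev m) = 0.
Proof.
move=> n8 m8 nm; rewrite dot_ev mxE eqxx /=.
have -> : (inord n == inord m :> 'I_8) = false.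
  by apply/negbTE; apply: contra nm => /eqP/(congr1 val); rewrite /= !inordK // => ->.
by [].
Qed.

Lemma ev_typeI4 : typeI4 (ev 0) (ev 1) (ev 2) (ev 3).
Proof.
split.
- by split; exact: ev_half.
- by split; rewrite dotC dot_ev mxE.
- by split; exact: ev_compat.
- by split; split; exact: ev_orth.
Qed.

Definition base_a := upv (ev 0) (ev 1).
Definition base_b := lwv (ev 0) (ev 1) (ev 2).
Definition base_c := lwv (ev 0) (ev 1) (ev 3).

Lemma base_frame : [/\ C3_frame base_a base_b base_c, dot phi base_a = 1,
  dot phi base_b = 0 & dot phi base_c = 0].
Proof. exact: upv_frame ev_typeI4. Qed.

(** Ties the base frame to the root from which [root_connected] starts. *)
Lemma base_aE : base_a = 2^-1 *: (phi + E R zroot0).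
Proof.
rewrite /base_a /upv; congr (_ *: (_ + _)); apply/rowP => i; rewrite E_zroot0 !mxE eqxx /=.
have q (n : nat) : (n < 8)%N -> (i == inord n) = (nat_of_ord i == n).
  by move=> n8; rewrite -(inj_eq val_inj) /= inordK.
by rewrite !q.
Qed.

Lemma relII1_full f g h k : relI f g (k - delta / 2) ->
  generically (H (k - delta)) (fun x => f x != 0) ->
  relII1_at f g h k base_a base_b base_c -> relII1 f g h k.
Proof.
move=> rI fn r1.
have r0 := relII0_of_relI rI fn.
suff S a : half a -> dot phi a = 1 -> forall b c, C3_frame a b c ->
    dot phi b = 0 -> dot phi c = 0 -> relII1_at f g h k a b c.
  by move=> a b c F fa fb fc; have /C3P[[ha _ _] _] := F; exact: S.
move: a; apply: root_connected.
  rewrite -base_aE; have [F fa fb fc] := base_frame.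
  exact: (relII1_all r0 F fa fb fc r1).
move=> u v w F fu fv fw Suv.
have [d T] := typeI4_fourth F fu fv fw.
have [F1 _ fb1 fc1] := upv_frame T.
have [F2 fa2 fb2 fc2] := upv_frame (typeI4_swap T).
apply: (relII1_all r0 F2 fa2 fb2 fc2).
apply: (relII1_root T rI fn).
exact: (Suv _ _ F1 fb1 fc1).
Qed.

Lemma solve_alg (B F0 G h : C) : F0 != 0 -> B != 0 -> B * (F0 * h) + G = 0 <-> h = - G / (B * F0).
Proof.
move=> n1 n2; split=> [e|->]; last by field; rewrite n1 n2.
have n12 := mulf_neq0 n2 n1.
by apply: (mulIf n12); rewrite divfK // -[RHS]addr0 -e; ring.
Qed.

(** * Vanishing components and the level omega *)

Lemma zero_shift f k k' v : k' + dot phi v = k -> eq_mero (H k) f (fun=> 0) ->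
  generically (H k') (fun x => f (x + v) = 0).
Proof. exact: generic_shift. Qed.

Lemma relI_zero f g k : eq_mero (H (k - delta / 2)) f (fun=> 0) -> relI f g k.
Proof.
move=> f0 a b c _ fa fb fc.
have s e : dot phi e = 2^-1 -> generically (H k) (fun x => f (x - delta *: e) = 0).
  by move=> fe; apply: (zero_shift _ f0); rewrite dotNr dotZr fe.
apply: generic_imp2 (generic_and (s _ fa) (s _ fb)) (s _ fc) => x _ [-> ->] ->.
by rewrite !mul0r !mulr0 !addr0.
Qed.

Lemma zero_pm g k e : eq_mero (H k) g (fun=> 0) -> dot phi e = 0 ->
  generically (H k) (fun x => g (x + delta *: e) = 0).
Proof. by move=> g0 fe; apply: (zero_shift _ g0); rewrite dotZr fe mulr0 addr0. Qed.

Lemma relII0_zero g k : eq_mero (H k) g (fun=> 0) -> relII0 g k.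
Proof.
move=> g0 a b c _ fa fb fc.
apply: generic_imp2 (generic_and (zero_pm g0 fa) (zero_pm g0 fb)) (zero_pm g0 fc) => x _ [-> ->] ->.
by rewrite !mul0r !mulr0 !addr0.
Qed.

Lemma zero_unit f k e : eq_mero (H (k - delta)) f (fun=> 0) -> dot phi e = 1 ->
  generically (H k) (fun x => f (x - delta *: e) = 0).
Proof. by move=> f0 fe; apply: (zero_shift _ f0); rewrite dotNr dotZr fe mulr1. Qed.

Lemma relII1_zero f g h k : eq_mero (H (k - delta)) f (fun=> 0) ->
  eq_mero (H k) g (fun=> 0) -> relII1 f g h k.
Proof.
move=> f0 g0 a b c _ fa fb fc.
apply: generic_imp2 (generic_and (zero_unit f0 fa) (zero_pm g0 fb)) (zero_pm g0 fc) => x _ [-> ->] ->.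
by rewrite !mul0r !mulr0 !addr0.
Qed.

Lemma relII2_zero f g h k : eq_mero (H (k - delta)) f (fun=> 0) ->
  eq_mero (H k) g (fun=> 0) -> relII2 f g h k.
Proof.
move=> f0 g0 a b c _ fa fb fc.
apply: generic_imp2 (generic_and (zero_unit f0 fa) (zero_unit f0 fb)) (zero_pm g0 fc) => x _ [-> ->] ->.
by rewrite !mul0r !mulr0 !addr0.
Qed.

Lemma relII2_root f g h k : br k = 0 -> eq_mero (H (k - delta)) f (fun=> 0) -> relII2 f g h k.
Proof.
move=> bk f0 a b c F fa fb _.
apply: generic_imp2 (zero_unit f0 fa) (zero_unit f0 fb) => x xk -> ->.
have -> : br_dot br a b x = 0.
  by rewrite /br_dot (frame_sum_phi F fa fb) (xk : dot phi x = k) bk mul0r.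
by rewrite !mul0r !mulr0 !addr0.
Qed.

(** Since f vanishes, h drops out of relation II_1, and what remains is the ratio hypothesis cleared
    of denominators. *)
Lemma relII1_of_ratio h f g k : generically (H k) (fun x => g x != 0) ->
  eq_mero (H (k - delta)) f (fun=> 0) ->
  (forall a0 a1 a2, C3_frame_II1 a0 a1 a2 ->
     dot phi a0 = 1 -> dot phi a1 = 0 -> dot phi a2 = 0 ->
     eq_mero (H k) (fun x => tau_pm delta g a1 x / tau_pm delta g a2 x)
       (fun x => br_dot br a0 a1 x / br_dot br a0 a2 x)) -> relII1 f g h k.
Proof.
move=> gn f0 ratio a b c F fa fb fc.
have F' : C3_frame_II1 a b c.
  by split=> //=; rewrite !dotNr fa fb fc oppr0.
have gn' v : dot phi v = 0 -> generically (H k) (fun x => g (x + v) != 0).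
  by move=> fv; apply: (generic_shift _ gn); rewrite fv addr0.
have [f1 f2] : dot phi (delta *: c) = 0 /\ dot phi (- (delta *: c)) = 0.
  by rewrite dotNr dotZr fc mulr0 oppr0.
have [[ha _ hc] [[_ ac _] _]] := (C3P a b c).1 F.
have n4 : (1 : C) != 4 by rewrite eq_sym -subr_eq0 -(natrB _ (isT : (1 <= 4)%N)) pnatr_eq0.
have B : generically (H k) (fun x => br_dot br a c x != 0).
  by apply: frame_generic => //; rewrite fa fc ?addr0 ?subr0 expr1n.
apply: generic_imp2 (generic_and (ratio a b c F' fa fb fc) (zero_unit f0 fa))
  (generic_and B (generic_and (gn' _ f1) (gn' _ f2))) => x _ [+ ->] [n1 [n2 n3]].
rewrite /tau_pm => /eqP; rewrite (eqr_div _ _ (mulf_neq0 n2 n3) n1) => /eqP e.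
by rewrite (br_dotC a c) mul0r mulr0 add0r mulNr [X in - X]mulrC e addNr.
Qed.

(** With f = 0 nothing can be cancelled as in [relII0_of_relI]. Instead, for a unit vector e with
    (phi|e) = 1 orthogonal to a, b, c, relations II_1 for (e, b, c) and (e, a, c) lose their first
    terms and combine by the three-term identity. *)
Lemma relII0_of_relII1 f g h k : eq_mero (H (k - delta)) f (fun=> 0) ->
  relII1 f g h k -> relII0 g k.
Proof.
move=> f0 r1 a b c F fa fb fc.
have [[ha hb hc] [[pab pac pbc] [cab cac]]] := (C3P a b c).1 F.
have [e [he fe cae pae]] := unit_partner ha fa.
have orth u : half u -> dot phi u = 0 -> compat a u -> dot a u = 0 -> dot e u = 0.
  move=> hu fu cau pau; have [uE|uE|//] := compat_orth he hu ha cae cau pae pau.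
  - by move/eqP: fu; rewrite uE fe oner_eq0.
  - by move/eqP: fu; rewrite uE dotNr fe oppr_eq0 oner_eq0.
have peb := orth b hb fb cab pab; have pec := orth c hc fc cac pac.
have cea := compat_sym cae.
have Fec : C3_frame e b c.
  by apply/C3P; split=> //; split=> //; split; [exact: compat_trans cea cab|exact: compat_trans cea cac].
have Fea : C3_frame e a c.
  by apply/C3P; split=> //; split; [rewrite dotC|split=> //; exact: compat_trans cea cac].
have n4 : (1 : C) != 4 by rewrite eq_sym -subr_eq0 -(natrB _ (isT : (1 <= 4)%N)) pnatr_eq0.
have B : generically (H k) (fun x => br_dot br e c x != 0).
  by apply: frame_generic => //; rewrite fe fc ?addr0 ?subr0 expr1n.
apply: generic_imp2 (generic_and (r1 _ _ _ Fec fe fb fc) (r1 _ _ _ Fea fe fa fc))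
  (generic_and B (zero_unit f0 fe)) => x _ [E1 E2] [n e0].
move: E1 E2; rewrite e0 mul0r !mulr0 !add0r => E1 E2; apply: (mulfI n); rewrite mulr0.
have T := br_dot_three a b c e x.
set Wa := g (x + delta *: a) * _ in E2 *; set Wb := g (x + delta *: b) * _ in E1 *.
set Wc := g (x + delta *: c) * _ in E1 E2 *.
transitivity (Wc * (br_dot br b c x * br_dot br e a x + br_dot br c a x * br_dot br e b x
    + br_dot br a b x * br_dot br e c x)
  - br_dot br b c x * (br_dot br c e x * Wa + br_dot br e a x * Wc)
  - br_dot br c a x * (br_dot br c e x * Wb + br_dot br e b x * Wc)).
  by rewrite (br_dotC e c); ring.
by rewrite T E1 E2 !mulr0 !subr0.
Qed.

(** * The recursive construction *)

Section Frame.
Variables a b c : V.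
Hypotheses (Fabc : C3_frame a b c) (fa : dot phi a = 1) (fb : dot phi b = 0) (fc : dot phi c = 0).

(* Solves relation II_1 for h.  Since x / 0 = 0, the result is 0 where f vanishes. *)
Definition next_tau f g : V -> C := fun z =>
  - (br_dot br c a (z - delta *: a) *
      (g (z - delta *: a + delta *: b) * g (z - delta *: a - delta *: b))
   + br_dot br a b (z - delta *: a) *
      (g (z - delta *: a + delta *: c) * g (z - delta *: a - delta *: c)))
  / (br_dot br b c (z - delta *: a) * f (z - delta *: a - delta *: a)).

Lemma frame_bc_generic k : generically (H k) (fun x => br_dot br b c x != 0).
Proof.
have [[ha hb hc] [[_ _ bc] _]] := (C3P a b c).1 Fabc.
have n4 : (0 : C) != 4 by rewrite eq_sym pnatr_eq0.
by apply: frame_generic => //; rewrite fb fc ?addr0 ?subr0 expr0n.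
Qed.

Lemma next_rel f g k : generically (H (k - delta)) (fun x => f x != 0) ->
  relII1_at f g (next_tau f g) k a b c.
Proof.
move=> fn.
have fn' : generically (H k) (fun x => f (x - delta *: a) != 0).
  by apply: (generic_shift _ fn); rewrite dotNr dotZr fa mulr1.
apply: generic_imp2 fn' (frame_bc_generic k) => x _ n1 n2.
by rewrite -addrA; apply/(solve_alg _ _ n1 n2); rewrite /next_tau addrK.
Qed.

Lemma next_uniq f g h k : generically (H (k - delta)) (fun x => f x != 0) ->
  relII1_at f g h k a b c -> eq_mero (H (k + delta)) h (next_tau f g).
Proof.
move=> fn r.
have fn' : generically (H k) (fun x => f (x - delta *: a) != 0).
  by apply: (generic_shift _ fn); rewrite dotNr dotZr fa mulr1.
have kk : k + delta + dot phi (- (delta *: a)) = k by rewrite dotNr dotZr fa mulr1 addrK.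
have := generic_shift kk (generic_and r (generic_and fn' (frame_bc_generic k))).
apply: generic_imp => z _; rewrite !subrK -addrA /next_tau => -[e [n1 n2]].
exact/(solve_alg _ _ n1 n2).
Qed.

Lemma br_dot_holomorphic u v : holomorphic_on setT (fun x : V => br_dot br u v x).
Proof.
have h w : holomorphic_on setT (fun x : V => br (dot w x)).
  by have := @br_dot_holo R br w 0 br_entire; under eq_fun do rewrite addr0.
by apply: holoM; exact: h.
Qed.

Lemma next_mero f g k : meromorphic_on (H (k - delta)) f -> meromorphic_on (H k) g ->
  meromorphic_on (H (k + delta)) (next_tau f g).
Proof.
move=> fm gm.
have bm u v := mero_holo (E := H k) (br_dot_holomorphic u v).
have sg v : dot phi v = 0 -> meromorphic_on (H k) (fun x => g (x + v)).
  by move=> fv; apply: (mero_shift _ gm); rewrite fv addr0.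
have fd u : dot phi u = 0 -> dot phi (delta *: u) = 0 /\ dot phi (- (delta *: u)) = 0.
  by move=> e; rewrite dotNr dotZr e mulr0 oppr0.
have [b1 b2] := fd _ fb; have [c1 c2] := fd _ fc.
have sf : meromorphic_on (H k) (fun x => f (x - delta *: a)).
  by apply: (mero_shift _ fm); rewrite dotNr dotZr fa mulr1.
have kk : k + delta + dot phi (- (delta *: a)) = k by rewrite dotNr dotZr fa mulr1 addrK.
have N : meromorphic_on (H k) (fun x =>
  - (br_dot br c a x * (g (x + delta *: b) * g (x - delta *: b))
   + br_dot br a b x * (g (x + delta *: c) * g (x - delta *: c)))).
  by apply/meroN/meroD; apply: meroM (bm _ _) _; apply: meroM; exact: sg.
have M := mero_div (@hyper_affine R k) N (meroM (bm b c) sf).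
exact: (mero_shift kk M).
Qed.

Lemma next_zero_r f g k : eq_mero (H k) g (fun=> 0) ->
  eq_mero (H (k + delta)) (next_tau f g) (fun=> 0).
Proof.
move=> g0.
have kk u : dot phi u = 0 -> k + delta + dot phi (- (delta *: a) + delta *: u) = k.
  by move=> e; rewrite dotDr dotNr !dotZr fa e; ring.
apply: generic_imp2 (generic_shift (kk _ fb) g0) (generic_shift (kk _ fc) g0) => z _.
by rewrite !addrA /next_tau => -> ->; rewrite !(mul0r, mulr0) addr0 oppr0 mul0r.
Qed.

Lemma next_eq f f' g g' k : eq_mero (H (k - delta)) f f' -> eq_mero (H k) g g' ->
  eq_mero (H (k + delta)) (next_tau f g) (next_tau f' g').
Proof.
move=> ff gg.
have kf : k + delta + dot phi (- (delta *: a) - delta *: a) = k - delta.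
  by rewrite dotBr dotNr dotZr fa mulr1; ring.
have kg s u : dot phi u = 0 -> k + delta + dot phi (- (delta *: a) + s *: u) = k.
  by move=> e; rewrite dotDr dotNr !dotZr fa e; ring.
have gs s u (fu : dot phi u = 0) := generic_shift (kg s u fu) gg.
apply: generic_imp2 (generic_and (generic_shift kf ff) (generic_and (gs delta b fb) (gs (- delta) b fb)))
  (generic_and (gs delta c fc) (gs (- delta) c fc)) => z _.
by rewrite !scaleNr !addrA /next_tau => -[-> [-> ->]] [-> ->].
Qed.

Section Tower.
Hypotheses (aE : a = base_a) (bE : b = base_b) (cE : c = base_c).

(** The implication from f = 0 to g = 0 excludes the case in which relation II_1 restricts g; it is
    handed on to the next level. *)
Lemma level_step f g k : meromorphic_on (H (k - delta)) f -> meromorphic_on (H k) g ->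
  relI f g (k - delta / 2) ->
  (eq_mero (H (k - delta)) f (fun=> 0) -> eq_mero (H k) g (fun=> 0)) ->
  [/\ relII0 g k, relII1 f g (next_tau f g) k, relII2 f g (next_tau f g) k &
   [/\ meromorphic_on (H (k + delta)) (next_tau f g), relI g (next_tau f g) (k + delta / 2) &
     eq_mero (H k) g (fun=> 0) -> eq_mero (H (k + delta)) (next_tau f g) (fun=> 0)]].
Proof.
move=> fm gm rI fg.
have hm := next_mero fm gm.
have gh := @next_zero_r f g k.
have [f0|fn] := mero_generic (@hyper_affine R (k - delta)) fm.
  have g0 := fg f0.
  split; [exact: relII0_zero|exact: relII1_zero|exact: relII2_zero|split=> //].
  by apply: relI_zero; rewrite addrK.
have r1 : relII1 f g (next_tau f g) k.
  apply: (relII1_full rI fn).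
  by rewrite -aE -bE -cE; exact: next_rel.
split; [exact: relII0_of_relI rI fn|exact: r1|exact: (relII2_of r1)|split=> //].
exact: (relI_next r1 fn).
Qed.

Variables (tau0 tau1 : V -> C) (omega : C).
Let K (n : int) : C := omega + n%:~R * delta.

Fixpoint tower_pair (n : nat) : (V -> C) * (V -> C) :=
  if n is m.+1 then ((tower_pair m).2, next_tau (tower_pair m).1 (tower_pair m).2) else (tau0, tau1).

Definition tower (n : int) : V -> C := if n is Posz m then (tower_pair m).1 else fun=> 0.

Hypothesis br_omega : br omega = 0.
Hypothesis tau0_mero : meromorphic_on (H omega) tau0.
Hypothesis tau1_mero : meromorphic_on (H (omega + delta)) tau1.
Hypothesis tau0_neq0 : ~ eq_mero (H omega) tau0 (fun=> 0).
Hypothesis tau0_ratio : forall a0 a1 a2, C3_frame_II1 a0 a1 a2 ->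
     dot phi a0 = 1 -> dot phi a1 = 0 -> dot phi a2 = 0 ->
     eq_mero (H omega) (fun x => tau_pm delta tau0 a1 x / tau_pm delta tau0 a2 x)
       (fun x => br_dot br a0 a1 x / br_dot br a0 a2 x).
Hypothesis tau01_relI : relI tau0 tau1 (omega + delta / 2).

Let KS n : K (n + 1) = K n + delta.
Proof. by rewrite /K intrD mulrDl mul1r addrA. Qed.

Let Ksucc (n : nat) : K n.+1 = K n + delta.
Proof. by rewrite -addn1 PoszD KS. Qed.

Let K0 : K 0 = omega.
Proof. by rewrite /K mul0r addr0. Qed.

Lemma tower_levels (n : nat) :
  [/\ meromorphic_on (H (K n)) (tower n), meromorphic_on (H (K n.+1)) (tower n.+1),
     relI (tower n) (tower n.+1) (K n + delta / 2) &
     eq_mero (H (K n)) (tower n) (fun=> 0) -> eq_mero (H (K n.+1)) (tower n.+1) (fun=> 0)].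
Proof.
(* At the start the implication between zeros is vacuous, by [tau0_neq0]. *)
elim: n => [|n [m1 m2 rI nz]]; first by rewrite Ksucc K0.
have kd : K n.+1 - delta = K n by rewrite Ksucc addrK.
rewrite -kd in m1 nz.
have rI' : relI (tower n) (tower n.+1) (K n.+1 - delta / 2).
  by rewrite (_ : _ - _ = K n + delta / 2) // -kd; field.
have [_ _ _ [hm hI hz]] := level_step m1 m2 rI' nz.
by rewrite (Ksucc n.+1).
Qed.

Lemma tower_relations (n : int) :
  [/\ relII0 (tower n) (K n), relII1 (tower (n - 1)) (tower n) (tower (n + 1)) (K n),
    relII2 (tower (n - 1)) (tower n) (tower (n + 1)) (K n) &
    relI (tower n) (tower (n + 1)) (K n + delta / 2)].
Proof.
have Z k m : m < 0 -> eq_mero (H k) (tower m) (fun=> 0).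
  by case: m => // m _; apply: generic_all.
case: n => [[|n]|n]; last first.
- split; [exact/relII0_zero/Z|apply: relII1_zero; exact: Z|apply: relII2_zero; exact: Z|exact/relI_zero/Z].
- have [m1 m2 rI nz] := tower_levels n.
  have [_ _ rI2 _] := tower_levels n.+1.
  have kd : K n.+1 - delta = K n by rewrite Ksucc addrK.
  rewrite -kd in m1 nz.
  have rI' : relI (tower n) (tower n.+1) (K n.+1 - delta / 2).
    by rewrite (_ : _ - _ = K n + delta / 2) // -kd; field.
  have [h0 h1 h2 _] := level_step m1 m2 rI' nz.
  have -> : n.+1%:Z - 1 = n%:Z by rewrite -addn1 PoszD addrK.
  by have -> : n.+1%:Z + 1 = n.+2%:Z by rewrite -PoszD addn1.
(* The level omega: the component below is 0 and [tau0] is not, so the ratio hypothesis and [omega]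
   = 0 replace [level_step]. *)
- have [_ _ rI _] := tower_levels 0.
  have t0n : generically (H omega) (fun x => tau0 x != 0).
    by have [|//] := mero_generic (@hyper_affine R omega) tau0_mero.
  have r1 h := relII1_of_ratio h t0n (Z (omega - delta) (-1) isT) tau0_ratio.
  rewrite K0 in rI *; split=> //.
  + exact: (relII0_of_relII1 (Z (omega - delta) (-1) isT) (r1 tau1)).
  + exact: relII2_root (Z _ (-1) isT).
Qed.

End Tower.
End Frame.

(** * From the hyperplanes to the ORG equations on D_omega *)

Section Gluing.
Hypothesis delta_neq0 : delta != 0.
Variable omega : C.
Local Notation D := (D_omega omega delta).
Let K (n : int) : C := omega + n%:~R * delta.

Definition org_at (tau : V -> C) (E : set V) a b c := eq_mero E
  (fun x => br_dot br b c x * tau_pm delta tau a x + br_dot br c a x * tau_pm delta tau b x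
            + br_dot br a b x * tau_pm delta tau c x) (fun=> 0).

Lemma org_at_cycle tau E a b c : org_at tau E b c a -> org_at tau E a b c.
Proof. by apply: generic_imp => x _ <-; ring. Qed.

Lemma org_at_N tau E a b c : org_at tau E (- a) b c -> org_at tau E a b c.
Proof.
apply: generic_imp => x _ <-; rewrite br_dotNr br_dotNl /tau_pm scalerN opprK.
by rewrite [tau (x - _) * _]mulrC.
Qed.

(** A frame is a set closed under sign; invariance under one sign change and cyclic permutations
    therefore allows the values of (phi|.) to be normalized. *)
Lemma frame_normalize (val : C -> Prop) (Q : V -> V -> V -> Prop) :
  (forall a b c, Q (- a) b c -> Q a b c) -> (forall a b c, Q b c a -> Q a b c) ->
  (forall a b c, C3_frame a b c -> val (dot phi a) -> val (dot phi b) -> val (dot phi c) -> Q a b c) ->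
  let sval (z : C) := val z \/ val (- z) in
  forall a b c, C3_frame a b c -> sval (dot phi a) -> sval (dot phi b) -> sval (dot phi c) -> Q a b c.
Proof.
move=> QN Qc Qv sval.
have step3 a b c : C3_frame a b c -> val (dot phi a) -> val (dot phi b) -> sval (dot phi c) -> Q a b c.
  move=> F va vb [vc|vc]; first exact: Qv.
  apply/Qc/Qc/QN/Qv; rewrite ?dotNr //.
  by apply: C3_N1; do 2!apply: C3_cycle.
have step2 a b c : C3_frame a b c -> val (dot phi a) -> sval (dot phi b) -> sval (dot phi c) -> Q a b c.
  move=> F va [vb|vb] vc; first exact: step3.
  apply/Qc/QN/Qc/Qc/step3; rewrite ?dotNr //.
  by do 2!apply: C3_cycle; apply: C3_N1; exact: C3_cycle.
move=> a b c F [va|va] vb vc; first exact: step2.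
by apply/QN/step2; rewrite ?dotNr //; exact: C3_N1.
Qed.

Lemma D_shift a (n : int) x : dot phi a = n%:~R -> D (x + delta *: a) <-> D x.
Proof.
move=> fa; split=> -[m]; rewrite /hyperplane /= ?dotDr ?dotZr ?fa => e.
  by exists (m - n); rewrite /hyperplane /= intrB mulrBl addrA -e; ring.
by exists (m + n); rewrite /hyperplane /= dotDr dotZr fa e intrD; ring.
Qed.

Lemma both_in_int a (n : int) : dot phi a = n%:~R -> both_in delta D a = D.
Proof.
move=> fa; have fa' : dot phi (- a) = (- n)%:~R by rewrite dotNr fa intrN.
apply/seteqP; split=> x; rewrite /both_in /= -scalerN.
  by move=> [/(D_shift _ fa)].
by move=> Dx; split; [apply/(D_shift _ fa)|apply/(D_shift _ fa')].
Qed.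

Lemma D_half a x : dot phi a = 2^-1 -> D (x + delta *: a) <-> D_omega (omega + delta / 2) delta x.
Proof.
move=> fa; split=> -[m]; rewrite /hyperplane /= ?dotDr ?dotZr ?fa => e.
  exists (m - 1); rewrite /hyperplane /= intrB mulrBl; apply: (addIr (delta / 2)).
  by rewrite e; field.
by exists (m + 1); rewrite /hyperplane /= dotDr dotZr fa e intrD; field.
Qed.

Lemma D_halfN a x : dot phi a = 2^-1 -> D (x - delta *: a) <-> D_omega (omega + delta / 2) delta x.
Proof.
move=> fa; split=> -[m]; rewrite /hyperplane /= ?dotDr ?dotNr ?dotZr ?fa => e.
  exists m; rewrite /hyperplane /=; apply: (addIr (- (delta / 2))).
  by rewrite e; field.
by exists m; rewrite /hyperplane /= dotDr dotNr dotZr fa e; field.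
Qed.

Lemma both_in_half a : dot phi a = 2^-1 -> both_in delta D a = D_omega (omega + delta / 2) delta.
Proof.
move=> fa; apply/seteqP; split=> x; first by move=> [/(D_half _ fa)].
by move=> Dx; split; [apply/(D_half _ fa)|apply/(D_halfN _ fa)].
Qed.

Definition org_frame (tau : V -> C) a b c :=
  org_at tau (both_in delta D a `&` both_in delta D b `&` both_in delta D c) a b c.

Lemma org_frame_cycle tau a b c : org_frame tau b c a -> org_frame tau a b c.
Proof.
rewrite /org_frame => h; apply: org_at_cycle.
by rewrite -setIA setIC.
Qed.

Lemma both_inN a : both_in delta D (- a) = both_in delta D a.
Proof. by apply/seteqP; split=> x; rewrite /both_in /= scalerN opprK => -[]; split. Qed.

Lemma org_frame_N tau a b c : org_frame tau (- a) b c -> org_frame tau a b c.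
Proof. by rewrite /org_frame both_inN; exact: org_at_N. Qed.

Definition zero_one (z : C) := z = 0 \/ z = 1.

Lemma zero_one_int (z : C) : zero_one z -> exists n : int, z = n%:~R.
Proof. by case=> ->; [exists 0|exists 1]. Qed.

Lemma org_frame_int tau a b c : zero_one (dot phi a) -> zero_one (dot phi b) ->
  zero_one (dot phi c) -> org_frame tau a b c <-> forall n, org_at tau (H (K n)) a b c.
Proof.
move=> /zero_one_int[i ia] /zero_one_int[j jb] /zero_one_int[l lc].
rewrite /org_frame (both_in_int ia) (both_in_int jb) (both_in_int lc) !setIid.
exact: iff_sym (generic_D _ delta_neq0 _).
Qed.

Section Relations.
Variables (T : int -> V -> C) (tau : V -> C).
Hypothesis tauE : forall n x, H (K n) x -> tau x = T n x.

Lemma org_of_relations : (forall n, [/\ relII0 (T n) (K n),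
     relII1 (T (n - 1)) (T n) (T (n + 1)) (K n),
     relII2 (T (n - 1)) (T n) (T (n + 1)) (K n) &
     relI (T n) (T (n + 1)) (K n + delta / 2)]) -> ORG_tau br delta D tau.
Proof.
move=> rel.
have t0 n a x : dot phi a = 0 -> H (K n) x -> tau_pm delta tau a x = T n (x + delta *: a) * T n (x - delta *: a).
  move=> fa Hx; rewrite /tau_pm; congr (_ * _); apply: tauE.
    by rewrite /hyperplane /= dotDr dotZr fa mulr0 addr0.
  by rewrite /hyperplane /= dotDr dotNr dotZr fa mulr0 oppr0 addr0.
have t1 n a x : dot phi a = 1 -> H (K n) x ->
    tau_pm delta tau a x = T (n - 1) (x - delta *: a) * T (n + 1) (x + delta *: a).
  move=> fa Hx; rewrite /tau_pm mulrC; congr (_ * _); apply: tauE; rewrite /hyperplane /=.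
    by rewrite dotDr dotNr dotZr fa (Hx : dot _ _ = _) /K intrB; ring.
  by rewrite dotDr dotZr fa (Hx : dot _ _ = _) /K intrD; ring.
have th n a x : dot phi a = 2^-1 -> H (K n + delta / 2) x ->
    tau_pm delta tau a x = T n (x - delta *: a) * T (n + 1) (x + delta *: a).
  move=> fa Hx; rewrite /tau_pm mulrC; congr (_ * _); apply: tauE; rewrite /hyperplane /=.
    by rewrite dotDr dotNr dotZr fa (Hx : dot _ _ = _) /K; field.
  by rewrite dotDr dotZr fa (Hx : dot _ _ = _) /K intrD; field.
have n01 : (0 : C) != 1 by rewrite eq_sym oner_eq0.
have org01 a b c : C3_frame a b c -> zero_one (dot phi a) -> zero_one (dot phi b) ->
    zero_one (dot phi c) -> org_frame tau a b c.
  have r0 u v w : C3_frame u v w -> dot phi u = 0 -> dot phi v = 0 -> dot phi w = 0 -> org_frame tau u v w.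
    move=> F fu fv fw; apply/org_frame_int; rewrite ?fu ?fv ?fw; [by left|by left|by left|].
    move=> n; have [r _ _ _] := rel n; apply: generic_imp (r _ _ _ F fu fv fw) => x Hx <-.
    by rewrite !(t0 n).
  have r1 u v w : C3_frame u v w -> dot phi u = 1 -> dot phi v = 0 -> dot phi w = 0 -> org_frame tau u v w.
    move=> F fu fv fw; apply/org_frame_int; rewrite ?fu ?fv ?fw; [by right|by left|by left|].
    move=> n; have [_ r _ _] := rel n; apply: generic_imp (r _ _ _ F fu fv fw) => x Hx <-.
    by rewrite (t1 n u) // (t0 n v) // (t0 n w).
  have r2 u v w : C3_frame u v w -> dot phi u = 1 -> dot phi v = 1 -> dot phi w = 0 -> org_frame tau u v w.
    move=> F fu fv fw; apply/org_frame_int; rewrite ?fu ?fv ?fw; [by right|by right|by left|].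
    move=> n; have [_ _ r _] := rel n; apply: generic_imp (r _ _ _ F fu fv fw) => x Hx <-.
    by rewrite (t1 n u) // (t1 n v) // (t0 n w).
  move=> F; have F1 := C3_cycle F; have F2 := C3_cycle F1.
  move=> [fa|fa] [fb|fb] [fc|fc].
  - exact: r0.
  - by do 2!apply: org_frame_cycle; exact: r1.
  - by apply: org_frame_cycle; exact: r1.
  - by apply: org_frame_cycle; exact: r2.
  - exact: r1.
  - by do 2!apply: org_frame_cycle; exact: r2.
  - exact: r2.
  (* Three values 1 would give a + b = phi = c + a, hence b = c. *)
  - exfalso; have /C3P[[_ hb _] [[_ _ pbc] _]] := F.
    have e := frame_sum_phi F fa fb; have := frame_sum_phi F2 fc fa.
    rewrite -e addrC => /addrI cb; move: pbc; rewrite cb hb.2 => /eqP.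
    by rewrite oner_eq0.
have orgh a b c : C3_frame a b c -> dot phi a = 2^-1 -> dot phi b = 2^-1 ->
    dot phi c = 2^-1 -> org_frame tau a b c.
  move=> F fa fb fc; rewrite /org_frame !both_in_half // !setIid; apply/generic_D => // n.
  have [_ _ _ r] := rel n.
  have kE : omega + delta / 2 + n%:~R * delta = K n + delta / 2 by rewrite addrAC.
  rewrite kE; apply: generic_imp (r _ _ _ F fa fb fc) => x Hx <-.
  by rewrite !(th n).
move=> a b c F.
have [[fa fb fc]|[i [j [l [ia jb lc s2]]]]] := frame_types F.
  have sq (z : C) : z ^+ 2 = 4^-1 -> z = 2^-1 \/ - z = 2^-1.
    move=> e; have : (z - 2^-1) * (- z - 2^-1) = 0.
      by rewrite (_ : _ * _ = 4^-1 - z ^+ 2); [rewrite e subrr|field].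
    by move=> /eqP; rewrite mulf_eq0 !subr_eq0 => /orP[] /eqP; [left|right].
  by apply: (frame_normalize (val := fun z : C => z = 2^-1) (@org_frame_N tau) (@org_frame_cycle tau) orgh F); exact: sq.
have sq (n : int) : n ^+ 2 <= 2 -> zero_one n%:~R \/ zero_one (- n%:~R).
  move=> n2; have : n = 0 \/ n = 1 \/ n = -1 by nia.
  move=> [->|[->|->]]; [by left; left|by left; right|right; right].
  by rewrite intrN opprK.
have si := sqr_ge0 i; have sj := sqr_ge0 j; have sl := sqr_ge0 l.
by apply: (frame_normalize (@org_frame_N tau) (@org_frame_cycle tau) org01 F);
  rewrite ?ia ?jb ?lc; apply: sq; lia.
Qed.

End Relations.

(** * Uniqueness *)

Section Uniqueness.
Variables a b c : V.
Hypotheses (Fabc : C3_frame a b c) (fa : dot phi a = 1) (fb : dot phi b = 0) (fc : dot phi c = 0).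
Variable tau : V -> C.
Hypothesis tau_org : ORG_tau br delta D tau.
Hypothesis tau_mero : meromorphic_on D tau.

Lemma org_relII1 n : relII1_at tau tau tau (K n) a b c.
Proof.
have /org_frame_int h : org_frame tau a b c := tau_org Fabc.
have := h _ _ _ n; rewrite fa fb fc => h'.
apply: generic_imp (h' (or_intror erefl) (or_introl erefl) (or_introl erefl)) => x _.
by rewrite /tau_pm [tau (x + delta *: a) * _]mulrC.
Qed.

(** The first two vectors add up to phi, so that one factor of their coefficient is [(phi|x)],
    constant on each hyperplane. *)
Lemma flip_frame : C3_frame a (phi - a) c.
Proof.
have [[ha hb hc] [[pab pac pbc] [cab cac]]] := (C3P a b c).1 Fabc.
have hp : half (phi - a).
  split; last by dots; rewrite dot_phiphi (dotC a phi) fa ha.2; ring.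
  by rewrite mulrnBl; apply: PB ha.1; rewrite mulr2n; apply: PD; exact: P_phi.
apply/C3P; split=> //; split.
  split=> //; first by dots; rewrite (dotC a phi) fa ha.2 subrr.
  by dots; rewrite fc pac subrr.
split=> //; rewrite /compat (_ : _ - _ = a *+ 2 - phi); last by rewrite mulr2n; veq.
by apply: PB ha.1 _; exact: P_phi.
Qed.

(** In relation II_2 for [flip_frame] the terms of a and phi - a contain values on [H (K n)] and
    vanish. The third term, [(phi|x)] [(2 a - phi|x)] tau(x +- delta c), would be generically
    nonzero if tau were so on the next hyperplane. *)
Lemma org_zero_step n : br (K (n + 1)) != 0 -> eq_mero (H (K n)) tau (fun=> 0) ->
  eq_mero (H (K (n + 1))) tau (fun=> 0).
Proof.
move=> bn t0.
have [//|tn] := mero_generic (@hyper_affine R _) ((mero_D _ delta_neq0 tau).2 tau_mero (n + 1)).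
have F := flip_frame; have fp : dot phi (phi - a) = 1 by rewrite dotBr dot_phiphi fa; ring.
have /org_frame_int h : org_frame tau a (phi - a) c := tau_org F.
have := h _ _ _ (n + 1); rewrite fa fp fc => h'.
have o := h' (or_intror erefl) (or_intror erefl) (or_introl erefl).
have t0' u : dot phi u = 1 -> generically (H (K (n + 1))) (fun x => tau (x - delta *: u) = 0).
  by move=> fu; apply: (generic_shift _ t0); rewrite dotNr dotZr fu /K intrD; ring.
have tn' s : generically (H (K (n + 1))) (fun x => tau (x + s *: c) != 0).
  by apply: (generic_shift _ tn); rewrite dotZr fc mulr0 addr0.
have B : generically (H (K (n + 1))) (fun x => br_dot br a (phi - a) x != 0).
  have [[ha _ _] _] := (C3P a b c).1 Fabc.
  have ne : dot (a - (phi - a)) (a - (phi - a)) != dot phi (a - (phi - a)) ^+ 2 / 2.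
    rewrite (_ : dot phi _ = 0); last by dots; rewrite dot_phiphi fa; ring.
    rewrite (_ : dot _ _ = 2) ?expr0n ?mul0r ?pnatr_eq0 //.
    by dots; rewrite dot_phiphi (dotC a phi) fa ha.2; ring.
  have := br_generic 0 (K (n + 1)) br_entire br_nonzero ne.
  apply: generic_imp => x Hx; rewrite addr0 => n1.
  by rewrite /br_dot mulf_neq0 // addrC subrK (Hx : dot phi x = _).
exfalso; apply: (generic_contra (hyper_point (K (n + 1))) (generic_and B (generic_and (tn' delta) (tn' (- delta))))).
apply: generic_imp2 o (generic_and (t0' _ fa) (t0' _ fp)) => x _ + [e1 e2] [n1 [n2 n3]].
rewrite /tau_pm e1 e2 !mulr0 !add0r; rewrite scaleNr in n3.
by move/eqP; apply/negP; exact: (mulf_neq0 n1 (mulf_neq0 n2 n3)).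
Qed.

End Uniqueness.
End Gluing.
End Relations.

(** * Existence and uniqueness of the hypergeometric function *)

Definition glue (R : realType) (omega delta : Cplx R) (T : int -> Vec R -> Cplx R) (x : Vec R) : Cplx R :=
  if pselect (exists n : int, hyperplane (omega + n%:~R * delta) x) is left e
  then T (projT1 (cid e)) x else 0.

Lemma glueE (R : realType) (omega delta : Cplx R) T (n : int) (x : Vec R) : delta != 0 ->
  hyperplane (omega + n%:~R * delta) x -> glue omega delta T x = T n x.
Proof.
move=> d0 Hx; rewrite /glue; case: pselect => [e|[]]; last by exists n.
by case: cid => m Hm /=; rewrite (H_inj d0 Hm Hx).
Qed.

Theorem theorem4p2 (R : realType) (br : Cplx R -> Cplx R)
    (br_entire : entire br)
    (br_nonzero : exists z, br z != 0)
    (br_three_term : three_term br)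
    (delta : Cplx R) (delta_neq0 : delta != 0)
    (delta_zeros : [set n%:~R * delta | n in [set: int]] `&` zeros br = [set 0])
    (omega : Cplx R) (omega_zero : zeros br omega)
    (tau0 tau1 : Vec R -> Cplx R)
    (tau0_mero : nonzero_meromorphic_on (hyperplane omega) tau0)
    (tau1_mero : nonzero_meromorphic_on (hyperplane (omega + delta)) tau1)
    (tau0_ratio : forall a0 a1 a2 : Vec R, C3_frame_II1 a0 a1 a2 ->
       dot (phi R) a0 = 1 -> dot (phi R) a1 = 0 -> dot (phi R) a2 = 0 ->
       eq_mero (hyperplane omega)
         (fun x => tau_pm delta tau0 a1 x / tau_pm delta tau0 a2 x)
         (fun x => br_dot br a0 a1 x / br_dot br a0 a2 x))
    (tau01_bilinear : forall a0 a1 a2 : Vec R, C3_frame a0 a1 a2 ->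
       dot (phi R) a0 = 2^-1 -> dot (phi R) a1 = 2^-1 -> dot (phi R) a2 = 2^-1 ->
       eq_mero (hyperplane (omega + delta / 2))
         (fun x =>
            br_dot br a1 a2 x * tau0 (x - delta *: a0) * tau1 (x + delta *: a0)
          + br_dot br a2 a0 x * tau0 (x - delta *: a1) * tau1 (x + delta *: a1)
          + br_dot br a0 a1 x * tau0 (x - delta *: a2) * tau1 (x + delta *: a2))
         (fun=> 0)) :
  exists tau : Vec R -> Cplx R,
    [/\ hypergeometric_tau br delta omega tau,
        eq_mero (hyperplane omega) tau0 tau,
        eq_mero (hyperplane (omega + delta)) tau1 tau &
        forall tau' : Vec R -> Cplx R,
          hypergeometric_tau br delta omega tau' ->
          eq_mero (hyperplane omega) tau0 tau' ->
          eq_mero (hyperplane (omega + delta)) tau1 tau' ->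
          eq_mero (D_omega omega delta) tau' tau].
Proof.
have br0 : br 0 = 0 by have : [set 0] (0 : Cplx R) by []; rewrite -delta_zeros => -[].
have brK (n : int) : n != 0 -> br (omega + n%:~R * delta) != 0.
  move=> n0; apply/eqP => bn.
  have := zeros_diff br_entire br_nonzero br_three_term br0 omega_zero bn.
  move=> bd; have : [set 0] (n%:~R * delta) by rewrite -delta_zeros; split=> //; exists n.
  by move=> /eqP; rewrite mulf_eq0 intr_eq0 (negbTE n0) (negbTE delta_neq0).
have [F fa fb fc] := base_frame R.
(* Naming the vectors through equations keeps the base frame from being unfolded. *)
have [a aE] : exists a, a = base_a R by eexists.
have [b bE] : exists b, b = base_b R by eexists.
have [c cE] : exists c, c = base_c R by eexists.
rewrite -aE -bE -cE in F fa fb fc.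
pose T := tower br delta a b c tau0 tau1.
have [m0 n0] := tau0_mero; have [m1 n1] := tau1_mero.
have rI : relI br delta tau0 tau1 (omega + delta / 2).
  move=> u v w Fu fu fv fw; apply: generic_imp (tau01_bilinear u v w Fu fu fv fw) => x _ <-.
  by rewrite !mulrA.
have K0 : omega + 0%:~R * delta = omega by rewrite mul0r addr0.
have K1 : omega + 1%:~R * delta = omega + delta by rewrite mul1r.
have KS (n : nat) : omega + n.+1%:~R * delta = omega + n%:~R * delta + delta.
  by rewrite -addn1 PoszD intrD mulrDl mul1r addrA.
have lev := tower_levels br_entire br_nonzero br_three_term br0 F fa fb fc aE bE cE m0 m1 n0 rI.
have rel := tower_relations br_entire br_nonzero br_three_term br0 F fa fb fc aE bE cE
  omega_zero m0 m1 n0 tau0_ratio rI.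
pose tau := glue omega delta T.
have tauE n x : hyperplane (omega + n%:~R * delta) x -> tau x = T n x by exact: glueE.
have tau_gen n : eq_mero (hyperplane (omega + n%:~R * delta)) (T n) tau.
  by apply: generic_all => x /tauE.
have e0 : eq_mero (hyperplane omega) tau0 tau by have := tau_gen 0; rewrite K0.
have e1 : eq_mero (hyperplane (omega + delta)) tau1 tau by have := tau_gen 1; rewrite K1.
have neg n : n < 0 -> eq_mero (hyperplane (omega + n%:~R * delta)) tau (fun=> 0).
  by case: n => // n _; apply: generic_all => x /tauE.
exists tau; split=> //.
  split=> //.
  - apply/(mero_D omega delta_neq0) => -[n|n].
      by apply: mero_eq (tau_gen n) _; have [] := lev n.
    apply: mero_eq (mero_holo (holo_cst 0)).
    by apply: generic_imp (neg (Negz n) isT) => x _.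
  - exact: (org_of_relations br_entire br_nonzero br_three_term br0 delta_neq0 tauE).
  - move=> t0; apply: n0; apply: generic_imp2 e0 t0 => x _ -> .
    by [].
move=> tau' [tm' to' neg' _] e0' e1'; apply/(generic_D omega delta_neq0) => -[n|n]; last first.
  by apply: generic_imp2 (neg' (Negz n) isT) (neg (Negz n) isT) => x _ -> ->.
(* The recursion looks two levels back, so two consecutive components are compared at once. *)
suff [h _] : eq_mero (hyperplane (omega + n%:~R * delta)) tau' (T n) /\
    eq_mero (hyperplane (omega + n.+1%:~R * delta)) tau' (T n.+1).
  by apply: generic_imp2 h (tau_gen n) => x _ -> ->.
elim: n => [|n [h1 h2]].
  by rewrite K0 K1; split; [apply: generic_imp e0'|apply: generic_imp e1'].
split=> //.
have kd : omega + n.+1%:~R * delta - delta = omega + n%:~R * delta by rewrite KS addrK.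
have [mn mn1 _ nz] := lev n.
(* A zero component does not determine the component two levels up through relation II_1. In that
   case both functions vanish there, [tau'] by [org_zero_step], whose bracket is nonzero because n +
   2 is. *)
have [tz|tn] := mero_generic (@hyper_affine R _) mn.
  have tz1 := nz tz.
  have tz2 : eq_mero (hyperplane (omega + n.+2%:~R * delta)) (T n.+2) (fun=> 0).
    by have [_ _ _] := lev n.+1; apply.
  have t'1 : eq_mero (hyperplane (omega + n.+1%:~R * delta)) tau' (fun=> 0).
    by apply: generic_imp2 h2 tz1 => x _ t1 t2; exact: (etrans t1 t2).
  have SE : n.+1%:Z + 1 = n.+2%:Z by rewrite -PoszD addn1.
  have := org_zero_step br_entire br_nonzero delta_neq0 F fa fc to' tm' (n := n.+1).
  rewrite SE => /(_ (brK n.+2 isT) t'1) t'2.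
  by apply: generic_imp2 t'2 tz2 => x _ t1 t2; exact: (etrans t1 (esym t2)).
have tn' : generically (hyperplane (omega + n.+1%:~R * delta - delta)) (fun x => tau' x != 0).
  by rewrite kd; apply: generic_imp2 h1 tn => x _ ->.
have u1 := next_uniq br_entire br_nonzero F fa fb fc tn' (org_relII1 delta_neq0 F fa fb fc to' n.+1).
rewrite -kd in h1.
have u2 := next_eq br fa fb fc h1 h2.
rewrite (KS n.+1).
by apply: generic_imp2 u1 u2 => x _ -> ->.
Qed.
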